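(* There exists a randomized algorithm that, given $M\in\mathbb{R}^{n\times(d-1)}$, $b\in\mathbb{R}^n$, $p\in[1,2)$ and $\varepsilon>0$, with constant probability outputs $\hat x$ with $\|M\hat x-b\|_p\le(1+\varepsilon)\min_x\|Mx-b\|_p$, in time $$\tilde O\Big(\mathrm{nnz}(\bar M)+d^{7-p/2}+\phi\big(\tilde O(d^{2+p}/\varepsilon^2),d\big)\Big),$$ where $\bar M=[M,-b]\in\mathbb{R}^{n\times d}$.
   Context: Running time counts arithmetic operations in the real RAM model. $\mathrm{nnz}(\bar M)$ is the number of nonzero entries of $\bar M$. $\phi(t,d)$ denotes the time to solve an $\ell_p$-regression problem $\min_x\|Nx-c\|_p$ with $t$ rows in $d$ dimensions. $\tilde O(f)$ denotes $f\cdot\log^{O(1)}(f)$-type quantities (polylogarithmic factors suppressed). *)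

(* Defs.v *)
From HB Require Import structures.
From mathcomp Require Import all_boot all_order all_algebra.
From mathcomp Require Import all_classical all_reals all_analysis.

Set Implicit Arguments.
Unset Strict Implicit.
Unset Printing Implicit Defensive.

Import Order.TTheory GRing.Theory Num.Theory.
Import numFieldNormedType.Exports.

Local Open Scope classical_set_scope.
Local Open Scope ring_scope.

Section LpRegression.
Variable R : realType.

Definition lp_norm (p : R) (m : nat) (v : 'cV[R]_m) : R :=
  (\sum_(i < m) `|v i 0| `^ p) `^ p^-1.

(* The minimum is attained (p >= 1), so that the infimum is the minimum. *)
Definition lp_min (p : R) (m k : nat) (N : 'M[R]_(m, k)) (c : 'cV[R]_m) : R :=
  inf (range (fun x : 'cV[R]_k => lp_norm p (N *m x - c))).

Definition lp_solver := forall m k : nat, 'M[R]_(m, k) -> 'cV[R]_m -> 'cV[R]_k.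

Definition lp_solver_correct (p : R) (solve : lp_solver) : Prop :=
  forall (m k : nat) (N : 'M[R]_(m, k)) (c : 'cV[R]_m),
    lp_norm p (N *m solve m k N c - c) = lp_min p N c.

Definition nnz (m k : nat) (N : 'M[R]_(m, k)) : nat :=
  #|[set e : 'I_m * 'I_k | N e.1 e.2 != 0]|%SET.

Definition augmented (n d : nat) (M : 'M[R]_(n, d.-1)) (b : 'cV[R]_n) :
  'M[R]_(n, d.-1 + 1) := row_mx M (- b).

(* f log^e f up to the factor C; the shift keeps the logarithm positive for
   small f. *)
Definition polylog_bound (C : R) (e : nat) (f : R) : R :=
  C * f * ln (2 + f) ^+ e.

End LpRegression.

(* A randomized real RAM.  The memory consists of arrays of naturals and arrays
   of reals, all infinite and zero-initialized; array names are literals,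
   indices are computed.  Programs contain no real constants, and there is no
   rounding from reals to naturals.  As usual for the real RAM, the analytic
   functions exp and log are primitive (they are needed to form x ^ p for real
   p). *)

Inductive nexp : Type :=
| NConst of nat
| NLoad of nat & nexp
| NAdd of nexp & nexp
| NSub of nexp & nexp
| NMul of nexp & nexp.

Inductive rexp : Type :=
| RNat of nexp
| RLoad of nat & nexp
| RAdd of rexp & rexp
| RSub of rexp & rexp
| RMul of rexp & rexp
| RDiv of rexp & rexp
| RExp of rexp
| RLn of rexp.

Inductive guard : Type :=
| NLt of nexp & nexp
| RLt of rexp & rexp.

(* Regress t k aN ac ax solves the regression problem with the t x k matrix
   stored row by row in real array aN and the right-hand side in real array ac,
   and writes a solution to real array ax. *)
Inductive cmd : Type :=
| Skip
| NStore of nat & nexp & nexp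
| RStore of nat & nexp & rexp
| Draw of nat & nexp
| Regress of nexp & nexp & nat & nat & nat
| Seq of cmd & cmd
| If of guard & cmd & cmd
| While of guard & cmd.

Fixpoint ncost (e : nexp) : nat :=
  match e with
  | NConst _ => 1
  | NLoad _ i => (ncost i).+1
  | NAdd e1 e2 | NSub e1 e2 | NMul e1 e2 => (ncost e1 + ncost e2).+1
  end.

Fixpoint rcost (e : rexp) : nat :=
  match e with
  | RNat i | RLoad _ i => (ncost i).+1
  | RAdd e1 e2 | RSub e1 e2 | RMul e1 e2 | RDiv e1 e2 =>
      (rcost e1 + rcost e2).+1
  | RExp e1 | RLn e1 => (rcost e1).+1
  end.

Definition gcost (g : guard) : nat :=
  match g with
  | NLt e1 e2 => (ncost e1 + ncost e2).+1
  | RLt e1 e2 => (rcost e1 + rcost e2).+1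
  end.

Section Semantics.
Variable R : realType.

Record state : Type := State {
  nmem : nat -> nat -> nat;
  rmem : nat -> nat -> R;
  draws : nat;
  time : nat }.

Definition upd (T : Type) (mem : nat -> nat -> T) (a i : nat) (v : T) :
  nat -> nat -> T :=
  fun a' i' => if (a' == a) && (i' == i) then v else mem a' i'.

Definition tick (c : nat) (s : state) : state :=
  State (nmem s) (rmem s) (draws s) (time s + c).

Fixpoint neval (s : state) (e : nexp) : nat :=
  match e with
  | NConst c => c
  | NLoad a i => nmem s a (neval s i)
  | NAdd e1 e2 => neval s e1 + neval s e2
  | NSub e1 e2 => neval s e1 - neval s e2
  | NMul e1 e2 => neval s e1 * neval s e2
  end.

Fixpoint reval (s : state) (e : rexp) : R :=
  match e with
  | RNat i => (neval s i)%:R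
  | RLoad a i => rmem s a (neval s i)
  | RAdd e1 e2 => reval s e1 + reval s e2
  | RSub e1 e2 => reval s e1 - reval s e2
  | RMul e1 e2 => reval s e1 * reval s e2
  | RDiv e1 e2 => reval s e1 / reval s e2
  | RExp e1 => expR (reval s e1)
  | RLn e1 => ln (reval s e1)
  end.

Definition geval (s : state) (g : guard) : bool :=
  match g with
  | NLt e1 e2 => (neval s e1 < neval s e2)%N
  | RLt e1 e2 => reval s e1 < reval s e2
  end.

Definition read_mx (s : state) (a m k : nat) : 'M[R]_(m, k) :=
  \matrix_(i, j) rmem s a (i * k + j)%N.

Definition read_cv (s : state) (a m : nat) : 'cV[R]_m :=
  \col_i rmem s a i.

Definition write_cv (mem : nat -> nat -> R) (a m : nat) (x : 'cV[R]_m) :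
  nat -> nat -> R :=
  fun a' i => if a' == a
              then if (insub i : option 'I_m) is Some j then x j 0 else mem a' i
              else mem a' i.

(* phi m k is the time charged for a call to solve on an m x k problem; the
   random source is the sequence u, consumed in order. *)
Variables (phi : nat -> nat -> nat) (solve : lp_solver R) (u : nat -> R).

Inductive exec : cmd -> state -> state -> Prop :=
| exec_Skip s : exec Skip s s
| exec_NStore a i e s :
    exec (NStore a i e) s
      (State (upd (nmem s) a (neval s i) (neval s e)) (rmem s) (draws s)
             (time s + (ncost i + ncost e).+1))
| exec_RStore a i e s :
    exec (RStore a i e) s
      (State (nmem s) (upd (rmem s) a (neval s i) (reval s e)) (draws s)
             (time s + (ncost i + rcost e).+1))
| exec_Draw a i s :
    exec (Draw a i) s
      (State (nmem s) (upd (rmem s) a (neval s i) (u (draws s))) (draws s).+1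
             (time s + (ncost i).+1))
| exec_Regress em ek aN ac ax s (m := neval s em) (k := neval s ek) :
    exec (Regress em ek aN ac ax) s
      (State (nmem s)
             (write_cv (rmem s) ax
                (solve (read_mx s aN m k) (read_cv s ac m)))
             (draws s)
             (time s + (ncost em + ncost ek + phi m k).+1))
| exec_Seq c1 c2 s s1 s2 :
    exec c1 s s1 -> exec c2 s1 s2 -> exec (Seq c1 c2) s s2
| exec_If g c1 c2 s s1 :
    exec (if geval s g then c1 else c2) (tick (gcost g).+1 s) s1 ->
    exec (If g c1 c2) s s1
| exec_While_false g c s :
    ~~ geval s g -> exec (While g c) s (tick (gcost g).+1 s)
| exec_While_true g c s s1 s2 :
    geval s g -> exec c (tick (gcost g).+1 s) s1 ->
    exec (While g c) s1 s2 -> exec (While g c) s s2.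

End Semantics.

Section InputOutput.
Variable R : realType.

(* entries lists the positions of the nonzero entries of N, in any order. *)
Definition sparse_listing (m k : nat) (N : 'M[R]_(m, k))
    (entries : seq ('I_m * 'I_k)) : Prop :=
  uniq entries /\ forall e, (e \in entries) = (N e.1 e.2 != 0).

(* Layout: natural array 0 holds n, d and the number of listed entries, natural
   arrays 1 and 2 their rows and columns; real array 0 holds p and eps, real
   array 1 the values of the listed entries. *)
Definition input_state (n d : nat) (N : 'M[R]_(n, d.-1 + 1)) (p eps : R)
    (entries : seq ('I_n * 'I_(d.-1 + 1))) : state R :=
  State
    (fun a => match a with
              | 0 => nth 0%N [:: n; d; size entries]
              | 1 => nth 0%N [seq nat_of_ord e.1 | e <- entries]
              | 2 => nth 0%N [seq nat_of_ord e.2 | e <- entries]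
              | _ => fun=> 0%N
              end)
    (fun a => match a with
              | 0 => nth 0 [:: p; eps]
              | 1 => nth 0 [seq N e.1 e.2 | e <- entries]
              | _ => fun=> 0
              end)
    0 0.

Definition output (k : nat) (s : state R) : 'cV[R]_k := read_cv s 2 k.

End InputOutput.

(* Equality on all initial segments covers every finite subfamily: take
   A k = setT outside of it. *)
Definition iid_uniform01 (R : realType) (disp : measure_display)
    (T : measurableType disp) (P : probability T R) (U : nat -> {RV P >-> R}) :
  Prop :=
  (forall (k : nat) (A : set R), measurable A ->
     distribution P (U k) A = uniform_prob (@ltr01 R) A) /\
  (forall (N : nat) (A : nat -> set R), (forall k, measurable (A k)) ->
     P (\bigcap_(k in `I_N) (U k @^-1` A k)) =
     (\prod_(k < N) P (U k @^-1` A k))%E).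

(* Main.v *)
Require Import Defs.
From HB Require Import structures.
From mathcomp Require Import all_boot all_order all_algebra.
From mathcomp Require Import all_classical all_reals all_analysis.
From mathcomp Require Import ring lra zify.

Set Implicit Arguments.
Unset Strict Implicit.
Unset Printing Implicit Defensive.

Import Order.TTheory GRing.Theory Num.Theory.
Import numFieldNormedType.Exports.

Local Open Scope classical_set_scope.
Local Open Scope ring_scope.

(* Homogenize: minimize F(x) = sum_i |a_i x|^p over the vectors x with last
   coordinate 1, the a_i being the nonzero rows of [M, -b].  For positive
   v_1, ..., v_n let q_v(x) = sum_i v_i^(-(1-p/2)) (a_i x)^2 and maintain the
   invariant (a_i x)^2 <= v_i q_v(x) for all i and x, starting from v = 1.  A
   round compresses the reweighted rows by CountSketch, orthonormalizes the
   coordinate functionals for the sketched form by Gram-Schmidt, estimates the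
   leverage scores by random sign projections, and replaces v_i by the minimum
   of v_i and a constant multiple of the estimate.  Since v only decreases,
   q_v only increases and the invariant survives; and since
   sqrt r <= 1/4 + r, the expectation of S(v) = sum_i v_i^(p/2) satisfies
   S' <= S/4 + O(d), so that S = O(d) after log n rounds.

   The invariant makes F and q_v^(p/2) equivalent up to a factor S^(1-p/2), so
   the last Gram-Schmidt vector, which minimizes the sketched form, is an
   O(sqrt d)-approximate solution.  It is good enough if eps^2 >= 2304 d.
   Otherwise each row is kept with probability 2^-J_i, about N v_i^(p/2) with
   N of order d / min(1, eps)^2, and the sampled problem is solved.  The error
   sup |F_sample - F| over the ball q_v <= 1 is controlled by revealing the
   J_i coins of every row one level at a time: each level is a Rademacher
   process, the contraction principle replaces |t|^p by a linear function, and
   the resulting bounds decrease geometrically with the level.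

   The algorithm uses its random reals only through the independent fair coins
   [U k < 1/2], of which finitely many matter. *)

(** * Expectations over fair coins *)

(** The invariant is one-sided: [v] only has to dominate the leverage scores of its own reweighted
    rows, so no fixed point is approximated. Underestimates must be excluded with high probability;
    overestimates only enlarge S(v) and are paid for in expectation.

    The guarantee for the sample is relative to min(1, eps), so its size stays of order d^2 for
    large eps, while the allowed size d^(2+p) / eps^2 tends to 0. This obstacle is why a preliminary
    solution exists. As S(v) <= 144 d = (12 sqrt d)^2, that solution is within a factor 48 sqrt d of
    the optimum, whence the threshold 48^2 d.

    The time bound must hold for every outcome, so the program compares the sample size with a cap
    before it calls the solver; only the quality of the output is random.

    Keeping probabilities are powers of 2 so that a row survives exactly when all of its J_i coins
    show heads: this can be executed without rounding, and it is the form that the level-by-level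
    analysis needs. Since all estimates are finite averages over coins, a bad point of the ball may
    be chosen freely for every outcome, and no supremum has to be measurable. *)

Section CoinExpectation.
Variable R : realType.

Definition scons (b : bool) (c : nat -> bool) : nat -> bool :=
  fun k => if k is k'.+1 then c k' else b.

Definition flip (k : nat) (c : nat -> bool) : nat -> bool :=
  fun j => if j == k then ~~ c j else c j.

Definition scat (M : nat) (c c' : nat -> bool) : nat -> bool :=
  fun k => if (k < M)%N then c k else c' (k - M)%N.

(** Recursive, so that [f] may be any function of an infinite sequence; coins from [N] on are read
    as [false]. *)
Fixpoint coinE (N : nat) (f : (nat -> bool) -> R) : R :=
  if N is N'.+1 then
    (coinE N' (fun c => f (scons true c)) +
     coinE N' (fun c => f (scons false c))) / 2
  else f (fun=> false).

Definition sgc (b : bool) : R := if b then 1 else -1.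

Lemma sgcN b : sgc (~~ b) = - sgc b.
Proof. by case: b => /=; rewrite ?opprK. Qed.

Lemma sgc_sqr b : sgc b ^+ 2 = 1.
Proof. by case: b; rewrite /sgc ?sqrrN expr1n. Qed.

Lemma le_coinE N f g : (forall c, f c <= g c) -> coinE N f <= coinE N g.
Proof.
elim: N f g => [|N IH] f g fg /=; first exact: fg.
by rewrite ler_pM2r ?invr_gt0// lerD//; apply: IH => c; exact: fg.
Qed.

Lemma eq_coinE N f g : (forall c, f c = g c) -> coinE N f = coinE N g.
Proof. by move=> fg; congr coinE; exact/funext. Qed.

Lemma coinE_cst N x : coinE N (fun=> x) = x.
Proof. by elim: N => //= N ->; field. Qed.

Lemma coinED N f g : coinE N (fun c => f c + g c) = coinE N f + coinE N g.
Proof. by elim: N f g => //= N IH f g; rewrite !IH; field. Qed.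

Lemma coinEZ N x f : coinE N (fun c => x * f c) = x * coinE N f.
Proof. by elim: N f => //= N IH f; rewrite !IH; field. Qed.

Lemma coinE_sum N I (r : seq I) (f : I -> (nat -> bool) -> R) :
  coinE N (fun c => \sum_(i <- r) f i c) = \sum_(i <- r) coinE N (f i).
Proof.
elim: r => [|i r IH].
  by rewrite big_nil -[RHS](coinE_cst N); apply: eq_coinE => c; rewrite big_nil.
rewrite big_cons -IH -coinED.
by apply: eq_coinE => c; rewrite big_cons.
Qed.

Lemma coinE_ge0 N f : (forall c, 0 <= f c) -> 0 <= coinE N f.
Proof. by move=> f0; rewrite -(coinE_cst N 0); exact: le_coinE. Qed.

Lemma flipE k c : flip k c k = ~~ c k.
Proof. by rewrite /flip eqxx. Qed.

Lemma flip_neq k j c : j != k -> flip k c j = c j.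
Proof. by rewrite /flip => /negbTE ->. Qed.

Lemma flipK k : involutive (flip k).
Proof.
by move=> c; apply/funext => j; rewrite /flip; case: eqVneq => //; rewrite negbK.
Qed.

(** Flipping one coin preserves the average; every symmetrization below rests on this. *)
Lemma coinE_flip N k f : (k < N)%N -> coinE N (fun c => f (flip k c)) = coinE N f.
Proof.
elim: N k f => [//|N IH] [|k] f kN /=.
  have E b c : flip 0 (scons b c) = scons (~~ b) c by apply/funext => -[].
  rewrite addrC; congr ((_ + _) / _); apply: eq_coinE => c; by rewrite E.
have E b c : flip k.+1 (scons b c) = scons b (flip k c).
  by apply/funext => -[].
congr ((_ + _) / _).
  rewrite -(IH k (fun c => f (scons true c)))//.
  by apply: eq_coinE => c; rewrite E.
rewrite -(IH k (fun c => f (scons false c)))//.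
by apply: eq_coinE => c; rewrite E.
Qed.

Lemma coinE_flip_half N k f : (k < N)%N ->
  coinE N f = coinE N (fun c => (f c + f (flip k c)) / 2).
Proof.
move=> kN; rewrite [RHS](@eq_coinE N _ (fun c => 2^-1 * (f c + f (flip k c)))); last first.
  by move=> c; rewrite mulrC.
by rewrite coinEZ coinED (coinE_flip f kN); field.
Qed.

Lemma coinE_odd N k f : (k < N)%N -> (forall c, f (flip k c) = - f c) ->
  coinE N f = 0.
Proof.
move=> kN fN; rewrite (coinE_flip_half f kN) -[RHS](coinE_cst N).
by apply: eq_coinE => c; rewrite fN subrr mul0r.
Qed.

(** The factor is 0 or 2 with equal probability: dropping at random and doubling what is kept is
    unbiased. *)
Lemma coinE_1Dsg N k f : (k < N)%N -> (forall c, f (flip k c) = f c) ->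
  coinE N (fun c => (1 + sgc (c k)) * f c) = coinE N f.
Proof.
move=> kN fN; rewrite (coinE_flip_half _ kN).
by apply: eq_coinE => c; rewrite flipE sgcN fN; field.
Qed.

Lemma coinE_cat M N f :
  coinE (M + N) f = coinE M (fun c => coinE N (fun c' => f (scat M c c'))).
Proof.
elim: M f => [|M IH] f /=.
  rewrite add0n; apply: eq_coinE => c; congr f; apply/funext => k.
  by rewrite /scat subn0.
have E b c c' : scons b (scat M c c') = scat M.+1 (scons b c) c'.
  by apply/funext => -[|k].
by congr ((_ + _) / _); rewrite IH; apply: eq_coinE => c;
  apply: eq_coinE => c'; rewrite E.
Qed.

Definition ind (P : Prop) : R := `[< P >]%:R.

Lemma ind_ge0 P : 0 <= ind P. Proof. exact: ler0n. Qed.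

Lemma ind_le1 P : ind P <= 1. Proof. by rewrite /ind lern1; case: asbool. Qed.

Lemma indT (P : Prop) : P -> ind P = 1.
Proof. by rewrite /ind => /asboolP ->. Qed.

Lemma indF (P : Prop) : ~ P -> ind P = 0.
Proof. by rewrite /ind; case: asboolP. Qed.

Lemma ind_le (P : Prop) x : 0 <= x -> (P -> 1 <= x) -> ind P <= x.
Proof. by move=> x0 Px; rewrite /ind; case: asboolP => //= /Px. Qed.

Lemma ind_not (P : Prop) : ind (~ P) = 1 - ind P.
Proof.
case: (EM P) => h; last by rewrite indT// indF// subr0.
by rewrite (indT h) indF ?subrr.
Qed.

End CoinExpectation.

(** * From uniform random variables to fair coins *)

Section CoinProbability.
Context (R : realType) (disp : measure_display) (T : measurableType disp).
Variables (P : probability T R) (U : nat -> {RV P >-> R}).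
Hypothesis iidU : iid_uniform01 U.

Definition coin (w : T) (k : nat) : bool := U k w < 2^-1.

Let half (b : bool) : set R :=
  if b then [set x : R | x < 2^-1] else [set x : R | ~~ (x < 2^-1)].

Let measurable_half b : measurable (half b).
Proof.
case: b; rewrite /half.
  rewrite (_ : [set x | _] = `]-oo, 2^-1[%classic); first exact: measurable_itv.
  by apply/seteqP; split => x /=; rewrite in_itv.
rewrite (_ : [set x | _] = `[2^-1, +oo[%classic); first exact: measurable_itv.
by apply/seteqP; split => x /=; rewrite in_itv/= andbT -leNgt.
Qed.

Let uniform_half b : uniform_prob (@ltr01 R) (half b) = 2^-1%:E.
Proof.
have pT : uniform_prob (@ltr01 R) (half true) = 2^-1%:E.
  rewrite /uniform_prob integral_uniform_pdf.
  rewrite (_ : half true `&` `[0, 1] = `[0, 2^-1[%classic); last first.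
    apply/seteqP; split => x /=; rewrite !in_itv/=.
      by move=> [-> /andP[-> _]].
    by move=> /andP[-> h]; split => //=; lra.
  rewrite (eq_integral (fun=> 1%E)); last first.
    move=> x; rewrite inE/= in_itv/= /uniform_pdf => /andP[x0 x1].
    by rewrite ifT ?subr0 ?invr1//; lra.
  rewrite integral_cst//= mul1e lebesgue_measure_itv/= lte_fin.
  by rewrite invr_gt0 ltr0n/= oppr0 adde0.
case: b => //.
have -> : half false = ~` half true.
  by apply/seteqP; split => x /=; [move/negP|move=> /negP].
rewrite probability_setC; last exact: (measurable_half true).
transitivity (1 - (2^-1 : R)%:E)%E; first by congr (1 - _)%E.
by rewrite -EFinB; congr EFin; field.
Qed.

Let cyl (M : nat) (beta : nat -> bool) : set T :=
  [set w | forall k, (k < M)%N -> coin w k = beta k].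

Let cylE M beta :
  cyl M beta = \bigcap_(k in `I_M) (U k @^-1` half (beta k)).
Proof.
apply/seteqP; split => w /= h k kM; move: (h k kM); rewrite /coin /half;
  by case: (beta k) => //= h'; first [by rewrite h'|exact/negbTE].
Qed.

Let measurable_cyl M beta : measurable (cyl M beta).
Proof.
rewrite cylE; apply: bigcap_measurableType => k _.
by rewrite -[X in measurable X]setTI; apply: (measurable_funPT (U k)).
Qed.

Let prob_cyl M beta : P (cyl M beta) = ((2^-1) ^+ M)%:E.
Proof.
rewrite cylE iidU.2//.
rewrite (eq_bigr (fun=> 2^-1%:E)); last first.
  move=> k _; rewrite -(uniform_half (beta k)) -(iidU.1 k)//.
elim: M => [|M IH]; first by rewrite big_ord0.
by rewrite big_ord_recr/= IH -EFinM exprSr.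
Qed.

(** One implication is enough, since agreement on the first [N] coins is symmetric. *)
Definition coin_local (N : nat) (G : (nat -> bool) -> Prop) : Prop :=
  forall c c', (forall k, (k < N)%N -> c k = c' k) -> G c -> G c'.

(** Induction on the number [N] of coins still free: the cylinder is split by the value of coin [M].
    The event becomes a finite union of cylinders, which gives measurability along with the
    probability. *)
Let prob_cylI N : forall M beta G, coin_local (M + N) G ->
  measurable (cyl M beta `&` [set w | G (coin w)]) /\
  P (cyl M beta `&` [set w | G (coin w)]) =
    (2^-1 ^+ M * coinE N (fun c => ind R (G (scat M beta c))))%:E.
Proof.
elim: N => [|N IH] M beta G locG.
  rewrite addn0 in locG; rewrite /=.
  have agree w : cyl M beta w -> forall k, (k < M)%N ->
      coin w k = scat M beta (fun=> false) k.
    by move=> h k kM; rewrite /scat kM h.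
  case: (EM (G (scat M beta (fun=> false)))) => hG.
    rewrite indT// mulr1 (_ : _ `&` _ = cyl M beta); first by split.
    apply/seteqP; split => w /=; [by move=> []|move=> h].
    by split => //; apply: locG hG => k kM; rewrite (agree w).
  rewrite indF// mulr0 (_ : _ `&` _ = set0); first by rewrite measure0.
  apply/seteqP; split => w [] //= h h'; apply: hG.
  by apply: locG h' => k kM; exact: agree.
pose be b := scat M beta (fun=> b).
have cylS b : cyl M.+1 (be b) = cyl M beta `&` [set w | coin w M = b].
  apply/seteqP; split => w /=.
    move=> h; split => [k kM|]; first by rewrite h 1?ltnW// /be /scat kM.
    by rewrite h// /be /scat ltnn.
  move=> [h hM] k; rewrite ltnS leq_eqVlt => /predU1P[->|kM].
    by rewrite hM /be /scat ltnn.
  by rewrite h// /be /scat kM.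
have -> : cyl M beta `&` [set w | G (coin w)] =
    (cyl M.+1 (be true) `&` [set w | G (coin w)]) `|`
    (cyl M.+1 (be false) `&` [set w | G (coin w)]).
  rewrite !cylS; apply/seteqP; split => w /=.
    by move=> [h g]; case E : (coin w M); [left|right].
  by move=> [[[h _] g]|[[h _] g]].
have locG' : coin_local (M.+1 + N) G by rewrite addSnnS.
have [mt Pt] := IH _ (be true) _ locG'.
have [mf Pf] := IH _ (be false) _ locG'.
split; first exact: measurableU.
transitivity (P (cyl M.+1 (be true) `&` [set w | G (coin w)]) +
              P (cyl M.+1 (be false) `&` [set w | G (coin w)]))%E.
  apply: measureU => //; rewrite !cylS; apply/seteqP; split => w //=.
  by move=> [[[_ h1] _] [[_ h2] _]]; rewrite h1 in h2.
rewrite Pt Pf -EFinD /=; congr EFin.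
have E b c : scat M.+1 (be b) c = scat M beta (scons b c).
  apply/funext => k; rewrite /be /scat /scons ltnS leq_eqVlt.
  case: eqVneq => [->|kM] /=; first by rewrite ltnn subnn.
  by case: ltnP => // Mk; rewrite (_ : (k - M)%N = (k - M.+1).+1)//; lia.
rewrite exprS; under eq_coinE do rewrite E.
by under [in X in _ + X]eq_coinE do rewrite E; field.
Qed.

Lemma prob_coin N G : coin_local N G ->
  measurable [set w | G (coin w)] /\
  P [set w | G (coin w)] = (coinE N (fun c => ind R (G c)))%:E.
Proof.
move=> locG; have := @prob_cylI N 0 (fun=> false) G locG.
have -> : cyl 0 (fun=> false) `&` [set w | G (coin w)] = [set w | G (coin w)].
  by apply/seteqP; split => w //= [].
rewrite expr0 mul1r => -[? ->]; split => //; congr EFin.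
by apply: eq_coinE => c; congr (ind _ (G _)); apply/funext => k;
  rewrite /scat subn0.
Qed.

End CoinProbability.

(** * Gram-Schmidt and sketching *)

Section GramSchmidt.
Variable R : realType.

(** Cauchy-Schwarz, from Lagrange's identity. *)
Lemma sumr_sqr_le (n : nat) (a b : nat -> R) :
  (\sum_(i < n) a i * b i) ^+ 2 <=
  (\sum_(i < n) a i ^+ 2) * (\sum_(i < n) b i ^+ 2).
Proof.
have h : 0 <= \sum_(i < n) \sum_(j < n) (a i * b j - a j * b i) ^+ 2.
  by apply: sumr_ge0 => i _; apply: sumr_ge0 => j _; exact: sqr_ge0.
have E : \sum_(i < n) \sum_(j < n) (a i * b j - a j * b i) ^+ 2 =
    2 * ((\sum_(i < n) a i ^+ 2) * (\sum_(i < n) b i ^+ 2)) -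
    2 * (\sum_(i < n) a i * b i) ^+ 2.
  under eq_bigr => i _.
    rewrite (eq_bigr (fun j : 'I_n => a i ^+ 2 * b j ^+ 2 +
       b i ^+ 2 * a j ^+ 2 - (2 * (a i * b i)) * (a j * b j))); last first.
      by move=> j _; ring.
    rewrite big_split sumrN big_split/= -!mulr_sumr.
    over.
  rewrite big_split sumrN big_split/= -!mulr_suml -mulr_sumr; ring.
by rewrite E in h; lra.
Qed.

Variable d : nat.

Definition mulv (X : nat -> nat -> R) (x : nat -> R) (r : nat) : R :=
  \sum_(a < d) X r a * x a.

Definition ip (m : nat) (X : nat -> nat -> R) (x y : nat -> R) : R :=
  \sum_(r < m) mulv X x r * mulv X y r.

Definition gram (m : nat) (X : nat -> nat -> R) (a b : nat) : R :=
  \sum_(r < m) X r a * X r b.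

Definition basisv (j : nat) : nat -> R := fun a => (a == j)%:R.

Lemma mulv_lin X k (c : nat -> R) (y : nat -> nat -> R) x r :
  mulv X (fun a => x a + \sum_(l < k) c l * y l a) r =
  mulv X x r + \sum_(l < k) c l * mulv X (y l) r.
Proof.
rewrite /mulv; under eq_bigr do rewrite mulrDr.
rewrite big_split/=; congr (_ + _).
under eq_bigr do rewrite mulr_sumr.
rewrite exchange_big/=; apply: eq_bigr => l _; rewrite mulr_sumr.
by apply: eq_bigr => a _; ring.
Qed.

Lemma mulvZ X c x r : mulv X (fun a => c * x a) r = c * mulv X x r.
Proof. by rewrite /mulv mulr_sumr; apply: eq_bigr => a _; ring. Qed.

Lemma mulv0 X r : mulv X (fun=> 0) r = 0.
Proof. by rewrite /mulv big1// => a _; rewrite mulr0. Qed.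

Lemma eq_mulv X x y r : (forall a, (a < d)%N -> x a = y a) ->
  mulv X x r = mulv X y r.
Proof. by move=> xy; apply: eq_bigr => a _; rewrite xy. Qed.

Lemma mulv_basis X j r : (j < d)%N -> mulv X (basisv j) r = X r j.
Proof.
move=> jd; rewrite /mulv (bigD1 (Ordinal jd))//= /basisv eqxx mulr1.
by rewrite big1 ?addr0// => a /negbTE; rewrite -val_eqE/= => ->; rewrite mulr0.
Qed.

Lemma ipC m X x y : ip m X x y = ip m X y x.
Proof. by apply: eq_bigr => r _; rewrite mulrC. Qed.

Lemma ip_ge0 m X x : 0 <= ip m X x x.
Proof. by apply: sumr_ge0 => r _; rewrite -expr2 sqr_ge0. Qed.

Lemma ip0l m X x y : (forall a, x a = 0) -> ip m X x y = 0.
Proof.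
move=> x0; rewrite /ip big1// => r _.
by rewrite (@eq_mulv _ x (fun=> 0)) ?mulv0 ?mul0r// => a _.
Qed.

Lemma ip_eq0 m X x r : ip m X x x = 0 -> (r < m)%N -> mulv X x r = 0.
Proof.
move=> /eqP; rewrite psumr_eq0; last by move=> i _; rewrite -expr2 sqr_ge0.
move=> /allP h rm; have := h (Ordinal rm) (mem_index_enum _) => /=.
by rewrite mulf_eq0 orbb => /eqP.
Qed.

(** These formulas read only the Gram matrix [Q], which is all that the program has. For
    [Q = gram m X] they are the inner product of column [l] with the [j]-th coordinate vector, the
    residual of that vector, and the squared length of the residual. *)
Definition gsy (Q B : nat -> nat -> R) (j l : nat) : R :=
  \sum_(b < d) B b l * Q b j.

Definition gsf (Q B : nat -> nat -> R) (j a : nat) : R :=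
  basisv j a - \sum_(l < d) B a l * gsy Q B j l.

Definition gsnu (Q B : nat -> nat -> R) (j : nat) : R :=
  \sum_(a < d) gsf Q B j a * Q a j.

(* Columns are Q-unit vectors or 0, as Q may be singular. *)
Fixpoint gs (Q : nat -> nat -> R) (j : nat) : nat -> nat -> R :=
  if j is j'.+1 then
    let B := gs Q j' in
    fun a l => if l == j' then
                 if 0 < gsnu Q B j' then
                   gsf Q B j' a / expR (ln (gsnu Q B j') / 2)
                 else 0
               else B a l
  else fun _ _ => 0.

Variables (m : nat) (X : nat -> nat -> R).
Let Q := gram m X.
Let col (B : nat -> nat -> R) l : nat -> R := fun a => B a l.

Let sum_gram (x : nat -> R) j : (j < d)%N ->
  \sum_(b < d) x b * Q b j = ip m X x (basisv j).
Proof.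
move=> jd; rewrite /Q /gram; under eq_bigr do rewrite mulr_sumr.
rewrite exchange_big/=; apply: eq_bigr => r _.
rewrite mulv_basis// /mulv mulr_suml; apply: eq_bigr => a _; ring.
Qed.

(** [gs_span] speaks of images under [X]: the form may be degenerate, and then the coordinate
    vectors themselves need not lie in the span of the columns. *)
Record gs_inv (j : nat) (B : nat -> nat -> R) : Prop := GsInv {
  gs_orth : forall l l', l != l' -> ip m X (col B l) (col B l') = 0;
  gs_unit : forall l, ip m X (col B l) (col B l) = 1 \/ forall a, B a l = 0;
  gs_supp : forall l a, (j <= l)%N -> B a l = 0;
  gs_tri : forall l a, (l < a)%N -> B a l = 0;
  gs_span : forall j' r, (j' < j)%N -> (r < m)%N ->
    X r j' = \sum_(l < d) ip m X (col B l) (basisv j') * mulv X (col B l) r }.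

Section Step.
Variables (j : nat) (B : nat -> nat -> R).
Hypotheses (jd : (j < d)%N) (BP : gs_inv j B).
Let f := gsf Q B j.

Let mulv_f r : mulv X f r =
  X r j - \sum_(l < d) gsy Q B j l * mulv X (col B l) r.
Proof.
rewrite -(mulv_basis X r jd) -sumrN.
under [in RHS]eq_bigr do rewrite -mulNr.
rewrite -(mulv_lin X d (fun l => - gsy Q B j l) (col B)).
apply: eq_mulv => a _; rewrite /f /gsf -sumrN; congr (_ + _).
by apply: eq_bigr => l _; rewrite /col; ring.
Qed.

Let gsyE l : gsy Q B j l = ip m X (col B l) (basisv j).
Proof. by rewrite -sum_gram. Qed.

Lemma gsf_orth l : ip m X f (col B l) = 0.
Proof.
case: (ltnP l d) => ld; last first.
  rewrite ipC; apply: ip0l => a; apply: (gs_supp BP).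
  exact: leq_trans (ltnW jd) ld.
rewrite {1}/ip; under eq_bigr do rewrite mulv_f mulrBl mulr_suml.
rewrite sumrB exchange_big/=.
rewrite (bigD1 (Ordinal ld))//= [X in _ - (_ + X)]big1 ?addr0; last first.
  move=> l' ll'; under eq_bigr do rewrite -mulrA.
  rewrite -mulr_sumr [X in _ * X](gs_orth BP) ?mulr0//.
under [X in _ - X]eq_bigr do rewrite -mulrA.
rewrite -mulr_sumr gsyE.
have -> : \sum_(i < m) X i j * mulv X (col B l) i = ip m X (col B l) (basisv j).
  by rewrite ipC; apply: eq_bigr => r _; rewrite mulv_basis.
case: (gs_unit BP l) => h; last by rewrite !ip0l// mul0r subr0.
by rewrite -/(ip m X (col B l) (col B l)) h mulr1 subrr.
Qed.

(** The residual differs from the [j]-th coordinate vector by a combination of columns, and it is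
    orthogonal to all of them. *)
Lemma gsnuE : gsnu Q B j = ip m X f f.
Proof.
rewrite /gsnu -/f (sum_gram f jd).
have -> : ip m X f (basisv j) =
    ip m X f f + \sum_(l < d) gsy Q B j l * ip m X f (col B l).
  rewrite /ip; under [in X in _ = _ + X]eq_bigr do rewrite mulr_sumr.
  rewrite exchange_big -big_split/=; apply: eq_bigr => r _.
  rewrite mulv_basis//.
  under eq_bigr do rewrite mulrCA.
  by rewrite -mulr_sumr -mulrDr {3}mulv_f subrK.
by rewrite big1 ?addr0// => l _; rewrite gsf_orth mulr0.
Qed.

Lemma gsf_orth_basis j' : (j' < j)%N -> ip m X f (basisv j') = 0.
Proof.
move=> j'j; have j'd := ltn_trans j'j jd.
rewrite /ip; under eq_bigr => r _ do
  rewrite mulv_basis// (gs_span BP j'j (ltn_ord r)) mulr_sumr.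
rewrite exchange_big/= big1// => l _.
under eq_bigr do rewrite mulrCA.
by rewrite -mulr_sumr [X in _ * X]gsf_orth mulr0.
Qed.

Lemma gsf_tri a : (j < a)%N -> f a = 0.
Proof.
move=> ja; rewrite /f /gsf /basisv gtn_eqF// sub0r big1 ?oppr0// => l _.
case: (ltnP l a) => la; first by rewrite (gs_tri BP) ?mul0r.
by rewrite (gs_supp BP) ?mul0r// (leq_trans (ltnW ja)).
Qed.

(** By triangularity. For the last index it says that the residual is an admissible point of the
    homogenized problem. *)
Lemma gsf_diag : f j = 1.
Proof.
rewrite /f /gsf /basisv eqxx big1 ?subr0// => l _.
case: (ltnP l j) => la; first by rewrite (gs_tri BP) ?mul0r.
by rewrite (gs_supp BP) ?mul0r.
Qed.

Lemma gs_step : gs_inv j.+1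
  (fun a l => if l == j then
     if 0 < gsnu Q B j then f a / expR (ln (gsnu Q B j) / 2) else 0
   else B a l).
Proof.
set nu := gsnu Q B j; set B' := fun a l => _.
pose sc := if 0 < nu then (expR (ln nu / 2))^-1 else 0.
have B'j a : B' a j = sc * f a.
  by rewrite /B' eqxx /sc; case: ifP => _; rewrite ?mul0r// mulrC.
have colj : col B' j = fun a => sc * f a by apply/funext.
have coln l : l != j -> col B' l = col B l.
  by move=> lj; apply/funext => a; rewrite /col /B' (negbTE lj).
have ip_scl x c y : ip m X (fun a => c * x a) y = c * ip m X x y.
  by rewrite /ip mulr_sumr; apply: eq_bigr => r _; rewrite mulvZ mulrA.
have nu0 : 0 <= nu by rewrite /nu gsnuE ip_ge0.
have sc1 : 0 < nu -> sc ^+ 2 * nu = 1.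
  move=> nu1; rewrite /sc nu1 exprVn -expRM_natl mulrCA mulfV// mulr1.
  by rewrite lnK ?posrE// mulVf// gt_eqF.
split.
- move=> l l' ll'; case: (eqVneq l j) => [lj|lj].
    have l'j : l' != j by rewrite -lj eq_sym.
    by rewrite lj colj ip_scl coln// gsf_orth mulr0.
  case: (eqVneq l' j) => [->|l'j].
    by rewrite ipC colj ip_scl coln// gsf_orth mulr0.
  by rewrite !coln// (gs_orth BP).
- move=> l; case: (eqVneq l j) => [->|lj]; last first.
    by rewrite coln//; case: (gs_unit BP l); [left|right => a; rewrite /B' (negbTE lj)].
  case: (ltP 0 nu) => nu1; last first.
    by right => a; rewrite B'j /sc ltNge nu1 mul0r.
  by left; rewrite colj ip_scl ipC ip_scl -gsnuE mulrA -expr2 sc1.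
- move=> l a jl; rewrite /B' gtn_eqF//; apply: (gs_supp BP); exact: ltnW.
- move=> l a la; case: (eqVneq l j) => [lj|lj].
    by rewrite lj B'j gsf_tri ?mulr0// -lj.
  by rewrite /B' (negbTE lj) (gs_tri BP).
move=> j' r j'j rm.
have colj0 : forall a, col B j a = 0 by move=> a; apply: (gs_supp BP).
rewrite (bigD1 (Ordinal jd))//= colj ip_scl mulvZ.
rewrite (eq_bigr (fun l : 'I_d =>
    ip m X (col B l) (basisv j') * mulv X (col B l) r)); last first.
  by move=> l lj; rewrite coln// -val_eqE.
have -> : \sum_(l < d | l != Ordinal jd)
     ip m X (col B l) (basisv j') * mulv X (col B l) r =
   \sum_(l < d) ip m X (col B l) (basisv j') * mulv X (col B l) r.
  by rewrite [in RHS](bigD1 (Ordinal jd))//= ip0l// mul0r add0r.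
move: j'j; rewrite ltnS leq_eqVlt => /predU1P[->|j'j]; last first.
  by rewrite gsf_orth_basis// mulr0 mul0r add0r (gs_span BP).
have := mulv_f r; under eq_bigr do rewrite gsyE.
move=> /eqP; rewrite eq_sym subr_eq => /eqP {1}->; congr (_ + _).
have -> : ip m X f (basisv j) = nu by rewrite -sum_gram.
case: (ltP 0 nu) => nu1.
  by rewrite -[LHS]mul1r -(sc1 nu1); ring.
(* A residual of length 0 is mapped to 0 by [X], so replacing its column by 0 loses nothing in
   [gs_span]. *)
have fr : mulv X f r = 0.
  apply: (ip_eq0 _ rm); rewrite -gsnuE -/nu; apply/eqP.
  by rewrite eq_le nu1 nu0.
by rewrite fr !mulr0.
Qed.

End Step.

Lemma gsP j : (j <= d)%N -> gs_inv j (gs Q j).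
Proof.
elim: j => [_|j IH jd]; last by apply: gs_step => //; apply: IH; exact: ltnW.
by split => //= l; [move=> l' _; rewrite ip0l|right].
Qed.

Notation B := (gs Q d).

Lemma gs_unit_le l : ip m X (col B l) (col B l) <= 1.
Proof.
by case: (gs_unit (gsP (leqnn d)) l) => [->|h]; rewrite ?ip0l// ler01.
Qed.

Lemma gs_expand x r : (r < m)%N ->
  mulv X x r = \sum_(l < d) ip m X (col B l) x * mulv X (col B l) r.
Proof.
move=> rm; rewrite {1}/mulv.
under eq_bigr => a _ do
  rewrite (gs_span (gsP (leqnn d)) (ltn_ord a) rm) mulr_suml.
rewrite exchange_big/=; apply: eq_bigr => l _.
under eq_bigr do rewrite mulrAC.
rewrite -mulr_suml -/(mulv X (col B l) r); congr (_ * _).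
rewrite /ip; under eq_bigr do rewrite mulr_suml.
rewrite exchange_big/=; apply: eq_bigr => s _.
rewrite -[mulv X x s]/(\sum_(a < d) X s a * x a) mulr_sumr.
apply: eq_bigr => a _.
by rewrite mulv_basis; [ring|].
Qed.

Lemma gs_parseval x : ip m X x x = \sum_(l < d) ip m X (col B l) x ^+ 2.
Proof.
rewrite {1}/ip; under eq_bigr => r _ do
  rewrite {1}(gs_expand x (ltn_ord r)) mulr_suml.
rewrite exchange_big/=; apply: eq_bigr => l _.
under eq_bigr do rewrite -mulrA.
by rewrite -mulr_sumr expr2.
Qed.

(** Pythagoras: the last residual is orthogonal to all other coordinate vectors, and [x] differs
    from it by a combination of exactly these, both having last coordinate 1. *)
Lemma gs_last_min j (x : nat -> R) : j.+1 = d -> x j = 1 ->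
  ip m X (gsf Q (gs Q j) j) (gsf Q (gs Q j) j) <= ip m X x x.
Proof.
move=> jd xj; have jd' : (j < d)%N by rewrite -jd.
have BP := gsP (ltnW jd'); set f := gsf Q (gs Q j) j.
have fj : f j = 1 by exact: gsf_diag.
pose z := fun a => x a - f a.
have mz r : mulv X x r = mulv X f r + mulv X z r.
  by rewrite /mulv -big_split; apply: eq_bigr => a _; rewrite /z /=; ring.
have fz : ip m X f z = 0.
  have -> : ip m X f z = \sum_(a < d) z a * ip m X f (basisv a).
    rewrite /ip; under [RHS]eq_bigr do rewrite mulr_sumr.
    rewrite exchange_big/=; apply: eq_bigr => r _.
    rewrite {2}/mulv mulr_sumr; apply: eq_bigr => a _.
    by rewrite mulv_basis//; ring.
  rewrite big1// => a _; have := ltn_ord a; rewrite -[X in (_ < X)%N]jd.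
  rewrite ltnS leq_eqVlt => /predU1P[->|aj'].
    by rewrite /z xj fj subrr mul0r.
  by rewrite /f (gsf_orth_basis jd' BP aj') mulr0.
have -> : ip m X x x = ip m X f f + 2 * ip m X f z + ip m X z z.
  rewrite /ip mulr_sumr -!big_split; apply: eq_bigr => r _ /=.
  by rewrite mz; ring.
by rewrite fz mulr0 addr0 lerDl ip_ge0.
Qed.

Variables (t : nat -> R) (c : R).
Hypothesis t_le : forall x : nat -> R, (\sum_(a < d) t a * x a) ^+ 2 <= c * ip m X x x.

(** By [t_le] the functional vanishes wherever the form does; this applies to [x] minus its
    expansion in the columns. *)
Lemma gs_functional (x : nat -> R) : \sum_(a < d) t a * x a =
  \sum_(l < d) ip m X (col B l) x * \sum_(a < d) t a * B a l.
Proof.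
pose T := fun (_ : nat) a => t a.
pose y := fun a => x a + \sum_(l < d) (- ip m X (col B l) x) * col B l a.
have yE X' r : mulv X' y r = mulv X' x r +
    \sum_(l < d) (- ip m X (col B l) x) * mulv X' (col B l) r.
  exact: (@mulv_lin X' d (fun l => - ip m X (col B l) x) (col B) x r).
have y0 : ip m X y y = 0.
  rewrite /ip big1// => r _; rewrite yE.
  rewrite (gs_expand x (ltn_ord r)) -big_split big1 ?mul0r//= => l _.
  by rewrite mulNr subrr.
have := t_le y; rewrite y0 mulr0 => h.
have : mulv T y 0 = 0 by apply/eqP; rewrite -sqrf_eq0 eq_le h sqr_ge0.
rewrite yE => /eqP; rewrite addr_eq0 => /eqP.
rewrite /mulv /T => ->; rewrite -sumrN; apply: eq_bigr => l _.
by rewrite mulNr opprK.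
Qed.

Lemma gs_functional_sqr (x : nat -> R) : (\sum_(a < d) t a * x a) ^+ 2 <=
  ip m X x x * \sum_(l < d) (\sum_(a < d) t a * B a l) ^+ 2.
Proof.
rewrite gs_functional gs_parseval.
exact: (@sumr_sqr_le _ (fun l => ip m X (col B l) x)
  (fun l => \sum_(a < d) t a * B a l)).
Qed.

(** Test [t_le] at the vector representing the functional: there the functional equals [tau] and so
    does the form, so that [tau^2 <= c tau]. *)
Lemma gs_functional_norm : 0 <= c ->
  \sum_(l < d) (\sum_(a < d) t a * B a l) ^+ 2 <= c.
Proof.
move=> c0; set tau := \sum_(l < d) _.
pose u l := \sum_(a < d) t a * B a l.
pose x := fun a => 0 + \sum_(l < d) u l * col B l a.
have xE X' r : mulv X' x r = \sum_(l < d) u l * mulv X' (col B l) r.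
  by have := @mulv_lin X' d u (col B) (fun=> 0) r; rewrite mulv0 add0r.
have tx : \sum_(a < d) t a * x a = tau.
  rewrite -/(mulv (fun _ => t) x 0) xE.
  by apply: eq_bigr => l _; rewrite expr2.
have ipx l : (l < d)%N -> ip m X (col B l) x = u l.
  move=> ld; rewrite /ip; under eq_bigr do rewrite xE mulr_sumr.
  rewrite exchange_big/= (bigD1 (Ordinal ld))//= [X in _ + X]big1 ?addr0.
    under eq_bigr do rewrite mulrCA.
    rewrite -mulr_sumr -/(ip m X (col B l) (col B l)).
    case: (gs_unit (gsP (leqnn d)) l) => h; first by rewrite h mulr1.
    by rewrite ip0l// mulr0 /u big1// => a _; rewrite h mulr0.
  move=> l' ll'; under eq_bigr do rewrite mulrCA.
  rewrite -mulr_sumr [X in _ * X](gs_orth (gsP (leqnn d))) ?mulr0//.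
  by apply: contra_neq ll' => e; apply/val_inj.
have := t_le x; rewrite tx gs_parseval.
under eq_bigr => l _ do rewrite ipx//.
rewrite -/tau expr2 => h.
have [t0|t0] := leP tau 0; first exact: le_trans t0 c0.
by rewrite ler_pM2r in h.
Qed.

End GramSchmidt.

(** * CountSketch as a subspace embedding *)

Section CountSketch.
Variable R : realType.
Local Notation coinE := (@coinE R).
Local Notation sg := (@sgc R).

Lemma radix_inj k i j b b' : (b < k)%N -> (b' < k)%N ->
  (i * k + b = j * k + b')%N -> i = j /\ b = b'.
Proof.
move=> bk b'k e; have k0 : (0 < k)%N by exact: leq_ltn_trans bk.
have := congr1 (divn^~ k) e; have := congr1 (modn^~ k) e.
by rewrite !modnMDl !divnMDl// !divn_small// !modn_small// !addn0.
Qed.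

Lemma radix_ltn k n i b : (i < n)%N -> (b < k)%N -> (i * k + b < n * k)%N.
Proof.
move=> i_n bk; apply: (@leq_trans (i.+1 * k)); last by rewrite leq_mul2r i_n orbT.
by rewrite mulSn addnC ltn_add2r.
Qed.

(** The coefficient of a sign may depend on earlier signs: in a cross term the later sign still
    occurs linearly, and flipping it shows that the term averages to 0. *)
Lemma coinE_rademacher_sqr N n (pos : nat -> nat) (w : nat -> (nat -> bool) -> R) :
  (forall i, (i < n)%N -> (pos i < N)%N) ->
  (forall i j, (i < j)%N -> (j < n)%N -> pos i != pos j) ->
  (forall i j c, (i <= j)%N -> (j < n)%N -> w i (flip (pos j) c) = w i c) ->
  coinE N (fun c => (\sum_(i < n) sg (c (pos i)) * w i c) ^+ 2) =
  \sum_(i < n) coinE N (fun c => w i c ^+ 2).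
Proof.
elim: n => [|n IH] posN posI wI.
  by rewrite big_ord0 -[RHS](coinE_cst N); apply: eq_coinE => c;
    rewrite big_ord0 expr0n.
rewrite big_ord_recr/= -IH; last 3 first.
- by move=> i i_n; apply: posN; exact: ltnW.
- by move=> i j ij jn; apply: posI => //; exact: ltnW.
- by move=> i j c ij jn; apply: wI => //; exact: ltnW.
rewrite -coinED.
transitivity (coinE N (fun c => (\sum_(i < n) sg (c (pos i)) * w i c) ^+ 2 +
    w n c ^+ 2) + coinE N (fun c =>
    2 * (sg (c (pos n)) * (\sum_(i < n) sg (c (pos i)) * w i c * w n c)))).
  rewrite -coinED; apply: eq_coinE => c.
  rewrite big_ord_recr/= -mulr_suml !expr2.
  have s2 := sgc_sqr R (c (pos n)).
  set S := \sum_(i < n) _; set s := sg _ in s2 *.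
  have -> : (S + s * w n c) * (S + s * w n c) =
    S * S + (s ^+ 2) * (w n c * w n c) + 2 * (s * (S * w n c)) by ring.
  by rewrite s2 mul1r.
rewrite [X in _ + X](@coinE_odd R N (pos n)) ?addr0//; first exact: posN.
move=> c; rewrite flipE sgcN mulNr mulrN; congr (- (_ * (_ * _))).
apply: eq_bigr => i _; rewrite flip_neq ?posI// !wI//; exact: ltnW.
Qed.

Fixpoint bitsv (g : nat -> bool) (l : nat) : nat :=
  if l is l'.+1 then (2 * bitsv g l' + g l')%N else 0%N.

Lemma bitsv_lt g l : (bitsv g l < 2 ^ l)%N.
Proof. by elim: l => //= l IH; rewrite expnS; case: (g l) => /=; lia. Qed.

Lemma eq_bitsv g g' l : (forall b, (b < l)%N -> g b = g' b) ->
  bitsv g l = bitsv g' l.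
Proof.
elim: l => //= l IH gg'; rewrite IH ?gg'// => b bl; apply: gg'; exact: ltnW.
Qed.

(** Writes a collision as a product with one factor per bit, so that the bits can be averaged one at
    a time. *)
Lemma bitsv_eq g g' l : (bitsv g l == bitsv g' l)%:R =
  \prod_(b < l) ((1 + sg (g b) * sg (g' b)) / 2) :> R.
Proof.
elim: l => [|l IH]; first by rewrite big_ord0.
rewrite big_ord_recr/= -IH.
have -> : (2 * bitsv g l + g l == 2 * bitsv g' l + g' l)%N =
    (bitsv g l == bitsv g' l) && (g l == g' l).
  by case: (g l) (g' l) => -[] /=; lia.
by case: (_ == _); case: (g l); case: (g' l); rewrite /sgc /=; field.
Qed.

Variables (lm n d : nat).
Let m := (2 ^ lm)%N.
Let N := (n * lm.+1)%N.

(** Row [i] owns the [lm + 1] coins from [i * lm.+1] on: [lm] for the bucket and the last one for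
    the sign. *)
Definition rowhash (c : nat -> bool) (i : nat) : nat :=
  bitsv (fun b => c (i * lm.+1 + b)%N) lm.

Definition rowsign (c : nat -> bool) (i : nat) : R :=
  sg (c (i * lm.+1 + lm)%N).

Lemma rowhash_lt c i : (rowhash c i < m)%N. Proof. exact: bitsv_lt. Qed.

Lemma rowhash_flip c i j : rowhash (flip (j * lm.+1 + lm) c) i = rowhash c i.
Proof.
apply: eq_bitsv => b bl; rewrite flip_neq//.
by apply/eqP => /(radix_inj (leqW bl) (ltnSn lm))[_ e]; rewrite e ltnn in bl.
Qed.

Lemma coinE_rowhash i j : (i < n)%N -> (j < n)%N -> i != j ->
  coinE N (fun c => (rowhash c i == rowhash c j)%:R) = (m%:R)^-1.
Proof.
move=> i_n jn ij.
suff h l : (l <= lm)%N -> coinE N (fun c => \prod_(b < l)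
    (1 + sg (c (i * lm.+1 + b)%N) * sg (c (j * lm.+1 + b)%N))) = 1.
  rewrite (@eq_coinE _ _ _ (fun c => (2 ^- lm) * \prod_(b < lm)
    (1 + sg (c (i * lm.+1 + b)%N) * sg (c (j * lm.+1 + b)%N)))); last first.
    by move=> c; rewrite bitsv_eq big_split prodr_const card_ord mulrC exprVn.
  by rewrite coinEZ h// mulr1 /m natrX.
elim: l => [_|l IH ll].
  by rewrite -[RHS](coinE_cst N); apply: eq_coinE => c; rewrite big_ord0.
rewrite -[RHS]IH; last exact: ltnW.
have pN : (i * lm.+1 + l < N)%N by apply: radix_ltn => //; exact: leqW.
(* Flipping bit [l] of row [i] changes only the last factor, from [1 + s s'] to [1 - s s']; the two
   average to 1. *)
rewrite (coinE_flip_half _ pN); apply: eq_coinE => c.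
rewrite !big_ord_recr/= flipE sgcN.
rewrite [flip _ _ (j * _ + _)%N]flip_neq; last first.
  apply/eqP => /(radix_inj (leqW ll) (leqW ll))[e _].
  by rewrite e eqxx in ij.
have -> : \prod_(b < l) (1 + sg (flip (i * lm.+1 + l) c (i * lm.+1 + b)%N) *
    sg (flip (i * lm.+1 + l) c (j * lm.+1 + b)%N)) =
    \prod_(b < l) (1 + sg (c (i * lm.+1 + b)%N) * sg (c (j * lm.+1 + b)%N)).
  apply: eq_bigr => b _; have bl := ltn_ord b.
  have bl' : (b < lm.+1)%N by apply: leq_trans bl (leqW (ltnW ll)).
  by rewrite !flip_neq//; apply/eqP => /(radix_inj bl' (leqW ll))[_ e];
    rewrite e ltnn in bl.
by field.
Qed.

(** Pairs are grouped by their larger index, so that the inner sum is an admissible coefficient of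
    sign [j] in [coinE_rademacher_sqr]. Applied to the outer and then to the inner sum, it leaves
    one collision probability per pair. *)
Lemma coinE_sketch_form (u v : nat -> R) :
  \sum_(i < n) u i ^+ 2 <= 1 -> \sum_(i < n) v i ^+ 2 <= 1 ->
  coinE N (fun c => (\sum_(j < n) rowsign c j * \sum_(i < j) rowsign c i *
      ((rowhash c i == rowhash c j)%:R * (u i * v j))) ^+ 2) <= m%:R^-1.
Proof.
move=> u1 v1.
have posN i : (i < n)%N -> (i * lm.+1 + lm < N)%N by move=> h; exact: radix_ltn.
have posI i j : (i < j)%N -> (i * lm.+1 + lm != j * lm.+1 + lm)%N.
  move=> ij; apply/eqP => /(radix_inj (ltnSn lm) (ltnSn lm))[e _].
  by rewrite e ltnn in ij.
rewrite (@coinE_rademacher_sqr N n (fun j => j * lm.+1 + lm)%N (fun j c =>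
  \sum_(i < j) rowsign c i * ((rowhash c i == rowhash c j)%:R * (u i * v j))))//;
  last 2 first.
- by move=> i j ij _; exact: posI.
- move=> i j c ij jn; apply: eq_bigr => i' _; rewrite !rowhash_flip.
  by rewrite /rowsign flip_neq// posI// (leq_trans _ ij).
have step j : (j < n)%N -> coinE N (fun c => (\sum_(i < j) rowsign c i *
      ((rowhash c i == rowhash c j)%:R * (u i * v j))) ^+ 2) =
    \sum_(i < j) m%:R^-1 * (u i ^+ 2 * v j ^+ 2).
  move=> jn; rewrite (@coinE_rademacher_sqr N j (fun j => j * lm.+1 + lm)%N
    (fun i c => (rowhash c i == rowhash c j)%:R * (u i * v j)))//.
  - apply: eq_bigr => i _; have ij := ltn_ord i.
    rewrite (@eq_coinE _ _ _ (fun c => (u i ^+ 2 * v j ^+ 2) *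
        (rowhash c i == rowhash c j)%:R)); last first.
      by move=> c; case: (_ == _) => /=; ring.
    by rewrite coinEZ coinE_rowhash ?(ltn_trans ij)// ?ltn_eqF// mulrC.
  - by move=> i ij; apply: posN; exact: ltn_trans jn.
  - by move=> i i' ii' _; exact: posI.
  - by move=> i i' c ii' i'j; rewrite !rowhash_flip.
rewrite (eq_bigr (fun j : 'I_n =>
  m%:R^-1 * ((\sum_(i < j) u i ^+ 2) * v j ^+ 2))); last first.
  by move=> j _; rewrite step// -mulr_sumr -mulr_suml.
rewrite -mulr_sumr -[leRHS]mulr1 ler_wpM2l ?invr_ge0//.
apply: le_trans v1; apply: ler_sum => j _; rewrite ler_piMl ?sqr_ge0//.
apply: le_trans u1; rewrite -(big_mkord xpredT (fun i => u i ^+ 2)).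
rewrite -[leRHS](big_mkord xpredT (fun i => u i ^+ 2)).
rewrite [leRHS](big_cat_nat (n := j))//=; last exact: ltnW.
by rewrite lerDl sumr_ge0// => i _; exact: sqr_ge0.
Qed.

Variable X : nat -> nat -> R.

Definition sketch (c : nat -> bool) (r a : nat) : R :=
  \sum_(i < n) (rowhash c i == r)%:R * (rowsign c i * X i a).

Definition sketch_good (c : nat -> bool) : Prop := forall x : nat -> R,
  `|ip d m (sketch c) x x - ip d n X x x| <= ip d n X x x / 2.

Lemma sum_triangle k (g : nat -> nat -> R) : (forall i j, g i j = g j i) ->
  \sum_(i < k) \sum_(j < k) g i j =
  \sum_(i < k) g i i + 2 * \sum_(j < k) \sum_(i < j) g i j.
Proof.
move=> gC; elim: k => [|k IH]; first by rewrite !big_ord0 mulr0 addr0.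
rewrite big_ord_recr/= (eq_bigr (fun i : 'I_k => \sum_(j < k) g i j + g i k));
  last by move=> i _; rewrite big_ord_recr.
have E : \sum_(j < k) g k j = \sum_(i < k) g i k.
  by apply: eq_bigr => i _; rewrite gC.
by rewrite big_split/= IH !big_ord_recr/= E; ring.
Qed.

Lemma sketch_ip c (x : nat -> R) : ip d m (sketch c) x x = ip d n X x x +
  2 * \sum_(j < n) rowsign c j * \sum_(i < j) rowsign c i *
      ((rowhash c i == rowhash c j)%:R * (mulv d X x i * mulv d X x j)).
Proof.
pose y i := rowsign c i * mulv d X x i.
have mE r : mulv d (sketch c) x r = \sum_(i < n) (rowhash c i == r)%:R * y i.
  rewrite /mulv /sketch; under eq_bigr do rewrite mulr_suml.
  rewrite exchange_big/=; apply: eq_bigr => i _.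
  by rewrite /y /mulv !mulr_sumr; apply: eq_bigr => a _; ring.
have -> : ip d m (sketch c) x x =
    \sum_(i < n) \sum_(j < n) (rowhash c i == rowhash c j)%:R * (y i * y j).
  rewrite /ip; under eq_bigr do rewrite mE mulr_suml.
  rewrite exchange_big/=; apply: eq_bigr => i _.
  rewrite (bigD1 (Ordinal (rowhash_lt c i)))//= [X in _ + X = _]big1 ?addr0.
    rewrite eqxx mul1r mulr_sumr; apply: eq_bigr => j _.
    by rewrite (eq_sym (rowhash c j)); ring.
  move=> r; rewrite -val_eqE/= eq_sym => /negbTE ->.
  by rewrite mul0r mul0r.
rewrite (@sum_triangle n (fun i j =>
  (rowhash c i == rowhash c j)%:R * (y i * y j))); last first.
  by move=> i j; rewrite eq_sym; ring.
congr (_ + _ * _).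
  apply: eq_bigr => i _; rewrite eqxx mul1r /y mulrACA -expr2 sgc_sqr.
  by rewrite mul1r.
apply: eq_bigr => j _; rewrite mulr_sumr; apply: eq_bigr => i _; rewrite /y.
by ring.
Qed.

(** In an orthonormal basis of the form, the error of the sketch is twice the bilinear form with
    matrix [Z]. If the squared entries of [Z] sum to at most 1/16, Cauchy-Schwarz bounds the error
    by [q / 2]. There are [d^2] entries of second moment at most [1 / m], and Markov's inequality
    concludes. *)
Lemma sketch_good_prob :
  coinE N (fun c => ind R (~ sketch_good c)) <= 16 * d%:R ^+ 2 / m%:R.
Proof.
pose b l : nat -> R := fun a => gs d (gram n X) d a l.
pose U l i := mulv d X (b l) i.
pose Z l l' c := \sum_(j < n) rowsign c j * \sum_(i < j) rowsign c i *
      ((rowhash c i == rowhash c j)%:R * (U l i * U l' j)).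
have U1 l : \sum_(i < n) U l i ^+ 2 <= 1 by exact: gs_unit_le.
apply: (@le_trans _ _ (coinE N (fun c =>
    16 * \sum_(l < d) \sum_(l' < d) Z l l' c ^+ 2))); last first.
  rewrite coinEZ coinE_sum -mulrA ler_wpM2l//.
  apply: (@le_trans _ _ (\sum_(l < d) \sum_(l' < d) m%:R^-1)); last first.
    by rewrite !sumr_const !card_ord -mulrnA -[leLHS]mulr_natr natrM mulrC expr2.
  apply: ler_sum => l _; rewrite coinE_sum; apply: ler_sum => l' _.
  exact: coinE_sketch_form.
apply: le_coinE => c; set ZZ := \sum_(l < d) _.
have ZZ0 : 0 <= ZZ.
  by apply: sumr_ge0 => l _; apply: sumr_ge0 => l' _; exact: sqr_ge0.
apply: ind_le => [|bad]; first exact: mulr_ge0.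
rewrite leNgt; apply/negP => ZZ1; apply: bad => x.
rewrite sketch_ip addrC addKr.
set q := ip d n X x x; have q0 : 0 <= q by exact: ip_ge0.
pose h l := ip d n X (b l) x.
have -> : \sum_(j < n) rowsign c j * \sum_(i < j) rowsign c i *
      ((rowhash c i == rowhash c j)%:R * (mulv d X x i * mulv d X x j)) =
   \sum_(l < d) h l * \sum_(l' < d) h l' * Z l l' c.
  rewrite /Z; under [RHS]eq_bigr do
    (rewrite mulr_sumr; under eq_bigr do rewrite !mulr_sumr).
  under [RHS]eq_bigr do rewrite exchange_big/=.
  rewrite exchange_big/=; apply: eq_bigr => j _.
  under [RHS]eq_bigr do under eq_bigr do rewrite !mulr_sumr.
  under [RHS]eq_bigr do rewrite exchange_big/=.
  rewrite exchange_big/= mulr_sumr; apply: eq_bigr => i _.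
  have i_n : (i < n)%N by exact: ltn_trans (ltn_ord i) (ltn_ord j).
  rewrite (@gs_expand R d n X x i i_n) (@gs_expand R d n X x j (ltn_ord j)).
  rewrite big_distrlr/= 3!mulr_sumr; apply: eq_bigr => l _.
  rewrite 3!mulr_sumr; apply: eq_bigr => l' _.
  by rewrite /h /U /b; ring.
set D := \sum_(l < d) _.
have : D ^+ 2 <= q * (q * ZZ).
  apply: le_trans (@sumr_sqr_le _ d h (fun l => \sum_(l' < d) h l' * Z l l' c)) _.
  have hq : \sum_(l < d) h l ^+ 2 = q by rewrite /q gs_parseval.
  rewrite hq ler_wpM2l// /ZZ mulr_sumr; apply: ler_sum => l _.
  rewrite -hq; exact: (@sumr_sqr_le _ d h (fun l' => Z l l' c)).
move=> hD; have {}hD : D ^+ 2 <= (q / 4) ^+ 2.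
  apply: le_trans hD _; rewrite mulrA -expr2 exprMn ler_wpM2l ?sqr_ge0//.
  by lra.
rewrite -ler_sqr ?nnegrE//; last by rewrite divr_ge0.
rewrite -normrX ger0_norm ?sqr_ge0//; nra.
Qed.

End CountSketch.

(** * Random sign projections: moments and lower tail *)

Section SignProjections.
Variable R : realType.
Local Notation coinE := (@coinE R).
Local Notation sg := (@sgc R).

(** Khinchine's inequality for the fourth moment. Odd powers of the split-off sign average to 0, and
    what remains is [3 T^2 + 6 T t^2 + t^4 <= 3 (T + t^2)^2]. *)
Lemma coinE_rademacher_quad N n (pos : nat -> nat) (t : nat -> R) :
  (forall i, (i < n)%N -> (pos i < N)%N) ->
  (forall i j, (i < j)%N -> (j < n)%N -> pos i != pos j) ->
  coinE N (fun c => (\sum_(i < n) sg (c (pos i)) * t i) ^+ 4) <=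
  3 * (\sum_(i < n) t i ^+ 2) ^+ 2.
Proof.
elim: n => [|n IH] posN posI.
  rewrite !big_ord0 expr0n/= mulr0 (@eq_coinE _ _ _ (fun=> 0)) ?coinE_cst//.
  by move=> c; rewrite big_ord0 expr0n.
have posN' i : (i < n)%N -> (pos i < N)%N by move=> i_n; apply: posN; exact: ltnW.
have posI' i j : (i < j)%N -> (j < n)%N -> pos i != pos j.
  by move=> ij jn; apply: posI => //; exact: ltnW.
pose S c := \sum_(i < n) sg (c (pos i)) * t i.
have SI c : S (flip (pos n) c) = S c.
  by apply: eq_bigr => i _; rewrite flip_neq// posI.
have ES2 : coinE N (fun c => S c ^+ 2) = \sum_(i < n) t i ^+ 2.
  rewrite (@coinE_rademacher_sqr R N n pos (fun i _ => t i))//.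
  by apply: eq_bigr => i _; rewrite coinE_cst.
have odd_part : coinE N (fun c =>
    sg (c (pos n)) * (4 * S c ^+ 3 * t n + 4 * S c * t n ^+ 3)) = 0.
  apply: (@coinE_odd R N (pos n)) => [|c]; first exact: posN.
  by rewrite flipE sgcN SI mulNr.
rewrite (@eq_coinE _ _ _ (fun c => (S c ^+ 4 + (6 * t n ^+ 2) * S c ^+ 2) +
   (t n ^+ 4 + sg (c (pos n)) * (4 * S c ^+ 3 * t n + 4 * S c * t n ^+ 3))));
  last first.
  move=> c; rewrite big_ord_recr/= -/(S c); set s := sg _.
  have s2 : s ^+ 2 = 1 by exact: sgc_sqr.
  have -> : (S c + s * t n) ^+ 4 = S c ^+ 4 + 6 * s ^+ 2 * t n ^+ 2 * S c ^+ 2 +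
    (s ^+ 2) ^+ 2 * t n ^+ 4 + s * (4 * S c ^+ 3 * t n + s ^+ 2 * 4 * S c * t n ^+ 3).
    by ring.
  by rewrite s2; ring.
rewrite coinED coinED coinEZ coinED coinE_cst odd_part addr0 ES2 big_ord_recr/=.
set T := \sum_(i < n) _.
have T0 : 0 <= T by apply: sumr_ge0 => i _; exact: sqr_ge0.
have := IH posN' posI'; rewrite -/T => h.
apply: (@le_trans _ _ (3 * T ^+ 2 + 6 * t n ^+ 2 * T + t n ^+ 4)).
  by rewrite lerD2r lerD2r.
have : 0 <= (t n ^+ 2) ^+ 2 by exact: sqr_ge0.
have -> : t n ^+ 4 = (t n ^+ 2) ^+ 2 by rewrite -exprM.
by move: (t n ^+ 2) => u; nra.
Qed.

(** An elementary second-order bound: [exp y >= (1 + y/2)^2], and the product of this square with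
    the right-hand side is [1 + y^3/2 + 3 y^4/16 >= 1]. *)
Lemma expRN_le (y : R) : 0 <= y -> expR (- y) <= 1 - y + 3 / 4 * y ^+ 2.
Proof.
move=> y0; have h1 : 1 + y / 2 <= expR (y / 2) by exact: expR_ge1Dx.
have h2 : (1 + y / 2) ^+ 2 <= expR y.
  have -> : expR y = expR (y / 2) ^+ 2 by rewrite -expRM_natl mulrCA mulfV// mulr1.
  by rewrite ler_sqr ?nnegrE ?expR_ge0//; lra.
rewrite expRN -[leLHS]mul1r ler_pdivrMr ?expR_gt0//.
apply: (@le_trans _ _ ((1 - y + 3 / 4 * y ^+ 2) * (1 + y / 2) ^+ 2)).
  have : 0 <= y ^+ 3 by exact: exprn_ge0.
  have : 0 <= y ^+ 4 by exact: exprn_ge0.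
  have -> : (1 - y + 3 / 4 * y ^+ 2) * (1 + y / 2) ^+ 2 =
    1 + y ^+ 3 / 2 + 3 / 16 * y ^+ 4 by field.
  by lra.
apply: ler_wpM2l => //.
have -> : 1 - y + 3 / 4 * y ^+ 2 = 2 / 3 + 3 / 4 * (y - 2 / 3) ^+ 2 by field.
by rewrite addr_ge0// mulr_ge0// sqr_ge0.
Qed.

Variable d : nat.

Definition sqproj (c : nat -> bool) (k : nat) (t : nat -> R) : R :=
  (\sum_(l < d) sg (c (k * d + l)%N) * t l) ^+ 2.

Lemma sqproj_ge0 c k t : 0 <= sqproj c k t. Proof. exact: sqr_ge0. Qed.

Lemma coinE_sqproj K k t : (k < K)%N ->
  coinE (K * d) (fun c => sqproj c k t) = \sum_(l < d) t l ^+ 2.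
Proof.
move=> kK; rewrite (@coinE_rademacher_sqr R (K * d) d (fun l => k * d + l)%N
  (fun l _ => t l))//.
- by apply: eq_bigr => l _; rewrite coinE_cst.
- by move=> l ld; exact: radix_ltn.
- by move=> l l' ll' _; rewrite eqn_add2l ltn_eqF.
Qed.

Lemma coinE_sqproj_exp K (t : nat -> R) (lam : R) :
  coinE (K * d) (fun c => expR (- (lam * \sum_(k < K) sqproj c k t))) =
  (coinE d (fun c => expR (- (lam * sqproj c 0 t)))) ^+ K.
Proof.
elim: K => [|K IH].
  by rewrite expr0 /= big_ord0 mulr0 oppr0 expR0.
rewrite mulSn coinE_cat exprS -IH mulrC -coinEZ; apply: eq_coinE => c.
rewrite mulrC -coinEZ; apply: eq_coinE => c'.
rewrite big_ord_recl/= -expRD; congr expR.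
rewrite mulrDr opprD; congr (- (_ * _) - (_ * _)).
  rewrite /sqproj; congr (_ ^+ 2); apply: eq_bigr => l _.
  by rewrite mul0n add0n /scat ltn_ord.
apply: eq_bigr => k _; rewrite /sqproj; congr (_ ^+ 2).
apply: eq_bigr => l _; rewrite /scat /bump/= add1n mulSn -addnA.
by rewrite ltnNge leq_addr /= addKn.
Qed.

(** Exponential moments: squares are nonnegative, so second and fourth moments already bound the
    Laplace transform of one projection, and the projections are independent. *)
Lemma sqproj_tail K (t : nat -> R) :
  coinE (K * d) (fun c => ind R (\sum_(k < K) sqproj c k t <
    K%:R * (\sum_(l < d) t l ^+ 2) / 3)) <= (24 / 25) ^+ K.
Proof.
set tau := \sum_(l < d) _.
have tau0 : 0 <= tau by apply: sumr_ge0 => l _; exact: sqr_ge0.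
have [tau_le0|tau_gt0] := leP tau 0.
  apply: (@le_trans _ _ 0); last by rewrite exprn_ge0// divr_ge0.
  apply: (@le_trans _ _ (coinE (K * d) (fun=> 0))); last by rewrite coinE_cst.
  apply: le_coinE => c; apply: ind_le => //.
  have -> : tau = 0 by apply/eqP; rewrite eq_le tau_le0.
  rewrite mulr0 mul0r => h; exfalso; move: h; apply/negP; rewrite -leNgt.
  by apply: sumr_ge0 => k _; exact: sqproj_ge0.
(* With [x = lam tau], one projection has Laplace transform at most [1 - x + 9 x^2 / 4], minimal at
   [x = 2/9] with value 8/9. The threshold [tau / 3] costs [exp (2/27) <= 27/25] per projection, and
   [27/25 * 8/9 = 24/25]. *)
pose lam := 2 / 9 / tau.
have lam0 : 0 < lam by rewrite divr_gt0.
have lamt : lam * tau = 2 / 9 by rewrite /lam mulfVK// gt_eqF.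
apply: (@le_trans _ _ (coinE (K * d) (fun c => expR (2 / 27) ^+ K *
    expR (- (lam * \sum_(k < K) sqproj c k t))))).
  apply: le_coinE => c; apply: ind_le.
    by rewrite mulr_ge0// ?exprn_ge0// expR_ge0.
  move=> h; rewrite -expRM_natl -expRD -[leLHS]expR0 ler_expR subr_ge0.
  apply: le_trans (ltW _) (_ : K%:R * (2 / 9) / 3 <= _); last by lra.
  have -> : K%:R * (2 / 9) / 3 = lam * (K%:R * tau / 3) by rewrite -lamt; ring.
  by rewrite ltr_pM2l.
rewrite coinEZ coinE_sqproj_exp -exprMn.
have E0 : 0 <= coinE d (fun c => expR (- (lam * sqproj c 0 t))).
  by apply: coinE_ge0 => c; exact: expR_ge0.
apply: lerXn2r; rewrite ?nnegrE ?mulr_ge0 ?expR_ge0//.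
have h89 : coinE d (fun c => expR (- (lam * sqproj c 0 t))) <= 8 / 9.
  apply: (@le_trans _ _ (coinE d (fun c => 1 + (- lam) * sqproj c 0 t +
     (3 / 4 * lam ^+ 2) * (\sum_(l < d) sg (c l) * t l) ^+ 4))).
    apply: le_coinE => c.
    apply: le_trans (expRN_le _) _.
      by rewrite mulr_ge0 ?sqproj_ge0// ltW.
    by rewrite /sqproj; under eq_bigr do rewrite mul0n add0n; rewrite exprMn; lra.
  rewrite 2!coinED coinE_cst 2!coinEZ.
  have -> : coinE d (fun c => sqproj c 0 t) = tau.
    by have := @coinE_sqproj 1 0 t (ltnSn 0); rewrite mul1n.
  rewrite mulNr lamt.
  have h4 : coinE d (fun c => (\sum_(l < d) sg (c l) * t l) ^+ 4) <= 3 * tau ^+ 2.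
    apply: (@coinE_rademacher_quad d d id t) => // i j ij _.
    by rewrite ltn_eqF.
  have : 3 / 4 * lam ^+ 2 *
      coinE d (fun c => (\sum_(l < d) sg (c l) * t l) ^+ 4) <=
      3 / 4 * lam ^+ 2 * (3 * tau ^+ 2).
    by rewrite ler_wpM2l// mulr_ge0// sqr_ge0.
  have -> : 3 / 4 * lam ^+ 2 * (3 * tau ^+ 2) = 9 / 4 * (lam * tau) ^+ 2 by field.
  by rewrite lamt; lra.
have h27 : expR (2 / 27) <= 27 / 25 :> R.
  rewrite -[leLHS]opprK -[X in expR X]opprK expRN opprK.
  have := @expR_ge1Dx R (- (2 / 27)) => h.
  rewrite -[leRHS]invrK lef_pV2 ?posrE ?expR_gt0 ?invr_gt0//; lra.
apply: (@le_trans _ _ (27 / 25 * (8 / 9))); last by lra.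
by apply: ler_pM => //; exact: expR_ge0.
Qed.

End SignProjections.

(** * Lewis weights *)

Section LewisStep.
Variable R : realType.
Local Notation coinE := (@coinE R).
Local Notation sg := (@sgc R).
Variables (p : R) (n d : nat) (A : nat -> nat -> R).
Hypotheses (p1 : 1 <= p) (p2 : p < 2).
Hypothesis A0 : forall i, (i < n)%N -> exists2 a, (a < d)%N & A i a != 0.

(** The square root of the weight [v_i^(-(1-p/2))], so that [qform] is the Gram form of the scaled
    rows. The power is spelled out in the way the program computes it. *)
Definition rowwt (v : nat -> R) (i : nat) : R := expR (- ((1 - p / 2) / 2) * ln (v i)).

Definition wtrows (v : nat -> R) (i a : nat) : R := rowwt v i * A i a.

Definition lewis (v : nat -> R) (i : nat) : R := expR (p / 2 * ln (v i)).

Definition qform (v x : nat -> R) : R := ip d n (wtrows v) x x.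

Definition lewis_inv (v : nat -> R) : Prop :=
  (forall i, (i < n)%N -> 0 < v i) /\
  (forall i x, (i < n)%N -> mulv d A x i ^+ 2 <= v i * qform v x).

Lemma mulv_wtrows v x i : mulv d (wtrows v) x i = rowwt v i * mulv d A x i.
Proof. by rewrite /mulv mulr_sumr; apply: eq_bigr => a _; rewrite mulrA. Qed.

Lemma qformE v x : qform v x = \sum_(i < n) rowwt v i ^+ 2 * mulv d A x i ^+ 2.
Proof.
by apply: eq_bigr => i _; rewrite mulv_wtrows -expr2 exprMn.
Qed.

Lemma qform_ge0 v x : 0 <= qform v x. Proof. exact: ip_ge0. Qed.

Lemma le_qform v v' x : (forall i, (i < n)%N -> 0 < v' i <= v i) ->
  qform v x <= qform v' x.
Proof.
move=> vv'; rewrite !qformE; apply: ler_sum => i _.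
have /andP[v'0 v'v] := vv' _ (ltn_ord i).
apply: ler_wpM2r; first exact: sqr_ge0.
rewrite ler_sqr ?nnegrE ?expR_ge0// ler_expR ler_wnM2l//.
  by move: (p2) => h; lra.
by rewrite ler_ln// posrE// (lt_le_trans v'0).
Qed.

Lemma lewis_inv1 : lewis_inv (fun=> 1).
Proof.
split => // i x i_n; rewrite mul1r qformE (bigD1 (Ordinal i_n))//=.
rewrite /rowwt ln1 mulr0 expR0 expr1n mul1r lerDl.
by apply: sumr_ge0 => j _; rewrite mulr_ge0 ?sqr_ge0.
Qed.

(** Divide by [lewis v i]: with [r = v'_i / v_i <= 1] the claim is [r^(p/2) <= 1/4 + r], and
    [r^(p/2) <= sqrt r] because [p >= 1]. *)
Lemma lewis_split v v' i : 0 < v' i -> v' i <= v i ->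
  lewis v' i <= lewis v i / 4 + rowwt v i ^+ 2 * v' i.
Proof.
move=> v'0 v'v; have v0 := lt_le_trans v'0 v'v.
have lnle : ln (v' i) <= ln (v i) by rewrite ler_ln ?posrE.
rewrite /lewis /rowwt -expRM_natl -[X in _ + _ * X](@lnK _ (v' i)) ?posrE//.
set a := ln (v i) in lnle *; set b := ln (v' i) in lnle *.
have -> : p / 2 * b = p / 2 * a + p / 2 * (b - a) by ring.
rewrite -expRD.
have -> : 2%:R * (- ((1 - p / 2) / 2) * a) + b = p / 2 * a + (b - a) by field.
rewrite (expRD (p / 2 * a) (p / 2 * (b - a))) (expRD (p / 2 * a) (b - a)).
rewrite -mulrDr ler_wpM2l ?expR_ge0//.
apply: (@le_trans _ _ (expR ((b - a) / 2))).
  by rewrite ler_expR; move: (p1) => h; nra.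
have -> : expR (b - a) = expR ((b - a) / 2) ^+ 2.
  by rewrite -expRM_natl; congr expR; field.
have : 0 <= (expR ((b - a) / 2) - 1 / 2) ^+ 2 by exact: sqr_ge0.
by move: (expR _) => h; nra.
Qed.

Variables (lm K : nat).
Let N1 := (n * lm.+1)%N.

Definition sketch_of (v : nat -> R) (c : nat -> bool) : nat -> nat -> R :=
  sketch lm n (wtrows v) c.

Definition sketch_basis (v : nat -> R) (c : nat -> bool) : nat -> nat -> R :=
  gs d (gram (2 ^ lm) (sketch_of v c)) d.

(** The signs are applied to the basis, not to the rows, so that one projection of all rows takes a
    single pass over the nonzero entries. *)
Definition projdir (v : nat -> R) (c : nat -> bool) (k a : nat) : R :=
  \sum_(l < d) sketch_basis v c a l * sg (c (N1 + (k * d + l))%N).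

Definition energy (v : nat -> R) (c : nat -> bool) (i : nat) : R :=
  \sum_(k < K) mulv d A (projdir v c k) i ^+ 2.

(** The constant 5: [energy / K] may be as small as a third of the leverage score and the sketched
    form as large as 3/2 of [qform], and [5/3 >= 3/2]. *)
Definition lewis_step (v : nat -> R) (c : nat -> bool) (i : nat) : R :=
  if 5 * energy v c i / K%:R < v i then 5 * energy v c i / K%:R else v i.

Definition leverage (v : nat -> R) (c : nat -> bool) (i : nat) : R :=
  \sum_(l < d) (\sum_(a < d) A i a * sketch_basis v c a l) ^+ 2.

(** Only underestimates would break the invariant, hence the one-sided condition; overestimates are
    handled in the mean by [lewis_sum_step]. *)
Definition step_good (v : nat -> R) (c : nat -> bool) : Prop :=
  sketch_good lm n d (wtrows v) c /\
  forall i, (i < n)%N -> K%:R * leverage v c i / 3 <= energy v c i.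

Hypothesis K0 : (0 < K)%N.

Lemma lewis_step_le v c i : lewis_step v c i <= v i.
Proof. by rewrite /lewis_step; case: ifP => // /ltW. Qed.

Lemma leverage_functional v c x i : (i < n)%N -> lewis_inv v ->
  sketch_good lm n d (wtrows v) c ->
  mulv d A x i ^+ 2 <= ip d (2 ^ lm) (sketch_of v c) x x * leverage v c i.
Proof.
move=> i_n [v0 vq] skg.
(* The factor 2: on a good sketch [qform] is at most twice the sketched form. *)
apply: (@gs_functional_sqr R d (2 ^ lm) (sketch_of v c) (A i) (v i * 2)) => y.
apply: le_trans (vq i y i_n) _; rewrite -mulrA ler_wpM2l//; first exact/ltW/v0.
have := skg y; rewrite -/(qform v y) ler_norml => /andP[+ _].
by rewrite -/(sketch_of v c) => h; lra.
Qed.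

Lemma lewis_inv_step v c : lewis_inv v -> step_good v c ->
  lewis_inv (lewis_step v c).
Proof.
move=> vP [skg jl]; have [v0 vq] := vP.
have KR : 0 < K%:R :> R by rewrite ltr0n.
(* A nonzero row has positive leverage; this keeps the new weights positive, as their logarithms
   require. *)
have lev0 i : (i < n)%N -> 0 < leverage v c i.
  move=> i_n; have [a ad Aa] := A0 i_n.
  have := leverage_functional (basisv R a) i_n vP skg.
  rewrite mulv_basis// => h; rewrite lt_neqAle sumr_ge0 ?andbT; last first.
    by move=> l _; exact: sqr_ge0.
  apply: contraNneq Aa => e; rewrite -sqrf_eq0 eq_le sqr_ge0 andbT.
  by rewrite -e mulr0 in h.
have en i : (i < n)%N -> leverage v c i * (5 / 3) <= 5 * energy v c i / K%:R.
  move=> i_n; rewrite ler_pdivlMr//; have := jl i i_n; lra.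
have sv0 i : (i < n)%N -> 0 < lewis_step v c i.
  move=> i_n; rewrite /lewis_step; case: ifP => _; last exact: v0.
  by apply: lt_le_trans (en i i_n); rewrite mulr_gt0 ?lev0.
split => // i x i_n.
have qq : qform v x <= qform (lewis_step v c) x.
  by apply: le_qform => j jn; rewrite sv0// lewis_step_le.
apply: (@le_trans _ _ (lewis_step v c i * qform v x)); last first.
  by rewrite ler_wpM2l// ltW// sv0.
rewrite /lewis_step; case: ifP => _; last exact: vq.
apply: le_trans (leverage_functional x i_n vP skg) _.
have := skg x; rewrite ler_norml -/(qform v x) -/(sketch_of v c) => /andP[_ h].
have h1 := en i i_n; have h2 := lev0 i i_n; have h3 := qform_ge0 v x.
apply: (@le_trans _ _ (leverage v c i * (3 / 2) * qform v x)).
  rewrite mulrC -mulrA; apply: ler_wpM2l; [exact: ltW|lra].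
by rewrite ler_wpM2r//; lra.
Qed.

Lemma rowhash_scat c c' i : (i < n)%N ->
  rowhash lm (scat N1 c c') i = rowhash lm c i.
Proof.
move=> i_n; apply: eq_bitsv => b bl; rewrite /scat ifT//.
exact: (radix_ltn i_n (leqW bl)).
Qed.

Lemma rowsign_scat c c' i : (i < n)%N ->
  rowsign R lm (scat N1 c c') i = rowsign R lm c i.
Proof.
by move=> i_n; rewrite /rowsign /scat ifT//; exact: (radix_ltn i_n (ltnSn lm)).
Qed.

Lemma sketch_of_scat v c c' : sketch_of v (scat N1 c c') = sketch_of v c.
Proof.
apply/funext => r; apply/funext => a; apply: eq_bigr => i _.
by rewrite rowhash_scat ?rowsign_scat.
Qed.

Lemma sketch_good_scat v c c' : sketch_good lm n d (wtrows v) (scat N1 c c') =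
  sketch_good lm n d (wtrows v) c.
Proof.
by rewrite /sketch_good -/(sketch_of v _) sketch_of_scat.
Qed.

Lemma leverage_scat v c c' i : leverage v (scat N1 c c') i = leverage v c i.
Proof. by rewrite /leverage /sketch_basis sketch_of_scat. Qed.

Lemma energy_scat v c c' i : energy v (scat N1 c c') i =
  \sum_(k < K) sqproj d c' k (fun l => \sum_(a < d) A i a * sketch_basis v c a l).
Proof.
apply: eq_bigr => k _; rewrite /sqproj /mulv /projdir; congr (_ ^+ 2).
under eq_bigr do rewrite mulr_sumr; rewrite exchange_big/=.
apply: eq_bigr => l _; rewrite mulr_sumr; apply: eq_bigr => a _.
rewrite /sketch_basis sketch_of_scat /scat ltnNge leq_addr/= addKn; ring.
Qed.

Lemma step_good_prob v : coinE (N1 + K * d) (fun c => ind R (~ step_good v c)) <=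
  16 * d%:R ^+ 2 / (2 ^ lm)%:R + n%:R * (24 / 25) ^+ K.
Proof.
pose low c c' i := ind R (\sum_(k < K) sqproj d c' k
    (fun l => \sum_(a < d) A i a * sketch_basis v c a l) <
    K%:R * leverage v c i / 3).
apply: (@le_trans _ _ (coinE N1 (fun c =>
   ind R (~ sketch_good lm n d (wtrows v) c) + n%:R * (24 / 25) ^+ K))); last first.
  by rewrite coinED coinE_cst lerD2r sketch_good_prob.
rewrite coinE_cat; apply: le_coinE => c.
apply: (@le_trans _ _ (coinE (K * d) (fun c' =>
   ind R (~ sketch_good lm n d (wtrows v) c) + \sum_(i < n) low c c' i))).
  apply: le_coinE => c'.
  have low0 : 0 <= \sum_(i < n) low c c' i.
    by apply: sumr_ge0 => i _; exact: ind_ge0.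
  apply: ind_le; first by rewrite addr_ge0 ?ind_ge0.
  rewrite /step_good sketch_good_scat.
  case: (EM (sketch_good lm n d (wtrows v) c)) => skg; last first.
    by rewrite indT// lerDl.
  rewrite indF ?add0r// => bad; rewrite leNgt; apply/negP => s1; apply: bad.
  split => // i i_n; rewrite energy_scat leverage_scat leNgt.
  apply/negP => h; move: s1; apply/negP; rewrite -leNgt.
  rewrite (bigD1 (Ordinal i_n))//= /low indT// lerDl.
  by apply: sumr_ge0 => j _; exact: ind_ge0.
rewrite coinED coinE_cst lerD2l coinE_sum.
apply: (@le_trans _ _ (\sum_(i < n) (24 / 25) ^+ K)).
  by apply: ler_sum => i _; exact: sqproj_tail.
by rewrite sumr_const card_ord [leRHS]mulr_natl lexx.
Qed.

Definition lewis_sum (v : nat -> R) : R := \sum_(i < n) lewis v i.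

Lemma lewis_sum_ge0 v : 0 <= lewis_sum v.
Proof. by apply: sumr_ge0 => i _; exact: expR_ge0. Qed.

(** A trace computation: exchanging the sums gives the sum of [qform] over the columns of the
    sketched basis. These have sketched norm at most 1, hence [qform] at most 2. *)
Lemma leverage_sum v c : sketch_good lm n d (wtrows v) c ->
  \sum_(i < n) rowwt v i ^+ 2 * leverage v c i <= 2 * d%:R.
Proof.
move=> skg; set B := sketch_basis v c.
have -> : \sum_(i < n) rowwt v i ^+ 2 * leverage v c i =
    \sum_(l < d) qform v (fun a => B a l).
  under eq_bigr do rewrite mulr_sumr.
  by rewrite exchange_big; apply: eq_bigr => l _; rewrite qformE.
apply: (@le_trans _ _ (\sum_(l < d) 2)); last first.
  by rewrite sumr_const card_ord mulr_natr.
apply: ler_sum => l _; have := skg (fun a => B a l).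
rewrite -/(qform v _) ler_norml => /andP[+ _].
have := @gs_unit_le R d (2 ^ lm) (sketch_of v c) l.
rewrite -/(sketch_basis v c) -/B -/(sketch_of v c) => h1 h2; lra.
Qed.

(** Once the sketch is fixed, [energy / K] has mean [leverage]. So the second term of [lewis_split]
    averages to at most 5 times the bound [2 d] of [leverage_sum]. *)
Lemma lewis_sum_step v : lewis_inv v ->
  coinE (N1 + K * d) (fun c => lewis_sum (lewis_step v c) * ind R (step_good v c))
  <= lewis_sum v / 4 + 10 * d%:R.
Proof.
move=> vP; have KR : 0 < K%:R :> R by rewrite ltr0n.
apply: (@le_trans _ _ (coinE N1 (fun c => lewis_sum v / 4 +
   10 * d%:R))); last by rewrite coinE_cst.
rewrite coinE_cat; apply: le_coinE => c.
case: (EM (sketch_good lm n d (wtrows v) c)) => skg; last first.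
  apply: (@le_trans _ _ (coinE (K * d) (fun=> 0))).
    apply: le_coinE => c'; rewrite indF ?mulr0// => -[].
    by rewrite sketch_good_scat.
  by rewrite coinE_cst addr_ge0// ?mulr_ge0// lewis_sum_ge0.
apply: (@le_trans _ _ (coinE (K * d) (fun c' => lewis_sum v / 4 +
   \sum_(i < n) rowwt v i ^+ 2 * (5 / K%:R) * energy v (scat N1 c c') i))).
  apply: le_coinE => c'.
  have RHS0 : 0 <= \sum_(i < n) rowwt v i ^+ 2 * (5 / K%:R) * energy v (scat N1 c c') i.
    apply: sumr_ge0 => i _; apply: mulr_ge0.
      by rewrite mulr_ge0 ?sqr_ge0// divr_ge0// ltW.
    by apply: sumr_ge0 => k _; exact: sqr_ge0.
  case: (EM (step_good v (scat N1 c c'))) => gd; last first.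
    by rewrite indF// mulr0 addr_ge0// mulr_ge0// lewis_sum_ge0.
  rewrite indT// mulr1 /lewis_sum mulr_suml -big_split.
  apply: ler_sum => i _ /=.
  have [v'0 _] := lewis_inv_step vP gd.
  apply: le_trans (lewis_split (v'0 _ (ltn_ord i)) (lewis_step_le _ _ _)) _.
  rewrite lerD2l -mulrA ler_wpM2l ?sqr_ge0// /lewis_step.
  by case: ifP => [_|/negbT]; [|rewrite -leNgt]; lra.
rewrite coinED coinE_cst lerD2l coinE_sum.
rewrite (eq_bigr (fun i : 'I_n => 5 * (rowwt v i ^+ 2 * leverage v c i))); last first.
  move=> i _; rewrite coinEZ.
  rewrite (@eq_coinE _ _ _ (fun c' => \sum_(k < K) sqproj d c' k
    (fun l => \sum_(a < d) A i a * sketch_basis v c a l))); last first.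
    by move=> c'; rewrite energy_scat.
  rewrite coinE_sum; under eq_bigr => k _ do rewrite coinE_sqproj//.
  rewrite sumr_const card_ord -[leverage v c i]/(\sum_(l < d) _ ^+ 2).
  by rewrite -mulr_natl; field; rewrite gt_eqF.
by rewrite -mulr_sumr; have := leverage_sum skg; lra.
Qed.

End LewisStep.

(** * Iterating the reweighting *)

Section LewisIteration.
Variable R : realType.
Local Notation coinE := (@coinE R).
Variables (p : R) (n d : nat) (A : nat -> nat -> R).
Hypotheses (p1 : 1 <= p) (p2 : p < 2).
Hypothesis A0 : forall i, (i < n)%N -> exists2 a, (a < d)%N & A i a != 0.
Variables (lm K : nat).
Hypothesis K0 : (0 < K)%N.

Let len := (n * lm.+1 + K * d)%N.

Definition sshift (a : nat) (c : nat -> bool) : nat -> bool := fun k => c (a + k)%N.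

Local Notation lstep := (@lewis_step R p n d A lm K).
Local Notation sgood := (@step_good R p n d A lm K).
Local Notation linv := (@lewis_inv R p n d A).
Local Notation lsum := (@lewis_sum R p n).

Lemma step_local v c c' : (forall k, (k < len)%N -> c k = c' k) ->
  lstep v c = lstep v c' /\ sgood v c = sgood v c'.
Proof.
move=> cc'.
have hh i : (i < n)%N -> rowhash lm c i = rowhash lm c' i.
  move=> i_n; apply: eq_bitsv => b bl; apply: cc'; rewrite /len.
  exact: ltn_addr (radix_ltn i_n (leqW bl)).
have ss i : (i < n)%N -> rowsign R lm c i = rowsign R lm c' i.
  move=> i_n; rewrite /rowsign cc'// /len.
  exact: ltn_addr (radix_ltn i_n (ltnSn lm)).
have sk : sketch_of p n A lm v c = sketch_of p n A lm v c'.
  by apply/funext => r; apply/funext => a; apply: eq_bigr => i _; rewrite hh ?ss.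
have en : energy p n d A lm K v c = energy p n d A lm K v c'.
  apply/funext => i; apply: eq_bigr => k _; congr (_ ^+ 2).
  apply: eq_bigr => a _; congr (_ * _); apply: eq_bigr => l _.
  rewrite /sketch_basis sk cc'// /len ltn_add2l.
  exact: radix_ltn.
split; first by apply/funext => i; rewrite /lewis_step en.
rewrite /step_good /sketch_good -/(sketch_of p n A lm v c).
by rewrite -/(sketch_of p n A lm v c') /leverage /sketch_basis sk en.
Qed.

Fixpoint lewis_run (T : nat) (v : nat -> R) (c : nat -> bool) : nat -> R :=
  if T is T'.+1 then lstep (lewis_run T' v c) (sshift (T' * len) c) else v.

Definition run_good (T : nat) (v : nat -> R) (c : nat -> bool) : Prop :=
  forall t, (t < T)%N -> sgood (lewis_run t v c) (sshift (t * len) c).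

Lemma lewis_run_local T v c c' : (forall k, (k < T * len)%N -> c k = c' k) ->
  lewis_run T v c = lewis_run T v c'.
Proof.
elim: T => //= T IH cc'.
rewrite IH => [|k kT]; last by apply: cc'; rewrite mulSn ltn_addl.
apply: (step_local _ _).1 => k kl; apply: cc'.
by rewrite mulSn addnC ltn_add2r.
Qed.

Lemma run_good_local T v c c' : (forall k, (k < T * len)%N -> c k = c' k) ->
  run_good T v c = run_good T v c'.
Proof.
move=> cc'; apply/propext.
have h t : (t < T)%N -> sgood (lewis_run t v c) (sshift (t * len) c) =
    sgood (lewis_run t v c') (sshift (t * len) c').
  move=> tT; have tT' : (t.+1 * len <= T * len)%N by rewrite leq_mul2r tT orbT.
  rewrite (@lewis_run_local t v c c') => [|k kt]; last first.
    apply: cc'; apply: leq_trans tT'; rewrite mulSn; exact: ltn_addl.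
  apply: (step_local _ _).2 => k kl; apply: cc'.
  by apply: leq_trans tT'; rewrite mulSn addnC ltn_add2r.
by split => g t tT; [rewrite -h|rewrite h]; rewrite ?g//; exact: g.
Qed.

Lemma sshift_scat M c c' : sshift M (scat M c c') = c'.
Proof.
by apply/funext => k; rewrite /sshift /scat ltnNge leq_addr/= addKn.
Qed.

Lemma lewis_run_scat T v c c' :
  lewis_run T v (scat (T * len) c c') = lewis_run T v c.
Proof. by apply: lewis_run_local => k kT; rewrite /scat kT. Qed.

Lemma run_goodS T v c c' : run_good T.+1 v (scat (T * len) c c') <->
  run_good T v c /\ sgood (lewis_run T v c) c'.
Proof.
rewrite -(@run_good_local T v (scat (T * len) c c') c); last first.
  by move=> k kT; rewrite /scat kT.
split=> [g|[g gT] t].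
  split=> [t tT|]; first by apply: g; exact: ltnW.
  by have := g T (ltnSn T); rewrite lewis_run_scat sshift_scat.
rewrite ltnS leq_eqVlt => /predU1P[->|]; last exact: g.
by rewrite lewis_run_scat sshift_scat.
Qed.

Lemma run_good_inv T v c : linv v -> run_good T v c -> linv (lewis_run T v c).
Proof.
move=> vP; elim: T => //= T IH g.
apply: (lewis_inv_step p2 A0 K0); last by apply: g.
by apply: IH => t tT; apply: g; exact: ltnW.
Qed.

Lemma run_good_prob T v : coinE (T * len) (fun c => ind R (~ run_good T v c)) <=
  T%:R * (16 * d%:R ^+ 2 / (2 ^ lm)%:R + n%:R * (24 / 25) ^+ K).
Proof.
set delta := _ + _; elim: T => [|T IH].
  rewrite mul0r mul0n /= (_ : (~ run_good 0 v _) = False) ?indF//.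
  by apply/propext; split => // h; apply: h.
rewrite mulSnr coinE_cat -[leRHS](coinE_cst (T * len)).
apply: (@le_trans _ _ (coinE (T * len) (fun c =>
    ind R (~ run_good T v c) + delta))); last first.
  by rewrite coinED !coinE_cst -addn1 natrD mulrDl mul1r lerD2r.
apply: le_coinE => c.
case: (EM (run_good T v c)) => g; last first.
  rewrite [X in _ <= X + _]indT//.
  apply: (@le_trans _ _ (coinE len (fun=> 1))).
    by apply: le_coinE => c'; exact: ind_le1.
  rewrite coinE_cst lerDl addr_ge0// ?mulr_ge0 ?divr_ge0 ?exprn_ge0//.
have -> : ind R (~ run_good T v c) = 0 by apply: indF => h; exact: h.
rewrite add0r.
apply: le_trans (step_good_prob p n d A lm K (lewis_run T v c)).
apply: le_coinE => c'; apply: ind_le => [|h]; first exact: ind_ge0.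
by rewrite indT// => g'; apply: h; apply/run_goodS.
Qed.

(** The indicator restricts the mean to runs in which the invariant holds, where [lewis_sum_step]
    applies. The recursion [x -> x/4 + 10 d] has fixed point [40 d / 3 <= 14 d]. *)
Lemma lewis_run_sum T v : linv v ->
  coinE (T * len) (fun c => lsum (lewis_run T v c) * ind R (run_good T v c)) <=
  lsum v / 4 ^+ T + 14 * d%:R.
Proof.
move=> vP; elim: T => [|T IH].
  by rewrite mul0n /= expr0 divr1 indT ?mulr1 ?lerDl ?mulr_ge0//.
rewrite mulSnr coinE_cat.
apply: (@le_trans _ _ (coinE (T * len) (fun c =>
    4^-1 * (lsum (lewis_run T v c) * ind R (run_good T v c)) + 10 * d%:R))).
  apply: le_coinE => c; case: (EM (run_good T v c)) => g; last first.
    rewrite indF// !mulr0 add0r.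
    apply: (@le_trans _ _ (coinE len (fun=> 0))); last first.
      by rewrite coinE_cst mulr_ge0.
    by apply: le_coinE => c'; rewrite indF ?mulr0// => /run_goodS[].
  rewrite indT// mulr1 mulrC.
  apply: le_trans (lewis_sum_step p1 p2 A0 lm K0 (run_good_inv vP g)).
  apply: le_coinE => c' /=; rewrite lewis_run_scat sshift_scat.
  apply: ler_wpM2l; first exact: lewis_sum_ge0.
  apply: ind_le => [|/run_goodS[_ h]]; first exact: ind_ge0.
  by rewrite indT.
rewrite coinED coinEZ coinE_cst exprS invfM.
set E := coinE _ _ in IH *; set D := d%:R in IH *.
have D0 : 0 <= D by exact: ler0n.
have -> : lsum v * (4^-1 * (4 ^+ T)^-1) = (lsum v / 4 ^+ T) / 4 by ring.
lra.
Qed.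

(** A union bound over the rounds, plus Markov's inequality for the sum on good runs. *)
Lemma lewis_run_prob T (S : R) v : 0 < S -> linv v ->
  coinE (T * len) (fun c =>
    ind R (~ (linv (lewis_run T v c) /\ lsum (lewis_run T v c) <= S))) <=
  T%:R * (16 * d%:R ^+ 2 / (2 ^ lm)%:R + n%:R * (24 / 25) ^+ K) +
  (lsum v / 4 ^+ T + 14 * d%:R) / S.
Proof.
move=> S0 vP; apply: le_trans (lerD (run_good_prob T v) (ler_wpM2r _
  (lewis_run_sum T vP))); last by rewrite invr_ge0 ltW.
rewrite [X in _ + X]mulrC -coinEZ -coinED; apply: le_coinE => c.
have ls0 := @lewis_sum_ge0 R p n (lewis_run T v c).
apply: ind_le => [|h].
  by rewrite addr_ge0 ?ind_ge0// !mulr_ge0 ?ind_ge0 ?invr_ge0 ?(ltW S0).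
case: (EM (run_good T v c)) => g; last first.
  rewrite [X in X + _]indT// lerDl !mulr_ge0 ?ind_ge0 ?invr_ge0 ?(ltW S0)//.
have -> : ind R (~ run_good T v c) = 0 by apply: indF => h'; exact: h'.
rewrite add0r.
rewrite indT// mulr1 mulrC ler_pdivlMr// mul1r leNgt; apply/negP => h'.
by apply: h; split; [exact: run_good_inv|exact: ltW].
Qed.

End LewisIteration.

(** * Row sampling *)

Section Contraction.
Variable R : realType.
Local Notation coinE := (@coinE R).
Local Notation sg := (@sgc R).
Variables (X : Type) (P : X -> Prop) (N : nat).

(* A choice [x] of a point for every outcome of the coins stands for the supremum
   of the usual contraction principle, which need not be attained. *)
Lemma rademacher_contraction1 k (G phi lam : (nat -> bool) -> X -> R) (x : (nat -> bool) -> X) :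
  (k < N)%N ->
  (forall c a, G (flip k c) a = G c a) ->
  (forall c a, phi (flip k c) a = phi c a) ->
  (forall c a, lam (flip k c) a = lam c a) ->
  (forall c a b, P a -> P b -> `|phi c a - phi c b| <= `|lam c a - lam c b|) ->
  (forall c, P (x c)) ->
  exists2 y : (nat -> bool) -> X, (forall c, P (y c)) &
    coinE N (fun c => G c (x c) + sg (c k) * phi c (x c)) <=
    coinE N (fun c => G c (y c) + sg (c k) * lam c (y c)).
Proof.
move=> kN GI phiI lamI lip Px.
(* Outcomes are paired by flipping coin [k]. The chosen points of a pair are exchanged, in both
   outcomes at once, if that makes the difference of [lam] agree in sign with the coin; the two
   values of [G] have the same sum either way. *)
pose cnd c := 0 <= sg (c k) * (lam c (x c) - lam c (x (flip k c))).
exists (fun c => if cnd c then x c else x (flip k c)).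
  by move=> c; case: ifP.
rewrite (coinE_flip_half _ kN) [leRHS](coinE_flip_half _ kN).
apply: le_coinE => c; rewrite ler_pM2r ?invr_gt0//.
have -> : cnd (flip k c) = cnd c.
  rewrite /cnd flipE sgcN flipK !lamI; congr (0 <= _); ring.
rewrite !flipE !sgcN flipK !GI !phiI !lamI.
set a := x c; set b := x (flip k c).
have lip1 : sg (c k) * (phi c a - phi c b) <= `|lam c a - lam c b|.
  apply: le_trans (lip c a b (Px _) (Px _)); apply: le_trans (ler_norm _) _.
  by rewrite normrM; case: (c k); rewrite /sgc ?normrN normr1 mul1r.
case: ifP => h.
  have : `|lam c a - lam c b| = sg (c k) * (lam c a - lam c b).
    rewrite -(ger0_norm h) normrM.
    by case: (c k); rewrite /sgc ?normrN normr1 mul1r.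
  by move=> E; rewrite E in lip1; lra.
have {}h : sg (c k) * (lam c a - lam c b) <= 0.
  rewrite leNgt; apply/negP => /ltW h'; have : cnd c by [].
  by rewrite h.
have : `|lam c a - lam c b| = - (sg (c k) * (lam c a - lam c b)).
  rewrite -(ler0_norm h) normrM.
  by case: (c k); rewrite /sgc ?normrN normr1 mul1r.
by move=> E; rewrite E in lip1; lra.
Qed.

(** The terms are replaced one at a time, with the ones already replaced absorbed in [G]. [phi] and
    [lam] may depend on coins outside [pos]: in the application these are the coins of later
    levels. *)
Lemma rademacher_contraction m (pos : nat -> nat) (phi lam : nat -> (nat -> bool) -> X -> R)
    (x : (nat -> bool) -> X) :
  (forall i, (i < m)%N -> (pos i < N)%N) ->
  (forall i j, (i < j)%N -> (j < m)%N -> pos i != pos j) ->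
  (forall i j c a, (i < m)%N -> (j < m)%N -> phi i (flip (pos j) c) a = phi i c a) ->
  (forall i j c a, (i < m)%N -> (j < m)%N -> lam i (flip (pos j) c) a = lam i c a) ->
  (forall i c a b, (i < m)%N -> P a -> P b ->
     `|phi i c a - phi i c b| <= `|lam i c a - lam i c b|) ->
  (forall c, P (x c)) ->
  exists2 y : (nat -> bool) -> X, (forall c, P (y c)) &
    coinE N (fun c => \sum_(i < m) sg (c (pos i)) * phi i c (x c)) <=
    coinE N (fun c => \sum_(i < m) sg (c (pos i)) * lam i c (y c)).
Proof.
move=> posN posI phiI lamI lip Px.
suff h k (G : (nat -> bool) -> X -> R) (z : (nat -> bool) -> X) : (k <= m)%N ->
    (forall j c a, (j < k)%N -> G (flip (pos j) c) a = G c a) ->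
    (forall c, P (z c)) ->
    exists2 y : (nat -> bool) -> X, (forall c, P (y c)) &
    coinE N (fun c => G c (z c) + \sum_(i < k) sg (c (pos i)) * phi i c (z c)) <=
    coinE N (fun c => G c (y c) + \sum_(i < k) sg (c (pos i)) * lam i c (y c)).
  have [y Py hy] := h m (fun _ _ => 0) x (leqnn m) (fun _ _ _ _ => erefl) Px.
  exists y => //; apply: le_trans (le_trans _ hy) _; apply: le_coinE => c;
    by rewrite add0r.
elim: k G z => [|k IH] G z km GI Pz.
  by exists z => //; apply: le_coinE => c; rewrite !big_ord0.
have kmW := ltnW km.
pose G1 c a := G c a + \sum_(i < k) sg (c (pos i)) * phi i c a.
have [|||||y1 Py1 h1] := @rademacher_contraction1 (pos k) G1 (phi k) (lam k) z (posN _ km).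
- move=> c a; rewrite /G1 GI//; congr (_ + _); apply: eq_bigr => i _.
  have ik := ltn_ord i; rewrite phiI ?(ltn_trans ik)// flip_neq//.
  by rewrite posI.
- by move=> c a; exact: phiI.
- by move=> c a; exact: lamI.
- by move=> c a b; exact: lip.
- by [].
pose G2 c a := G c a + sg (c (pos k)) * lam k c a.
have [|y Py h2] := IH G2 y1 kmW _ Py1.
  move=> j c a jk; rewrite /G2 GI ?(ltnW jk)//; last exact: ltnW.
  rewrite lamI ?(ltn_trans jk)// flip_neq// eq_sym posI//.
exists y => //.
apply: (le_trans _ (le_trans h1 (le_trans _ (le_trans h2 _)))).
- by apply: le_coinE => c; rewrite /G1 big_ord_recr/= addrA.
- by apply: le_coinE => c; rewrite /G1 /G2 addrAC.
- by apply: le_coinE => c; rewrite /G2 big_ord_recr/= addrAC addrA.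
Qed.

End Contraction.

(** * Deviation of the sampled cost, level by level *)

Section Sampling.
Variable R : realType.
Local Notation coinE := (@coinE R).
Local Notation sg := (@sgc R).

Lemma powR_expR (x a : R) : 0 < x -> x `^ a = expR (a * ln x).
Proof. by rewrite /powR; case: eqP => // ->; rewrite ltxx. Qed.

(** No derivative is taken: for [T <= S], the bound [T^(p-1) >= S^(p-1) T / S] (as [p - 1 <= 1])
    gives [S^p - T^p <= S^(p-1) (S - T) (S + T) / S]. *)
Lemma powR_lipschitz (p v s t : R) : 1 <= p -> p < 2 -> 0 < v ->
  s ^+ 2 <= v -> t ^+ 2 <= v ->
  `| `|s| `^ p - `|t| `^ p | <= 2 * expR ((p - 1) / 2 * ln v) * `|s - t|.
Proof.
move=> p1 p2 v0.
wlog ts : s t / `|t| <= `|s|.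
  move=> W hs ht; have [/W|/ltW/W] := leP `|t| `|s|; first exact.
  by rewrite distrC (distrC s); apply.
move=> hs _; have S_ge0 : 0 <= `|s| by [].
apply: (@le_trans _ _ (2 * expR ((p - 1) / 2 * ln v) * (`|s| - `|t|))); last first.
  rewrite ler_wpM2l ?mulr_ge0 ?expR_ge0//.
  by apply: le_trans (ler_dist_dist s t); exact: ler_norm.
rewrite -real_normK ?num_real// in hs.
move: `|s| `|t| ts hs S_ge0 (normr_ge0 t) => S T TS Sv S0 T0.
have p0 : 0 <= p by lra.
rewrite ger0_norm; last by rewrite subr_ge0 ge0_ler_powR// nnegrE.
have [S_le0|S_gt0] := leP S 0.
  have -> : S = 0 by apply/eqP; rewrite eq_le S_le0.
  have -> : T = 0 by apply/eqP; rewrite eq_le T0 andbT (le_trans TS).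
  by rewrite !subrr mulr0.
have lnS : ln S <= ln v / 2.
  have : ln (S ^+ 2) <= ln v by rewrite ler_ln ?posrE// exprn_gt0.
  by rewrite lnXn// -mulr_natr => h; lra.
have SpE : S `^ p = S * expR ((p - 1) * ln S).
  rewrite powR_expR// -{2}(@lnK _ S) ?posrE// -expRD; congr expR; ring.
have le_e : expR ((p - 1) * ln S) <= expR ((p - 1) / 2 * ln v).
  by rewrite ler_expR; nra.
apply: (@le_trans _ _ (2 * expR ((p - 1) * ln S) * (S - T))); last first.
  by rewrite ler_wpM2r ?subr_ge0// ler_wpM2l.
set e := expR _ in SpE *; have e0 : 0 < e by exact: expR_gt0.
have [T_le0|T_gt0] := leP T 0.
  have -> : T = 0 by apply/eqP; rewrite eq_le T0 T_le0.
  rewrite powR0 ?subr0 ?SpE; last by rewrite gt_eqF//; lra.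
  by nra.
have TpE : T `^ p = T * expR ((p - 1) * ln T).
  rewrite powR_expR// -{2}(@lnK _ T) ?posrE// -expRD; congr expR; ring.
have : e * (T / S) <= expR ((p - 1) * ln T).
  have -> : e * (T / S) = expR ((p - 1) * ln S + (ln T - ln S)).
    rewrite expRD expRB !lnK ?posrE//.
  rewrite ler_expR.
  have : ln T <= ln S by rewrite ler_ln ?posrE.
  by nra.
move=> h; rewrite SpE TpE.
have : T * (e * (T / S)) <= T * expR ((p - 1) * ln T) by rewrite ler_wpM2l.
suff : S * e - T * (e * (T / S)) <= 2 * e * (S - T) by lra.
have -> : S * e - T * (e * (T / S)) = e * ((S - T) * ((S + T) / S)).
  by field; rewrite gt_eqF.
have -> : 2 * e * (S - T) = e * ((S - T) * 2) by ring.
rewrite ler_wpM2l ?(ltW e0)// ler_wpM2l ?subr_ge0//.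
by rewrite ler_pdivrMr//; lra.
Qed.

Variables (p : R) (n d : nat) (A : nat -> nat -> R) (v : nat -> R).
Hypotheses (p1 : 1 <= p) (p2 : p < 2).
Hypothesis vP : lewis_inv p n d A v.
Variables (L : nat) (J : nat -> nat) (Np theta : R).
Hypotheses (Np0 : 0 < Np) (theta0 : 0 < theta).
Hypothesis JL : forall i, (i < n)%N -> (J i <= L)%N.
(** A row with exponent 0 is always kept with weight 1 and causes no error, so its Lewis weight may
    be large. *)
Hypothesis Jle : forall i, (i < n)%N -> (0 < J i)%N ->
  Np * lewis p v i <= 2^-1 ^+ J i.
Hypothesis Sle : lewis_sum p n v / Np <= theta ^+ 2.

Definition lp_cost (x : nat -> R) : R := \sum_(i < n) `|mulv d A x i| `^ p.

(* The factor, 0 or 2^(J i - l), that the coins from level [l] on contribute to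
   the inverse probability weight of row [i]. *)
Definition keepwt (c : nat -> bool) (l i : nat) : R :=
  \prod_(l <= b < J i) (1 + sg (c (i * L + b)%N)).

Definition sampled_cost (c : nat -> bool) (x : nat -> R) : R :=
  \sum_(i < n) keepwt c 0 i * `|mulv d A x i| `^ p.

Let N := (n * L)%N.
Let ball (x : nat -> R) : Prop := qform p n d A v x <= 1.

Let v0 i : (i < n)%N -> 0 < v i. Proof. by case: vP => h _; exact: h. Qed.

Let ball_le x i : (i < n)%N -> ball x -> mulv d A x i ^+ 2 <= v i.
Proof.
move=> i_n xb; have [_ h] := vP; apply: le_trans (h i x i_n) _.
by rewrite ler_piMr// ltW// v0.
Qed.

Let keepwtS c l i : keepwt c l i =
  (if (l < J i)%N then 1 + sg (c (i * L + l)%N) else 1) * keepwt c l.+1 i.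
Proof.
rewrite /keepwt; case: ltnP => h; first by rewrite big_ltn.
by rewrite !big_geq ?mul1r//; exact: leqW.
Qed.

Let posN i l : (i < n)%N -> (l < L)%N -> (i * L + l < N)%N.
Proof. exact: radix_ltn. Qed.

Lemma coinE_keepwt i l : (i < n)%N -> coinE N (fun c => keepwt c l i) = 1.
Proof.
move=> i_n; have [k hk] : exists k, (J i - l <= k)%N by exists (J i - l)%N.
elim: k l hk => [|k IH] l hk.
  rewrite -[RHS](coinE_cst N); apply: eq_coinE => c.
  by rewrite /keepwt big_geq//; move: hk; lia.
case: (ltnP l (J i)) => lJ; last first.
  rewrite -[RHS](coinE_cst N); apply: eq_coinE => c.
  by rewrite /keepwt big_geq.
rewrite -[RHS](IH l.+1); last by lia.
have lL : (l < L)%N by exact: leq_trans lJ (JL i_n).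
rewrite -[RHS](@coinE_1Dsg R N (i * L + l)%N); last 2 first.
- exact: posN.
- move=> c; apply: eq_big_nat => b /andP[lb bJ]; rewrite flip_neq//.
  by rewrite eqn_add2l gtn_eqF.
by apply: eq_coinE => c; rewrite keepwtS lJ.
Qed.

(** Each factor is 0 or 2, and [x^2 = 2 x] for both. *)
Lemma keepwt_sqr c l i : keepwt c l i ^+ 2 = 2 ^+ (J i - l) * keepwt c l i.
Proof.
rewrite /keepwt expr2 -prodr_const_nat -!big_split/=.
by apply: eq_bigr => b _; case: (c _); rewrite /sgc; ring.
Qed.

(** Telescoping over the levels: the level-[l] coins enter linearly, with coefficients that depend
    only on later levels. Given those, each level is a Rademacher process. *)
Let diffE c x : sampled_cost c x - lp_cost x =
  \sum_(l < L) \sum_(i < n) sg (c (i * L + l)%N) *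
    ((l < J i)%:R * keepwt c l.+1 i * `|mulv d A x i| `^ p).
Proof.
rewrite exchange_big/= /sampled_cost /lp_cost -sumrB; apply: eq_bigr => i _.
have kL : keepwt c L i = 1 by rewrite /keepwt big_geq// JL.
rewrite -[X in _ - X]mul1r -{1}kL -mulrBl -opprB.
rewrite -(@telescope_sumr R 0 L (fun l => keepwt c l i))//.
rewrite big_mkord -sumrN mulr_suml; apply: eq_bigr => l _.
rewrite opprB (keepwtS c l); case: (ltnP l (J i)) => h /=; ring.
Qed.

Let level_var (l : nat) : R := 2 * theta ^+ 2 * 2^-1 ^+ l.

(** After contraction the level is linear in [x], and its supremum over the ball is a dual norm,
    with square [Z] in an orthonormal basis. The parameter [beta] of the arithmetic-geometric mean
    inequality avoids square roots and is fixed in [sampling_mean]. *)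
Let level_bound (l : nat) (sigma beta : R) (x : (nat -> bool) -> nat -> R) :
  (l < L)%N -> `|sigma| = 1 -> 0 < beta -> (forall c, ball (x c)) ->
  coinE N (fun c => sigma * \sum_(i < n) sg (c (i * L + l)%N) *
    ((l < J i)%:R * keepwt c l.+1 i * `|mulv d A (x c) i| `^ p)) <=
  (beta + level_var l / beta) / 2.
Proof.
move=> lL sigma1 beta0 xb.
pose kap i c := (l < J i)%:R * keepwt c l.+1 i *
  (2 * expR ((p - 1) / 2 * ln (v i))).
have posI i j : (i < j)%N -> (i * L + l != j * L + l)%N.
  move=> ij; apply/eqP => /(radix_inj lL lL)[e _].
  by rewrite e ltnn in ij.
have keepI i j c : (i < n)%N ->
    keepwt (flip (j * L + l) c) l.+1 i = keepwt c l.+1 i.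
  move=> i_n; case: (ltnP l (J i)) => lJ; last by rewrite /keepwt !big_geq// leqW.
  apply: eq_big_nat => b /andP[lb bJ]; rewrite flip_neq//.
  have bL : (b < L)%N by exact: leq_trans (JL i_n).
  by apply/eqP => /(radix_inj bL lL)[_ e]; rewrite e ltnn in lb.
have [||||||y yb hy] := @rademacher_contraction R (nat -> R) ball N n (fun i => i * L + l)%N
  (fun i c x => sigma * ((l < J i)%:R * keepwt c l.+1 i * `|mulv d A x i| `^ p))
  (fun i c x => kap i c * mulv d A x i) x.
- by move=> i i_n; exact: posN.
- by move=> i j ij _; exact: posI.
- by move=> i j c a i_n _; rewrite keepI.
- by move=> i j c a i_n _; rewrite /kap keepI.
- move=> i c a b i_n ab bb.
  have h := powR_lipschitz p1 p2 (v0 i_n) (ball_le i_n ab) (ball_le i_n bb).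
  set w := (l < J i)%:R * keepwt c l.+1 i.
  rewrite -!mulrBr [leLHS]normrM sigma1 mul1r [leLHS]normrM -/w.
  rewrite [leRHS]normrM [X in _ <= X * _]normrM -/w -(mulrA `|w|) ler_wpM2l//.
  by rewrite [`|2 * _|]ger0_norm// mulr_ge0 ?expR_ge0.
- exact: xb.
pose B := gs d (gram n (wtrows p A v)) d.
pose tt i l' := \sum_(a < d) A i a * B a l'.
pose s c i := sg (c (i * L + l)%N).
pose Z c := \sum_(l' < d) (\sum_(i < n) s c i * (kap i c * tt i l')) ^+ 2.
apply: (@le_trans _ _ (coinE N (fun c => \sum_(i < n) s c i *
    (kap i c * mulv d A (y c) i)))).
  apply: le_trans hy; apply: le_coinE => c; rewrite mulr_sumr.
  by apply: ler_sum => i _; rewrite mulrCA.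
(* [T <= beta / 2 + T^2 / (2 beta)], and [T^2 <= Z] on the ball. *)
apply: (@le_trans _ _ (coinE N (fun c => beta / 2 + (2 * beta)^-1 * Z c))).
  apply: le_coinE => c; set T := \sum_(i < n) _.
  pose t a := \sum_(i < n) (s c i * kap i c) * A i a.
  have tE (x' : nat -> R) : \sum_(a < d) t a * x' a =
      \sum_(i < n) (s c i * kap i c) * mulv d A x' i.
    rewrite /t; under eq_bigr do rewrite mulr_suml.
    rewrite exchange_big/=; apply: eq_bigr => i _.
    by rewrite /mulv mulr_sumr; apply: eq_bigr => a _; rewrite mulrA.
  have TZ : T ^+ 2 <= Z c.
    have -> : T = \sum_(a < d) t a * y c a.
      by rewrite tE; apply: eq_bigr => i _; rewrite mulrA.
    (* The constant is crude: it does not enter the resulting bound and only certifies that the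
       functional vanishes where the form does. *)
    have := @gs_functional_sqr R d n (wtrows p A v) t
      ((\sum_(i < n) (s c i * kap i c) ^+ 2) * \sum_(i < n) v i) _ (y c).
    rewrite -/(qform p n d A v (y c)).
    have -> : \sum_(l0 < d) (\sum_(a < d) t a * gs d (gram n (wtrows p A v)) d a l0) ^+ 2 = Z c.
      apply: eq_bigr => l' _; congr (_ ^+ 2).
      rewrite (tE (fun a => B a l')); apply: eq_bigr => i _.
      by rewrite -mulrA.
    move=> h; apply: le_trans (h _) _ => [x'|].
      rewrite tE; apply: le_trans (@sumr_sqr_le _ n (fun i => s c i * kap i c)
        (fun i => mulv d A x' i)) _.
      rewrite -mulrA ler_wpM2l ?sumr_ge0//; first by move=> i _; exact: sqr_ge0.
      rewrite mulr_suml; apply: ler_sum => i _.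
      by have [_] := vP; apply.
    by rewrite ler_piMl ?yb// sumr_ge0// => l' _; exact: sqr_ge0.
  rewrite -(ler_pM2l (_ : 0 < 2 * beta)) ?mulr_gt0//.
  rewrite mulrDr mulVKf ?mulf_neq0 ?gt_eqF//.
  have := sqr_ge0 (beta - T).
  have -> : 2 * beta * (beta / 2) = beta ^+ 2 by field.
  by nra.
rewrite coinED coinE_cst coinEZ coinE_sum.
have EZ l' : coinE N (fun c => (\sum_(i < n) s c i * (kap i c * tt i l')) ^+ 2) =
    \sum_(i < n) coinE N (fun c => kap i c ^+ 2) * tt i l' ^+ 2.
  rewrite (@coinE_rademacher_sqr R N n (fun i => i * L + l)%N
    (fun i c => kap i c * tt i l'))//.
  - by apply: eq_bigr => i _; rewrite mulrC -coinEZ; apply: eq_coinE => c;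
      rewrite exprMn mulrC.
  - by move=> i i_n; exact: posN.
  - by move=> i j ij _; exact: posI.
  - by move=> i j c ij jn; rewrite /kap keepI// (leq_ltn_trans ij).
under eq_bigr do rewrite EZ.
rewrite exchange_big/=.
have hsum : \sum_(i < n) \sum_(l' < d) coinE N (fun c => kap i c ^+ 2) *
    tt i l' ^+ 2 <= level_var l.
  apply: (@le_trans _ _ (\sum_(i < n) (2 * 2^-1 ^+ l / Np) * lewis p v i)).
    apply: ler_sum => i _; have i_n := ltn_ord i; rewrite -mulr_sumr.
    have tau_le : \sum_(l' < d) tt i l' ^+ 2 <= v i.
      apply: gs_functional_norm; last exact/ltW/v0.
      by move=> x'; have [_] := vP; apply.
    have Ek : coinE N (fun c => kap i c ^+ 2) = (l < J i)%:R *
        (2 ^+ (J i - l.+1) * (4 * expR ((p - 1) * ln (v i)))).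
      rewrite (@eq_coinE _ _ _ (fun c => ((l < J i)%:R *
        (2 ^+ (J i - l.+1) * (4 * expR ((p - 1) * ln (v i))))) * keepwt c l.+1 i)).
        by rewrite coinEZ coinE_keepwt// mulr1.
      move=> c; rewrite /kap !exprMn keepwt_sqr -expRM_natl.
      have -> : 2%:R * ((p - 1) / 2 * ln (v i)) = (p - 1) * ln (v i) by field.
      by case: (l < J i)%N; rewrite /= ?expr1n ?expr0n/=; ring.
    have Ek0 : 0 <= coinE N (fun c => kap i c ^+ 2).
      by apply: coinE_ge0 => c; exact: sqr_ge0.
    apply: le_trans (ler_wpM2l Ek0 tau_le) _; rewrite {}Ek.
    case: (ltnP l (J i)) => lJ; last first.
      by rewrite !mul0r mulr_ge0 ?expR_ge0// divr_ge0 ?mulr_ge0 ?exprn_ge0 ?invr_ge0// ltW.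
    have J0 : (0 < J i)%N by exact: leq_ltn_trans lJ.
    (* Of the two factors [lewis p v i], one is cancelled against [2^(J i)] by [Jle]; what remains
       is linear in [lewis] and of order [2^-l / Np]. *)
    rewrite mul1r; have vE : expR ((p - 1) * ln (v i)) * v i = lewis p v i ^+ 2.
      rewrite -[X in _ * X](@lnK _ (v i)) ?posrE ?v0// -expRD -expRM_natl.
      by congr expR; field.
    have -> : 2 ^+ (J i - l.+1) * (4 * expR ((p - 1) * ln (v i))) * v i =
      4 * 2 ^+ (J i - l.+1) * lewis p v i * lewis p v i.
      by rewrite -!mulrA vE; ring.
    apply: ler_wpM2r; first exact: expR_ge0.
    rewrite ler_pdivlMr//.
    have -> : 4 * 2 ^+ (J i - l.+1) * lewis p v i * Np =
      4 * 2 ^+ (J i - l.+1) * (Np * lewis p v i) by ring.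
    apply: (@le_trans _ _ (4 * 2 ^+ (J i - l.+1) * 2^-1 ^+ J i)).
      by rewrite ler_wpM2l ?Jle// mulr_ge0// exprn_ge0.
    have -> : 2^-1 ^+ J i = 2^-1 ^+ (J i - l.+1) * (2^-1 * 2^-1 ^+ l) :> R.
      by rewrite -exprS -exprD subnK.
    have uw : 2 ^+ (J i - l.+1) * 2^-1 ^+ (J i - l.+1) = 1 :> R.
      by rewrite -exprMn mulfV// expr1n.
    have -> : 4 * 2 ^+ (J i - l.+1) * (2^-1 ^+ (J i - l.+1) * (2^-1 * 2^-1 ^+ l)) =
      2 * (2 ^+ (J i - l.+1) * 2^-1 ^+ (J i - l.+1)) * 2^-1 ^+ l :> R by field.
    by rewrite uw mulr1.
  rewrite -mulr_sumr -/(lewis_sum p n v) /level_var.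
  have -> : 2 * 2^-1 ^+ l / Np * lewis_sum p n v =
    2 * 2^-1 ^+ l * (lewis_sum p n v / Np) by ring.
  have -> : 2 * theta ^+ 2 * 2^-1 ^+ l = 2 * 2^-1 ^+ l * theta ^+ 2 by ring.
  by apply: ler_wpM2l Sle; rewrite mulr_ge0// exprn_ge0.
have -> : (beta + level_var l / beta) / 2 = beta / 2 + (2 * beta)^-1 * level_var l.
  by field; rewrite gt_eqF.
by rewrite lerD2l ler_wpM2l// invr_ge0 mulr_ge0// ltW.
Qed.

Lemma sum_geometric (x : R) k : 0 <= x < 1 -> \sum_(l < k) x ^+ l <= (1 - x)^-1.
Proof.
move=> /andP[x0 x1]; rewrite -[leRHS]mul1r ler_pdivlMr ?subr_gt0// mulrC.
have := @subrXX R 1 x k; rewrite expr1n => E.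
have -> : (1 - x) * \sum_(l < k) x ^+ l = 1 - x ^+ k.
  rewrite E; congr (_ * _).
  by apply: eq_bigr => i _; rewrite expr1n mul1r.
by rewrite gerBl exprn_ge0.
Qed.

Lemma sampling_mean (sigma : R) (x : (nat -> bool) -> nat -> R) :
  `|sigma| = 1 -> (forall c, ball (x c)) ->
  coinE N (fun c => sigma * (sampled_cost c (x c) - lp_cost (x c))) <= 5 * theta.
Proof.
move=> s1 xb.
rewrite (@eq_coinE _ _ _ (fun c => \sum_(l < L) sigma * \sum_(i < n)
    sg (c (i * L + l)%N) *
    ((l < J i)%:R * keepwt c l.+1 i * `|mulv d A (x c) i| `^ p))); last first.
  by move=> c; rewrite diffE mulr_sumr.
rewrite coinE_sum.
(* Taking [beta = theta (3/4)^l] at level [l] leaves [level_var / beta = 2 theta (2/3)^l], because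
   [1/2 = 3/4 * 2/3]. Both series converge and give [theta / 2 * 4 + theta * 3 = 5 theta]. *)
apply: (@le_trans _ _ (\sum_(l < L) (theta / 2 * (3 / 4) ^+ l + theta * (2 / 3) ^+ l))).
  apply: ler_sum => l _.
  have b0 : 0 < theta * (3 / 4) ^+ l by rewrite mulr_gt0// exprn_gt0.
  apply: le_trans (level_bound (ltn_ord l) s1 b0 xb) _.
  rewrite /level_var le_eqVlt; apply/orP; left; apply/eqP.
  have -> : 2^-1 ^+ l = (3 / 4) ^+ l * (2 / 3) ^+ l :> R.
    by rewrite -exprMn; congr (_ ^+ _); field.
  by field; rewrite expf_neq0// gt_eqF.
rewrite big_split/= -!mulr_sumr.
have h1 : \sum_(l < L) (3 / 4) ^+ l <= 4 :> R.
  apply: le_trans (sum_geometric _ _) _; first by apply/andP; split; lra.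
  by rewrite -[leRHS]invrK lef_pV2 ?posrE; lra.
have h2 : \sum_(l < L) (2 / 3) ^+ l <= 3 :> R.
  apply: le_trans (sum_geometric _ _) _; first by apply/andP; split; lra.
  by rewrite -[leRHS]invrK lef_pV2 ?posrE; lra.
have := ler_wpM2l (ltW theta0) h1; have := ler_wpM2l (ltW theta0) h2.
by move: (\sum_(l < L) _) (\sum_(l < L) _) => u1 u2; lra.
Qed.

(** Markov's inequality without a supremum: a violating point is chosen for every outcome that has
    one, and 0 otherwise, and [sampling_mean] is applied to this choice, once for each sign. *)
Lemma sampling_prob (eta : R) : 0 < eta ->
  coinE N (fun c => ind R (exists2 x, ball x &
    eta < `|sampled_cost c x - lp_cost x|)) <= 10 * theta / eta.
Proof.
move=> eta0.
have ball0 : ball (fun=> 0).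
  by rewrite /ball /qform /ip big1// => r _; rewrite mulv0 mul0r.
have side (sigma : R) : `|sigma| = 1 -> coinE N (fun c => ind R (exists2 x, ball x &
    eta < sigma * (sampled_cost c x - lp_cost x))) <= 5 * theta / eta.
  move=> s1.
  pose Q c := exists2 x, ball x & eta < sigma * (sampled_cost c x - lp_cost x).
  have /choice[x xP] : forall c, exists x, ball x /\
      eta * ind R (Q c) <= sigma * (sampled_cost c x - lp_cost x).
    move=> c; case: (EM (Q c)) => q.
      by have [x xb xe] := q; exists x; rewrite indT// mulr1 ltW.
    exists (fun=> 0); rewrite indF// mulr0; split => //.
    rewrite /sampled_cost /lp_cost !big1 ?subrr ?mulr0// => i _;
      by rewrite mulv0 normr0 powR0 ?mulr0//; apply: lt0r_neq0; move: (p1) => h; lra.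
  rewrite ler_pdivlMr// mulrC -coinEZ.
  apply: le_trans (@sampling_mean sigma x s1 _); last by move=> c; have [] := xP c.
  by apply: le_coinE => c; have [] := xP c.
apply: (@le_trans _ _ (5 * theta / eta + 5 * theta / eta)); last by lra.
apply: le_trans (lerD (side 1 (normr1 _)) (side (-1) _)); last by rewrite normrN1.
rewrite -coinED; apply: le_coinE => c.
apply: ind_le => [|[x xb]]; first by rewrite addr_ge0 ?ind_ge0.
rewrite lter_normr => /orP[h|h].
  rewrite [X in X + _]indT ?lerDl ?ind_ge0//; exists x => //.
  by rewrite mul1r.
rewrite [X in _ + X]indT ?lerDr ?ind_ge0//; exists x => //.
by rewrite mulN1r.
Qed.

Definition kept (c : nat -> bool) (i : nat) : bool :=
  [forall l : 'I_(J i), c (i * L + l)%N].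

Lemma keepwt_kept c i : keepwt c 0 i = 2 ^+ J i * (kept c i)%:R.
Proof.
rewrite /keepwt big_mkord /kept.
case: forallP => [h|/forallP].
  rewrite mulr1 -[J i in RHS]card_ord -prodr_const; apply: eq_bigr => l _.
  by rewrite h.
rewrite negb_forall => /existsP[l /negbTE h]; rewrite mulr0.
by rewrite (bigD1 l)//= h /sgc subrr mul0r.
Qed.

Hypothesis Jgt : forall i, (i < n)%N -> (J i < L)%N ->
  2^-1 ^+ J i < 2 * (Np * lewis p v i).

(** Below the cap [L] the keeping probability is within a factor 2 of its target; a row at the cap
    adds at most [2^-L]. *)
Lemma kept_mean : coinE N (fun c => (\sum_(i < n) kept c i)%:R) <=
  2 * Np * lewis_sum p n v + n%:R * 2^-1 ^+ L.
Proof.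
rewrite (@eq_coinE _ _ _ (fun c => \sum_(i < n) 2^-1 ^+ J i * keepwt c 0 i)); last first.
  move=> c; rewrite natr_sum; apply: eq_bigr => i _.
  by rewrite keepwt_kept mulrA -exprMn mulVf// expr1n mul1r.
rewrite coinE_sum.
apply: (@le_trans _ _ (\sum_(i < n) (2 * Np * lewis p v i + 2^-1 ^+ L))).
  apply: ler_sum => i _; rewrite coinEZ coinE_keepwt// mulr1.
  have w0 : 0 < lewis p v i by exact: expR_gt0.
  have [JL'|] := ltnP (J i) L.
    rewrite -mulrA; apply: le_trans (ltW (Jgt _ JL')) _ => //.
    by rewrite lerDl exprn_ge0.
  move=> LJ; have -> : J i = L by apply/eqP; rewrite eqn_leq LJ JL.
  by rewrite lerDr !mulr_ge0// ltW.
by rewrite big_split/= -mulr_sumr sumr_const card_ord [X in _ <= _ + X]mulr_natl lexx.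
Qed.

End Sampling.

(** * Comparing the cost with the quadratic form *)

Section CostComparison.
Variable R : realType.
Variables (p : R) (n d : nat) (A : nat -> nat -> R) (v : nat -> R).
Hypotheses (p1 : 1 <= p) (p2 : p < 2).
Hypothesis vP : lewis_inv p n d A v.

Local Notation q := (qform p n d A v).
Local Notation cost := (lp_cost p n d A).

Lemma qformZ c x : q (fun a => c * x a) = c ^+ 2 * q x.
Proof.
rewrite !qformE mulr_sumr; apply: eq_bigr => i _.
by rewrite mulvZ exprMn; ring.
Qed.

Lemma lp_costZ c x : 0 < c -> cost (fun a => c * x a) = c `^ p * cost x.
Proof.
move=> c0; rewrite /lp_cost mulr_sumr; apply: eq_bigr => i _.
by rewrite mulvZ normrM powRM// gtr0_norm.
Qed.

Lemma lp_cost_ge0 x : 0 <= cost x.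
Proof. by apply: sumr_ge0 => i _; exact: powR_ge0. Qed.

Lemma qform_eq0 x i : q x = 0 -> (i < n)%N -> mulv d A x i = 0.
Proof.
move=> q0 i_n; have [_ h] := vP; have := h i x i_n; rewrite q0 mulr0 => h0.
by apply/eqP; rewrite -sqrf_eq0 eq_le h0 sqr_ge0.
Qed.

Lemma lp_cost_eq0 x : q x = 0 -> cost x = 0.
Proof.
move=> q0; rewrite /lp_cost big1// => i _; rewrite qform_eq0// normr0 powR0//.
by rewrite gt_eqF//; move: (p1) => h; lra.
Qed.

(** Termwise: the invariant gives [y^2 <= v_i], so that [v_i^(-(1-p/2)) y^2 <= |y|^p]. *)
Lemma lp_cost_ge1 x : q x = 1 -> 1 <= cost x.
Proof.
move=> q1; rewrite -{1}q1 qformE /lp_cost; apply: ler_sum => i _.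
have i_n := ltn_ord i; have [v0 hv] := vP.
have := hv i x i_n; rewrite q1 mulr1.
set y := mulv d A x i => yv.
case: (eqVneq y 0) => [->|y0]; first by rewrite expr0n/= mulr0 powR_ge0.
have ny : 0 < `|y| by rewrite normr_gt0.
rewrite -(real_normK (num_real y)) in yv *.
rewrite powR_expR// /rowwt -[`|y| ^+ 2](@lnK _) ?posrE ?exprn_gt0//.
rewrite -expRM_natl -expRD ler_expR lnXn// -mulr_natl.
have : ln (`|y| ^+ 2) <= ln (v i) by rewrite ler_ln ?posrE ?exprn_gt0// v0.
rewrite lnXn// -mulr_natl; move=> h; rewrite -mulr_natl in h.
have q0 : 0 <= 1 - p / 2 by move: (p2) => h2; lra.
by have := mulr_ge0 q0 (_ : 0 <= ln (v i) - 2 * ln `|y|); rewrite subr_ge0 => /(_ h); lra.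
Qed.

(** Hoelder's inequality done term by term: with [u] the [i]-th term of [qform] and
    [z = lewis / S^2], one has [|y|^p = S^(2-p) u^(p/2) z^(1-p/2) <= S max (u, z)]. Summing
    [S (u + z)] gives at most [S (3 + 1)]. *)
Lemma lp_cost_le_ball (S : R) x : 1 <= S -> lewis_sum p n v <= S ^+ 2 ->
  q x <= 3 -> cost x <= 4 * S.
Proof.
move=> S1 hS qx; have S0 : 0 < S by exact: lt_le_trans S1.
apply: (@le_trans _ _ (\sum_(i < n) S *
    (rowwt p v i ^+ 2 * mulv d A x i ^+ 2 + lewis p v i / S ^+ 2))).
  rewrite /lp_cost; apply: ler_sum => i _.
  have w0 : 0 < lewis p v i / S ^+ 2 by rewrite divr_gt0 ?expR_gt0// exprn_gt0.
  set y := mulv d A x i; set z := lewis p v i / S ^+ 2 in w0 *.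
  case: (eqVneq y 0) => [->|y0].
    rewrite normr0 powR0; last by rewrite gt_eqF//; move: (p1) => h; lra.
    by rewrite expr0n/= mulr0 add0r mulr_ge0 ?(ltW S0) ?(ltW w0).
  have ny : 0 < `|y| by rewrite normr_gt0.
  set u := rowwt p v i ^+ 2 * y ^+ 2.
  have wt2 : 0 < rowwt p v i ^+ 2 by rewrite exprn_gt0// expR_gt0.
  have y2 : 0 < y ^+ 2 by rewrite exprn_even_gt0.
  have u0 : 0 < u by exact: mulr_gt0.
  have lnu : ln u = - (1 - p / 2) * ln (v i) + 2 * ln `|y|.
    rewrite lnM ?posrE// -(real_normK (num_real y)) !lnXn ?expR_gt0//.
    by rewrite expRK; field.
  have lnz : ln z = p / 2 * ln (v i) - 2 * ln S.
    rewrite ln_div ?posrE ?expR_gt0 ?exprn_gt0// expRK lnXn//; by ring.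
  have lnS : 0 <= ln S by rewrite ln_ge0.
  have [uz|uz] := leP u z.
    apply: (@le_trans _ _ (S * z)); last by rewrite ler_pM2l// lerDr ltW.
    have lnuz : ln u <= ln z by rewrite ler_ln ?posrE.
    rewrite powR_expR// -[S in leRHS](@lnK _) ?posrE// -[z](@lnK _) ?posrE//.
    rewrite -expRD ler_expR lnz; rewrite lnu lnz in lnuz.
    move: (p1) (ln `|y|) (ln (v i)) (ln S) lnuz lnS => h1 a b s lnuz lnS.
    have q0 : 0 <= p - 1 by lra.
    have q1 : 0 <= b / 2 - s - a by lra.
    by have := mulr_ge0 q0 lnS; have := mulr_ge0 q0 q1; lra.
  apply: (@le_trans _ _ (S * u)); last by rewrite ler_pM2l// lerDl ltW.
  have lnuz : ln z <= ln u by rewrite ler_ln ?posrE// ltW.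
  rewrite powR_expR// -[S in leRHS](@lnK _) ?posrE// -[u](@lnK _) ?posrE//.
  rewrite -expRD ler_expR lnu; rewrite lnu lnz in lnuz.
  move: (p1) (p2) (ln `|y|) (ln (v i)) (ln S) lnuz lnS => h1 h2 a b s lnuz lnS.
  have q0 : 0 <= p - 1 by lra.
  have q2 : 0 <= 1 - p / 2 by lra.
  have q1 : 0 <= 2 * a + 2 * s - b by lra.
  by have := mulr_ge0 q0 lnS; have := mulr_ge0 q2 q1; lra.
rewrite -mulr_sumr big_split/= -qformE -mulr_suml -/(lewis_sum p n v).
rewrite mulrC ler_pM2r//.
have : lewis_sum p n v / S ^+ 2 <= 1 by rewrite ler_pdivrMr ?mul1r// exprn_gt0.
by move: qx; lra.
Qed.

Lemma normalize x : 0 < q x -> exists2 c : R, 0 < c & q (fun a => c * x a) = 1.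
Proof.
move=> qx; exists (Num.sqrt (q x))^-1; first by rewrite invr_gt0 sqrtr_gt0.
by rewrite qformZ exprVn sqr_sqrtr ?ltW// mulVf// gt_eqF.
Qed.

(** Rescale so that [q y = 1]. The factor 3 is the ratio of 3/2 to 1/2, the distortion bounds of a
    good sketch. *)
Lemma lp_cost_le (S : R) x y : 1 <= S -> lewis_sum p n v <= S ^+ 2 ->
  q x <= 3 * q y -> cost x <= 4 * S * cost y.
Proof.
move=> S1 hS qxy; have S0 : 0 < S by exact: lt_le_trans S1.
have := qform_ge0 p n d A v y; rewrite le_eqVlt => /predU1P[qy0|qy0].
  rewrite -qy0 mulr0 in qxy; rewrite lp_cost_eq0 ?mulr_ge0 ?lp_cost_ge0 ?ltW//.
  by apply/eqP; rewrite eq_le qxy qform_ge0.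
have [c c0 qc] := normalize qy0.
have cp : 0 < c `^ p by exact: powR_gt0.
rewrite -(ler_pM2l cp) mulrCA -!lp_costZ//.
apply: (@le_trans _ _ (4 * S * 1)); last first.
  by rewrite ler_pM2l ?mulr_gt0// lp_cost_ge1.
rewrite mulr1; apply: lp_cost_le_ball => //.
rewrite qformZ in qc; rewrite qformZ.
apply: (@le_trans _ _ (c ^+ 2 * (3 * q y))).
  by rewrite ler_wpM2l// sqr_ge0.
by rewrite mulrCA qc mulr1.
Qed.

Variables (L : nat) (J : nat -> nat) (c : nat -> bool) (eta : R).
Local Notation scost := (sampled_cost p n d A L J c).
Hypothesis dev : forall x, q x <= 1 -> `|scost x - cost x| <= eta.

Lemma sampled_costZ a x : 0 < a -> scost (fun k => a * x k) = a `^ p * scost x.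
Proof.
move=> a0; rewrite /sampled_cost mulr_sumr; apply: eq_bigr => i _.
by rewrite mulvZ normrM powRM// gtr0_norm//; ring.
Qed.

(** Both costs are homogeneous and the true cost is at least 1 on the unit sphere, so the additive
    error on the ball becomes a relative error everywhere. *)
Lemma sampled_cost_dev x : `|scost x - cost x| <= eta * cost x.
Proof.
have := qform_ge0 p n d A v x; rewrite le_eqVlt => /predU1P[qx0|qx0].
  have c0 := lp_cost_eq0 (esym qx0); rewrite c0 mulr0.
  have -> : scost x = 0.
    rewrite /sampled_cost big1// => i _; rewrite qform_eq0// normr0 powR0 ?mulr0//.
    by rewrite gt_eqF//; move: (p1) => h; lra.
  by rewrite subrr normr0.
have [a a0 qa] := normalize qx0.
have ap : 0 < a `^ p by exact: powR_gt0.
have eta0 : 0 <= eta.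
  by apply: le_trans (@dev (fun k => a * x k) _); rewrite ?normr_ge0 ?qa.
rewrite -(ler_pM2l ap) -{1}(gtr0_norm ap) -normrM mulrBr mulrCA.
rewrite -sampled_costZ// -lp_costZ//.
apply: (@le_trans _ _ (eta * 1)); first by rewrite mulr1 dev ?qa.
by rewrite ler_wpM2l// lp_cost_ge1.
Qed.

End CostComparison.

(** * The program *)

Section ProgramLogic.
Variable R : realType.
Variables (phi : nat -> nat -> nat) (solve : lp_solver R) (u : nat -> R).

Local Notation state := (state R).
Local Notation exec := (@exec R phi solve u).

Lemma neval_tick k (s : state) e : neval (tick k s) e = neval s e.
Proof. by elim: e => //= [a e ->|e1 -> e2 ->|e1 -> e2 ->|e1 -> e2 ->]. Qed.

Lemma reval_tick k (s : state) e : reval (tick k s) e = reval s e.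
Proof.
by elim: e => //= [i|a i|e1 -> e2 ->|e1 -> e2 ->|e1 -> e2 ->|e1 -> e2 ->
  |e ->|e ->]; rewrite ?neval_tick.
Qed.

Lemma geval_tick k (s : state) g : geval (tick k s) g = geval s g.
Proof. by case: g => e1 e2 /=; rewrite ?neval_tick ?reval_tick. Qed.

Lemma tickC j k (s : state) : tick j (tick k s) = tick k (tick j s).
Proof. by rewrite /tick /= addnAC. Qed.

Lemma exec_tick c s s' k : exec c s s' -> exec c (tick k s) (tick k s').
Proof.
move=> h; elim: h k => {c s s'}.
- by move=> s k; constructor.
- move=> a i e s k; rewrite {2}/tick /= addnAC -(neval_tick k s i) -(neval_tick k s e).
  exact: exec_NStore.
- move=> a i e s k; rewrite {2}/tick /= addnAC -(neval_tick k s i) -(reval_tick k s e).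
  exact: exec_RStore.
- move=> a i s k; rewrite {2}/tick /= addnAC -(neval_tick k s i).
  exact: exec_Draw.
- move=> em ek aN ac ax s m k0 k; rewrite {2}/tick /= addnAC /m /k0.
  rewrite -(neval_tick k s em) -(neval_tick k s ek); exact: exec_Regress.
- by move=> c1 c2 s s1 s2 _ IH1 _ IH2 k; apply: exec_Seq (IH1 k) (IH2 k).
- move=> g c1 c2 s s1 _ IH k; constructor.
  by rewrite geval_tick tickC; exact: IH.
- move=> g c s gs k; rewrite tickC; apply: exec_While_false.
  by rewrite geval_tick.
- move=> g c s s1 s2 gs _ IH1 _ IH2 k.
  apply: (@exec_While_true _ _ _ _ _ _ _ (tick k s1)); rewrite ?geval_tick//.
  by rewrite tickC; exact: IH1.
Qed.

(* Resets the clock, so that the [t] of a triple bounds the time of the command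
   alone. *)
Definition core (s : state) : state := State (nmem s) (rmem s) (draws s) 0.

Lemma neval_core (s : state) e : neval (core s) e = neval s e.
Proof. by elim: e => //= [a e ->|e1 -> e2 ->|e1 -> e2 ->|e1 -> e2 ->]. Qed.

Lemma reval_core (s : state) e : reval (core s) e = reval s e.
Proof.
by elim: e => //= [i|a i|e1 -> e2 ->|e1 -> e2 ->|e1 -> e2 ->|e1 -> e2 ->
  |e ->|e ->]; rewrite ?neval_core.
Qed.

(** A total-correctness triple for one initial state instead of a precondition: what is known about
    [s] stays in the context of the proof. *)
Definition tri (c : cmd) (s : state) (t : nat) (Q : state -> Prop) : Prop :=
  exists s', [/\ exec c (core s) s', (time s' <= t)%N & Q (core s')].

Lemma tick_core s : tick (time s) (core s) = s.
Proof. by case: s => nm rm dr tm; rewrite /tick /= add0n. Qed.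

Lemma tri_weaken c s t t' (Q Q' : state -> Prop) : tri c s t Q ->
  (t <= t')%N -> (forall s', Q s' -> Q' s') -> tri c s t' Q'.
Proof.
move=> [s' [e h q]] tt' QQ'; exists s'; split => //; first exact: leq_trans tt'.
exact: QQ'.
Qed.

Lemma tri_seq c1 c2 s t1 t2 (Q1 Q : state -> Prop) : tri c1 s t1 Q1 ->
  (forall s', Q1 s' -> tri c2 s' t2 Q) -> tri (Seq c1 c2) s (t1 + t2) Q.
Proof.
move=> [s1 [e1 h1 q1]] h; have [s2 [e2 h2 q2]] := h _ q1.
exists (tick (time s1) s2); split => //=.
  by apply: exec_Seq e1 _; rewrite -{1}(tick_core s1); exact: exec_tick.
by rewrite addnC leq_add.
Qed.

Lemma tri_skip s t (Q : state -> Prop) : Q (core s) -> tri Skip s t Q.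
Proof. by move=> q; exists (core s); split => //; exact: exec_Skip. Qed.

Lemma tri_nstore a i e s t (Q : state -> Prop) :
  ((ncost i + ncost e).+1 <= t)%N ->
  Q (State (upd (nmem s) a (neval (core s) i) (neval (core s) e)) (rmem s) (draws s) 0) ->
  tri (NStore a i e) s t Q.
Proof.
by move=> h q; eexists; split; [exact: exec_NStore|rewrite /= add0n|].
Qed.

Lemma tri_rstore a i e s t (Q : state -> Prop) :
  ((ncost i + rcost e).+1 <= t)%N ->
  Q (State (nmem s) (upd (rmem s) a (neval (core s) i) (reval (core s) e)) (draws s) 0) ->
  tri (RStore a i e) s t Q.
Proof.
by move=> h q; eexists; split; [exact: exec_RStore|rewrite /= add0n|].
Qed.

Lemma tri_draw a i s t (Q : state -> Prop) :
  ((ncost i).+1 <= t)%N ->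
  Q (State (nmem s) (upd (rmem s) a (neval (core s) i) (u (draws s))) (draws s).+1 0) ->
  tri (Draw a i) s t Q.
Proof.
by move=> h q; eexists; split; [exact: exec_Draw|rewrite /= add0n|].
Qed.

Lemma tri_if g c1 c2 s t (Q : state -> Prop) :
  (geval (core s) g -> tri c1 s t Q) -> (~~ geval (core s) g -> tri c2 s t Q) ->
  tri (If g c1 c2) s (t + (gcost g).+1) Q.
Proof.
move=> h1 h2.
have : tri (if geval (core s) g then c1 else c2) s t Q by case: ifPn.
move=> [s' [e h q]]; exists (tick (gcost g).+1 s'); split => //=.
  by constructor; exact: exec_tick.
by rewrite leq_add2r.
Qed.

Definition setn (s : state) (i k : nat) : state :=
  State (upd (nmem s) i 0 k) (rmem s) (draws s) 0.

Definition NV (x : nat) : nexp := NLoad x (NConst 0).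

Definition For (i : nat) (N : nexp) (body : cmd) : cmd :=
  Seq (NStore i (NConst 0) (NConst 0))
      (While (NLt (NV i) N)
             (Seq body (NStore i (NConst 0) (NAdd (NV i) (NConst 1))))).

(** [n.+1] counts the failing test as well; 20 covers the rest of the test, the increment and the
    initialization of the counter. *)
Definition fortime (n cN tb : nat) : nat := (n.+1 * (tb + cN + 20))%N.

Lemma leq_fortime n n' cN tb tb' : (n <= n')%N -> (tb <= tb')%N ->
  (fortime n cN tb <= fortime n' cN tb')%N.
Proof. by move=> nn tt; rewrite leq_mul ?ltnS// !leq_add2r. Qed.

Lemma tri_for i N body s n tb (I : nat -> state -> Prop) :
  (forall k s', (k <= n)%N -> I k s' -> nmem s' i 0 = k /\ neval s' N = n) ->
  I 0 (setn s i 0) ->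
  (forall k s', (k < n)%N -> I k s' -> tri body s' tb
     (fun s'' => nmem s'' i 0 = k /\ I k.+1 (setn s'' i k.+1))) ->
  tri (For i N body) s (fortime n (ncost N) tb) (I n).
Proof.
move=> hI I0 step.
have loop r : forall k s', (k + r = n)%N -> s' = core s' -> I k s' ->
    tri (While (NLt (NV i) N)
           (Seq body (NStore i (NConst 0) (NAdd (NV i) (NConst 1))))) s'
        (r.+1 * (tb + ncost N + 20) - 10) (I n).
  elim: r => [|r IH] k s' kr s'c Iks.
    rewrite addn0 in kr; rewrite {k}kr in Iks.
    have [e1 e2] := hI _ _ (leqnn n) Iks.
    exists (tick (gcost (NLt (NV i) N)).+1 s'); split.
    - rewrite -s'c; apply: exec_While_false.
      by rewrite /= e1 e2 ltnn.
    - by rewrite s'c /=; lia.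
    - by rewrite s'c in Iks.
  have kn : (k < n)%N by lia.
  have [e1 e2] := hI _ _ (ltnW kn) Iks.
  have [s1 [x1 t1 [y1 I1]]] := step _ _ kn Iks.
  pose s2 := State (upd (nmem s1) i 0 (nmem s1 i 0 + 1)%N) (rmem s1) (draws s1)
               (time s1 + (1 + 4).+1).
  have s2E : core s2 = setn (core s1) i k.+1.
    by rewrite /core /setn /s2 /= -[nmem s1 i 0]/(nmem (core s1) i 0) y1 addn1.
  have [|||s3 [x3 t3 I3]] := IH k.+1 (core s2); first by lia.
  - by [].
  - by rewrite s2E.
  set g := (gcost (NLt (NV i) N)).+1.
  exists (tick (g + time s2) s3); split.
  - apply: (@exec_While_true _ _ _ _ _ _ _ (tick g s2)).
    + by rewrite -s'c /= e1 e2.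
    + apply: (@exec_tick _ _ _ g).
      apply: exec_Seq x1 _; rewrite /s2.
      exact: exec_NStore.
    + have -> : tick g s2 = tick (g + time s2) (core (core s2)).
        by rewrite /tick /core /=; congr State; lia.
      exact: exec_tick.
  - by rewrite /g /s2 /=; lia.
  - by [].
have := loop n 0 (setn s i 0) (add0n n) (erefl _) I0.
move=> h; apply: (@tri_weaken _ _ (3 + (n.+1 * (tb + ncost N + 20) - 10)) _ (I n)).
- apply: (@tri_seq _ _ _ _ _ (fun s' => s' = setn s i 0)).
    by apply: tri_nstore.
  by move=> s' ->.
- by rewrite /fortime; lia.
- by [].
Qed.

Fixpoint nreads (e : nexp) : seq nat :=
  match e with
  | NConst _ => [::]
  | NLoad a i => a :: nreads i
  | NAdd e1 e2 | NSub e1 e2 | NMul e1 e2 => nreads e1 ++ nreads e2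
  end.

Fixpoint rnreads (e : rexp) : seq nat :=
  match e with
  | RNat i | RLoad _ i => nreads i
  | RAdd e1 e2 | RSub e1 e2 | RMul e1 e2 | RDiv e1 e2 => rnreads e1 ++ rnreads e2
  | RExp e1 | RLn e1 => rnreads e1
  end.

Fixpoint rreads (e : rexp) : seq nat :=
  match e with
  | RNat _ => [::]
  | RLoad a _ => [:: a]
  | RAdd e1 e2 | RSub e1 e2 | RMul e1 e2 | RDiv e1 e2 => rreads e1 ++ rreads e2
  | RExp e1 | RLn e1 => rreads e1
  end.

Definition frame (NA RA : seq nat) (s s' : state) : Prop :=
  (forall a, a \notin NA -> nmem s' a = nmem s a) /\
  (forall a, a \notin RA -> rmem s' a = rmem s a).

Definition avoids (l NA : seq nat) : bool := all (fun x => x \notin NA) l.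

Lemma frame_trans NA RA s s' s'' :
  frame NA RA s s' -> frame NA RA s' s'' -> frame NA RA s s''.
Proof.
by move=> [h1 h2] [h3 h4]; split => a ha; [rewrite h3 ?h1|rewrite h4 ?h2].
Qed.

Lemma frame_sub NA RA NA' RA' s s' : frame NA RA s s' ->
  all (mem NA') NA -> all (mem RA') RA -> frame NA' RA' s s'.
Proof.
move=> [h1 h2] /allP n1 /allP n2; split => a ha; [apply: h1|apply: h2];
  apply: contraNN ha; [exact: n1|exact: n2].
Qed.

Lemma neval_frame NA RA s s' e : frame NA RA s s' -> avoids (nreads e) NA ->
  neval s' e = neval s e.
Proof.
move=> [h _]; elim: e => //= [a i IH /andP[a1 a2]|e1 IH1 e2 IH2|e1 IH1 e2 IH2|e1 IH1 e2 IH2].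
- by rewrite h// IH.
all: by rewrite /avoids all_cat => /andP[a1 a2]; rewrite IH1// IH2.
Qed.

Lemma reval_frame NA RA s s' e : frame NA RA s s' ->
  avoids (rnreads e) NA -> avoids (rreads e) RA -> reval s' e = reval s e.
Proof.
move=> fr; have [_ h] := fr; elim: e => //=.
- by move=> i a1 _; rewrite (neval_frame fr).
- by move=> a i a1; rewrite /avoids/= andbT => a2; rewrite h// (neval_frame fr).
1-4: by move=> e1 IH1 e2 IH2; rewrite /avoids !all_cat => /andP[a1 a2] /andP[b1 b2];
  rewrite IH1// IH2.
all: by move=> e IH a1 a2; rewrite IH.
Qed.

Lemma frame_setnl NA RA s i k : i \in NA -> frame NA RA s (setn s i k).
Proof.
move=> iN; split => a ha //=; apply/funext => j; rewrite /upd.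
by case: eqP => //= e; rewrite e iN in ha.
Qed.

Lemma frame_nupd NA RA nm rm dr t nm' rm' dr' t' a i v : a \in NA ->
  frame NA RA (State nm rm dr t) (State nm' rm' dr' t') ->
  frame NA RA (State nm rm dr t) (State (upd nm' a i v) rm' dr' t').
Proof.
move=> aR [h1 h2]; split => b hb /=; last exact: h2.
apply/funext => j; rewrite /upd; case: eqP => [e|_ /=]; first by rewrite e aR in hb.
exact: (congr1 (fun f => f j) (h1 b hb)).
Qed.

Fixpoint nest (env : seq (nat * nexp)) (body : cmd) : cmd :=
  if env is (i, N) :: r then For i N (nest r body) else body.

Definition Acc (env : seq (nat * nexp)) (a : nat) (idx : nexp) (val : rexp) : cmd :=
  nest env (RStore a idx (RAdd (RLoad a idx) val)).

(** What [Acc] adds to cell [j]. As [val] does not read the array being changed, every summand can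
    be evaluated in the initial state with only the counters set. *)
Fixpoint accsum (env : seq (nat * nexp)) (idx : nexp) (val : rexp) (s : state)
    (j : nat) : R :=
  if env is (i, N) :: r then
    \sum_(k < neval s N) accsum r idx val (setn s i k) j
  else if neval s idx == j then reval s val else 0.

Fixpoint acctime (env : seq (nat * nexp)) (s : state) (t0 : nat) : nat :=
  if env is (i, N) :: r then fortime (neval s N) (ncost N) (acctime r s t0) else t0.

Definition counters (env : seq (nat * nexp)) : seq nat := [seq e.1 | e <- env].

Definition env_ok (env : seq (nat * nexp)) : bool :=
  uniq (counters env) && all (fun e => avoids (nreads e.2) (counters env)) env.

Lemma acctime_frame NA RA env s s' t0 : frame NA RA s s' ->
  all (fun e => avoids (nreads e.2) NA) env -> acctime env s' t0 = acctime env s t0.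
Proof.
elim: env s s' => [|[i N] r IH] s s' fr //= /andP[hN hr].
by rewrite (neval_frame fr)// (IH _ _ fr).
Qed.

(** Finer than [frame]: of a counter array only cell 0 may change. Hence setting a counter in both
    states makes its array agree again, which [frame] does not give. *)
Definition cframe (cs RA : seq nat) (s s' : state) : Prop :=
  (forall a j, ~~ ((a \in cs) && (j == 0%N)) -> nmem s' a j = nmem s a j) /\
  (forall a, a \notin RA -> rmem s' a = rmem s a).

Lemma cframe_frame cs RA s s' : cframe cs RA s s' -> frame cs RA s s'.
Proof.
move=> [h1 h2]; split => // a ha; apply/funext => j; apply: h1.
by rewrite (negbTE ha).
Qed.

Lemma cframe_trans cs RA s s' s'' :
  cframe cs RA s s' -> cframe cs RA s' s'' -> cframe cs RA s s''.
Proof.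
by move=> [h1 h2] [h3 h4]; split => a ha; [move=> hj; rewrite h3 ?h1|rewrite h4 ?h2].
Qed.

Lemma cframe_sub cs RA cs' RA' s s' : cframe cs RA s s' ->
  {subset cs <= cs'} -> {subset RA <= RA'} -> cframe cs' RA' s s'.
Proof.
move=> [h1 h2] n1 n2; split => a; last by move=> ha; apply: h2; apply: contraNN ha => /n2.
move=> j ha; apply: h1; apply: contraNN ha => /andP[/n1 -> ->] //.
Qed.

Lemma cframe_setn cs RA i k s s' : cframe (i :: cs) RA s s' ->
  cframe cs RA (setn s i k) (setn s' i k).
Proof.
move=> [h1 h2]; split => [a j ha|a ha] /=; last exact: h2.
rewrite /upd; case: ifP => // e; apply: h1; rewrite inE.
by move: ha e; case: (a \in cs) (a == i) (j == 0%N) => [] [] [].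
Qed.

Lemma cframe_setnl cs RA i k s : i \in cs -> cframe cs RA s (setn s i k).
Proof.
move=> ic; split => // a j ha /=; rewrite /upd; case: ifP => // /andP[/eqP e j0].
by rewrite e ic j0 in ha.
Qed.

Lemma avoids_sub l NA NA' : {subset NA' <= NA} -> avoids l NA -> avoids l NA'.
Proof. by move=> h; apply: sub_all => x; apply: contraNN; exact: h. Qed.

Lemma env_ok_cons i N r : env_ok ((i, N) :: r) ->
  [/\ env_ok r, i \notin counters r, avoids (nreads N) (i :: counters r) &
      all (fun e => avoids (nreads e.2) (i :: counters r)) r].
Proof.
rewrite /env_ok /= => /andP[/andP[ir ur] /andP[hN hr]]; split => //.
rewrite ur; apply: sub_all hr => e; apply: avoids_sub => x xr.
by rewrite inE xr orbT.
Qed.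

Lemma accsum_cframe RA env idx val s s' j : cframe (counters env) RA s s' ->
  env_ok env -> avoids (rreads val) RA ->
  accsum env idx val s' j = accsum env idx val s j.
Proof.
elim: env s s' => [|[i N] r IH] s s' fr /=.
  move=> _ h; have fr' := cframe_frame fr.
  have av l : avoids l [::] by apply/allP.
  by rewrite (neval_frame fr')// (reval_frame fr').
move=> /env_ok_cons[ok_r _ hN _] h.
rewrite (neval_frame (cframe_frame fr))//.
by apply: eq_bigr => k _; apply: IH => //; exact: cframe_setn.
Qed.

Lemma tri_acc env a idx val s : env_ok env -> a \notin rreads val ->
  tri (Acc env a idx val) s
    (acctime env s (ncost idx + (ncost idx + rcost val).+2).+1)
    (fun s' => [/\ cframe (counters env) [:: a] s s', draws s' = draws s &
       forall j, rmem s' a j = rmem s a j + accsum env idx val s j]).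
Proof.
set t0 := (_.+1)%N.
elim: env s => [|[i N] r IH] s ok av.
  apply: tri_rstore => //=; split => //.
    split => // b /=; rewrite inE => ba; apply/funext => j.
    by rewrite /upd (negbTE ba).
  move=> j; rewrite /upd eqxx /= eq_sym.
  rewrite neval_core reval_core.
  by case: eqP => [<-//|_]; rewrite addr0.
have [ok_r ir hN hr] := env_ok_cons ok.
have av' : avoids (rreads val) [:: a].
  by apply/allP => x xv; rewrite inE; apply: contraNneq av => <-.
apply: (@tri_weaken _ _ (fortime (neval s N) (ncost N) (acctime r s t0)) _
  (fun s' => [/\ cframe (i :: counters r) [:: a] s s',
   nmem s' i 0 = neval s N, draws s' = draws s &
   forall j, rmem s' a j = rmem s a j +
     \sum_(k' < neval s N) accsum r idx val (setn s i k') j])) => //; last first.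
  by move=> s' [].
refine (@tri_for i N (nest r (RStore a idx (RAdd (RLoad a idx) val))) s (neval s N)
  (acctime r s t0) (fun k s' => [/\ cframe (i :: counters r) [:: a] s s',
   nmem s' i 0 = k, draws s' = draws s &
   forall j, rmem s' a j = rmem s a j +
     \sum_(k' < k) accsum r idx val (setn s i k') j]) _ _ _).
- move=> k s' _ [fr <- _ _]; split => //.
  by rewrite (neval_frame (cframe_frame fr)).
- split => //.
  + by apply: cframe_setnl; exact: mem_head.
  + by rewrite /= /upd !eqxx.
  + by move=> j; rewrite big_ord0 addr0.
- move=> k s' kn [fr hk hd hr'].
  rewrite -(@acctime_frame (i :: counters r) [:: a] r s s' t0 (cframe_frame fr))//.
  apply: tri_weaken (IH s' ok_r av) (leqnn _) _ => s'' [fr2 d2 h2].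
  have fr3 : cframe (i :: counters r) [:: a] s s''.
    apply: cframe_trans fr _; apply: cframe_sub fr2 _ _ => // x xr.
    by rewrite inE xr orbT.
  split.
    by rewrite fr2.1 ?(negbTE ir).
  split.
  + by apply: cframe_trans fr3 _; apply: cframe_setnl; exact: mem_head.
  + by rewrite /= /upd !eqxx.
  + by rewrite /= d2.
  + move=> j /=; rewrite h2 hr' big_ord_recr/= addrA; congr (_ + _).
    apply: (@accsum_cframe [:: a]) => //.
    split => [b j' hb|b hb] /=; last by rewrite fr.2.
    rewrite /upd; case: ifP => [/andP[/eqP-> /eqP->]//|e].
    apply: fr.1; rewrite inE; move: hb e.
    by case: (b \in _) (b == i) (j' == 0%N) => [] [] [].
Qed.

End ProgramLogic.

(** * Filling arrays and drawing coins *)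

Section Macros.
Variable R : realType.
Variables (phi : nat -> nat -> nat) (solve : lp_solver R) (u : nat -> R).
Local Notation state := (state R).
Local Notation tri := (tri phi solve u).

Definition Fill (i : nat) (N : nexp) (a : nat) (val : rexp) : cmd :=
  For i N (RStore a (NV i) val).

Lemma frame_setn_counter RA (s s' : state) i k : frame [:: i] RA s s' ->
  (forall j, (0 < j)%N -> nmem s' i j = nmem s i j) -> nmem s' i 0 = k ->
  frame [::] RA (setn s i k) s'.
Proof.
move=> [h1 h2] hj hk; split => [b _|b hb] /=; last exact: h2.
apply/funext => -[|j]; rewrite /upd /=.
  by case: eqP => [->//|/eqP bi]; rewrite h1// inE.
by case: eqP => [->/=|/eqP bi]; [rewrite hj|rewrite h1// inE].
Qed.

Lemma avoids_nil l : avoids l [::]. Proof. exact/allP. Qed.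

Lemma tri_fill i N a val s : avoids (nreads N) [:: i] -> a \notin rreads val ->
  tri (Fill i N a val) s (fortime (neval s N) (ncost N) (3 + rcost val))
    (fun s' => [/\ frame [:: i] [:: a] s s', draws s' = draws s &
       forall j, rmem s' a j =
         if (j < neval s N)%N then reval (setn s i j) val else rmem s a j]).
Proof.
move=> hN hv.
have av' : avoids (rreads val) [:: a].
  by apply/allP => x xv; rewrite inE; apply: contraNneq hv => <-.
pose n := neval s N.
apply: (@tri_weaken _ _ _ _ _ _ (fortime n (ncost N) (3 + rcost val)) _
  (fun s' => [/\ frame [:: i] [:: a] s s', nmem s' i 0 = n,
     (forall j, (0 < j)%N -> nmem s' i j = nmem s i j), draws s' = draws s &
     forall j, rmem s' a j =
       if (j < n)%N then reval (setn s i j) val else rmem s a j])) => //; last first.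
  by move=> s' [].
refine (@tri_for _ _ _ _ i N (RStore a (NV i) val) s n (3 + rcost val)
  (fun k s' => [/\ frame [:: i] [:: a] s s', nmem s' i 0 = k,
     (forall j, (0 < j)%N -> nmem s' i j = nmem s i j), draws s' = draws s &
     forall j, rmem s' a j =
       if (j < k)%N then reval (setn s i j) val else rmem s a j]) _ _ _).
- by move=> k s' _ [fr <- _ _ _]; split => //; rewrite (neval_frame fr).
- split => //.
  + by apply: frame_setnl; exact: mem_head.
  + by rewrite /= /upd !eqxx.
  + by move=> j j0 /=; rewrite /upd eqxx gtn_eqF.
move=> k s' kn [fr hk hj hd hr].
apply: tri_rstore => //=; rewrite reval_core hk.
split => //; split => //=.
- split => b hb /=; last first.
    rewrite inE in hb; rewrite -(fr.2 b); last by rewrite inE.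
    by apply/funext => j; rewrite /upd (negbTE hb).
  rewrite -(fr.1 b hb); apply/funext => j; rewrite /upd.
  by rewrite inE in hb; rewrite (negbTE hb).
- by rewrite /upd !eqxx.
- by move=> j j0; rewrite /upd eqxx gtn_eqF//= hj.
move=> j; rewrite /upd eqxx /= ltnS leq_eqVlt.
case: eqP => [->|_] /=; last exact: hr.
exact: (reval_frame (frame_setn_counter fr hj hk)) (avoids_nil _) av'.
Qed.

Definition coins (k : nat) : bool := u k < 2^-1.

(** The bit is produced by branching, because a guard is the only passage from reals to naturals;
    1/2 is computed, because programs contain no real constants. *)
Definition DrawBits (N : nexp) : cmd :=
  For 21 N (Seq (Draw 13 (NConst 0))
    (If (RLt (RLoad 13 (NConst 0)) (RDiv (RNat (NConst 1)) (RNat (NConst 2))))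
        (NStore 32 (NV 21) (NConst 1)) (NStore 32 (NV 21) (NConst 0)))).

Lemma tri_drawbits N s : avoids (nreads N) [:: 21; 32]%N ->
  tri (DrawBits N) s (fortime (neval s N) (ncost N) 20)
    (fun s' => [/\ frame [:: 21; 32]%N [:: 13]%N s s',
       draws s' = (draws s + neval s N)%N &
       forall k, (k < neval s N)%N -> nmem s' 32 k = sshift (draws s) coins k]).
Proof.
move=> hN; pose n := neval s N.
apply: (@tri_weaken _ _ _ _ _ _ (fortime n (ncost N) 20) _
  (fun s' => [/\ frame [:: 21; 32]%N [:: 13]%N s s', nmem s' 21 0 = n,
     draws s' = (draws s + n)%N &
     forall k, (k < n)%N -> nmem s' 32 k = sshift (draws s) coins k])) => //; last first.
  by move=> s' [].
refine (@tri_for _ _ _ _ 21 N _ s n 20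
  (fun k s' => [/\ frame [:: 21; 32]%N [:: 13]%N s s', nmem s' 21 0 = k,
     draws s' = (draws s + k)%N &
     forall j, (j < k)%N -> nmem s' 32 j = sshift (draws s) coins j]) _ _ _).
- by move=> k s' _ [fr <- _ _]; split => //; rewrite (neval_frame fr).
- by split => //=; [exact: frame_setnl|rewrite addn0].
move=> k s' kn [fr hk hd hr].
apply: (@tri_weaken _ _ _ _ _ _ (2 + (5 + 9)) _ _ _ _ _ (fun _ h => h)) => //.
apply: (@tri_seq _ _ _ _ _ _ _ _ _ (fun s1 => s1 = State (nmem s')
  (upd (rmem s') 13 0 (u (draws s'))) (draws s').+1 0)).
  by apply: tri_draw.
move=> s1 ->; have b2n (b : bool) (s2 : state) : b = coins (draws s') ->
    s2 = State (upd (nmem s') 32 k b) (upd (rmem s') 13 0 (u (draws s'))) (draws s').+1 0 ->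
    nmem s2 21 0 = k /\ [/\ frame [:: 21; 32]%N [:: 13]%N s (setn s2 21 k.+1),
     nmem (setn s2 21 k.+1) 21 0 = k.+1, draws (setn s2 21 k.+1) = (draws s + k.+1)%N &
     forall j, (j < k.+1)%N -> nmem (setn s2 21 k.+1) 32 j = sshift (draws s) coins j].
  move=> bE ->; split => //=; split => //=.
  - split => a ha /=.
      rewrite -(fr.1 a ha); apply/funext => j; rewrite /upd.
      by move: ha; rewrite !inE negb_or => /andP[/negbTE -> /negbTE ->].
    rewrite -(fr.2 a ha); apply/funext => j; rewrite /upd.
    by rewrite inE in ha; rewrite (negbTE ha).
  - by rewrite hd addnS.
  move=> j; rewrite ltnS /upd /= leq_eqVlt; case: eqP => [->|_] /=; last exact: hr.
  by rewrite bE hd.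
apply: tri_if => /= h; (apply: tri_nstore; first by []); cbv beta.
  apply: (b2n true); last by rewrite /= hk.
  by rewrite /coins; move: h; rewrite /upd/= div1r => ->.
apply: (b2n false); last by rewrite /= hk.
by rewrite /coins; move: h; rewrite /upd/= div1r => /negbTE ->.
Qed.

End Macros.

Ltac frame_upd fr :=
  let a := fresh "a" in let ha := fresh "ha" in let j := fresh "j" in
  split => a ha /=;
  [rewrite -(fr.1 a ha)|rewrite -(fr.2 a ha)]; try reflexivity;
  apply/funext => j; rewrite /upd; move: ha; rewrite !inE ?negb_or;
  repeat (let h := fresh "h" in case/andP => h; rewrite ?(negbTE h) /=; clear h);
  let h := fresh "h" in move=> h; rewrite ?(negbTE h) /=; reflexivity.

(* Natural arrays: 11 number n of nonzero rows, 12 and 14 the logarithms loglen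
   and sketchlog (13 and 15 their powers of 2), 16 numproj, 20-23 loop counters,
   30 compact row number plus 1 of an input row, 31 compact row of an input
   entry, 32 coins, 33 buckets, 36 position of a kept row, 37 sample size.
   Real arrays: 2 output, 3 the vector v, 4 signed row factors, 5 sketch, 6 Gram
   matrix, 7 Gram-Schmidt basis, 8-11 intermediate vectors, 12 energies,
   15 sampling rate, 17 row weights, 18 and 19 sampled problem. *)
Definition eD := NLoad 0 (NConst 1).
Definition eZ := NLoad 0 (NConst 2).
Definition eN := NV 11.
Definition eLG := NV 12.
Definition eLM := NV 14.
Definition eMM := NV 15.
Definition eK := NV 16.
Definition eP := RLoad 0 (NConst 0).
Definition eEPS := RLoad 0 (NConst 1).
Definition rn (k : nat) : rexp := RNat (NConst k).
Definition idx2 (i j : nexp) : nexp := NAdd (NMul i eD) j.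
Definition sgn_of (i : nexp) : rexp := RSub (RNat (NMul (NConst 2) (NLoad 32 i))) (rn 1).

(** * Hashing, sketching and the Gram matrix *)

Definition HashRows : cmd :=
  For 21 eN (Seq (NStore 34 (NConst 0) (NConst 0))
    (Seq (For 22 eLM (NStore 34 (NConst 0) (NAdd (NMul (NConst 2) (NV 34))
            (NLoad 32 (NAdd (NMul (NV 21) (NAdd eLM (NConst 1))) (NV 22))))))
         (NStore 33 (NV 21) (NV 34)))).

Definition RowCoef : cmd := Fill 21 eN 4
  (RMul (RExp (RMul (RSub (rn 0) (RDiv (RSub (rn 1) (RDiv eP (rn 2))) (rn 2)))
                    (RLn (RLoad 3 (NV 21)))))
        (sgn_of (NAdd (NMul (NV 21) (NAdd eLM (NConst 1))) eLM))).

Definition SketchRows : cmd :=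
  Seq (Fill 21 (NMul eMM eD) 5 (rn 0))
      (Acc [:: (21, eZ)]%N 5 (idx2 (NLoad 33 (NLoad 31 (NV 21))) (NLoad 2 (NV 21)))
           (RMul (RLoad 4 (NLoad 31 (NV 21))) (RLoad 1 (NV 21)))).

Definition GramRows : cmd :=
  Seq (Fill 21 (NMul eD eD) 6 (rn 0))
      (Acc [:: (21, eMM); (22, eD); (23, eD)]%N 6 (idx2 (NV 22) (NV 23))
           (RMul (RLoad 5 (idx2 (NV 21) (NV 22))) (RLoad 5 (idx2 (NV 21) (NV 23))))).

Section Phases.
Variable R : realType.
Variables (phi : nat -> nat -> nat) (solve : lp_solver R) (u : nat -> R).
Local Notation state := (state R).
Local Notation tri := (tri phi solve u).
Variables (d z n lg lm K : nat) (crow ccol : nat -> nat) (vals : nat -> R) (p eps : R).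

(** The memory that the preprocessing prepares and that all later phases only read. *)
Record ctx (s : state) : Prop := Ctx {
  ctx_d : nmem s 0 1 = d;
  ctx_z : nmem s 0 2 = z;
  ctx_n : nmem s 11 0 = n;
  ctx_lg : nmem s 12 0 = lg;
  ctx_lm : nmem s 14 0 = lm;
  ctx_m : nmem s 15 0 = (2 ^ lm)%N;
  ctx_K : nmem s 16 0 = K;
  ctx_row : forall e, (e < z)%N -> nmem s 31 e = crow e;
  ctx_col : forall e, (e < z)%N -> nmem s 2 e = ccol e;
  ctx_val : forall e, (e < z)%N -> rmem s 1 e = vals e;
  ctx_p : rmem s 0 0 = p;
  ctx_eps : rmem s 0 1 = eps }.

Lemma ctx_frame NA RA s s' : frame NA RA s s' -> ctx s ->
  avoids [:: 0; 2; 11; 12; 14; 15; 16; 31]%N NA -> avoids [:: 0; 1]%N RA -> ctx s'.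
Proof.
move=> [h1 h2] c /allP a1 /allP a2.
have e1 a : a \in [:: 0; 2; 11; 12; 14; 15; 16; 31]%N -> nmem s' a = nmem s a.
  by move=> /a1; exact: h1.
have e2 a : a \in [:: 0; 1]%N -> rmem s' a = rmem s a by move=> /a2; exact: h2.
case: c => *; split; rewrite ?e1 ?e2//.
Qed.

Hypothesis crow_lt : forall e, (e < z)%N -> (crow e < n)%N.
Hypothesis ccol_lt : forall e, (e < z)%N -> (ccol e < d)%N.

Definition ent (i a : nat) : R :=
  \sum_(e < z) (if (crow e == i) && (ccol e == a) then vals e else 0).

Lemma sum_pick k a0 (F : nat -> R) :
  \sum_(a < k) (if (a : nat) == a0 then F a else 0) = if (a0 < k)%N then F a0 else 0.
Proof.
case: ltnP => h.
  rewrite (bigD1 (Ordinal h))//= eqxx big1 ?addr0// => i.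
  by rewrite -val_eqE/= => /negbTE ->.
rewrite big1// => i _; case: eqP => // e.
by have := ltn_ord i; rewrite e ltnNge h.
Qed.

Lemma sum_pick2 k k' a0 b0 (F : nat -> nat -> R) : (a0 < k)%N -> (b0 < k')%N ->
  \sum_(a < k) \sum_(b < k') (if (a * k' + b == a0 * k' + b0)%N then F a b else 0) =
  F a0 b0.
Proof.
move=> ha hb.
rewrite (eq_bigr (fun a : 'I_k => if (a : nat) == a0 then F a b0 else 0)).
  by rewrite (sum_pick k a0 (fun a => F a b0)) ha.
move=> a _; case: eqP => [->|ne].
  transitivity (\sum_(b < k') (if (b : nat) == b0 then F a0 b else 0)).
    by apply: eq_bigr => b _; rewrite eqn_add2l.
  by rewrite sum_pick hb.
rewrite big1// => b _; case: eqP => // /(radix_inj (ltn_ord b) hb)[e _].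
by rewrite e in ne.
Qed.

Lemma sum_entries (G : nat -> nat -> R) :
  \sum_(e < z) G (crow e) (ccol e) * vals e =
  \sum_(i < n) \sum_(a < d) G i a * ent i a.
Proof.
rewrite /ent.
under [RHS]eq_bigr do under eq_bigr do rewrite mulr_sumr.
under [RHS]eq_bigr do rewrite exchange_big/=.
rewrite exchange_big/=; apply: eq_bigr => e _; have ez := ltn_ord e.
rewrite (bigD1 (Ordinal (crow_lt ez)))//= [X in _ = _ + X]big1 ?addr0.
  rewrite (bigD1 (Ordinal (ccol_lt ez)))//= !eqxx big1 ?addr0// => a.
  by rewrite -val_eqE/= eq_sym => /negbTE ->; rewrite mulr0.
move=> i; rewrite -val_eqE/= eq_sym => /negbTE ie; apply: big1 => a _.
by rewrite ie mulr0.
Qed.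

Lemma tri_hashrows s (c : nat -> bool) : ctx s ->
  (forall k, (k < n * lm.+1 + K * d)%N -> nmem s 32 k = c k :> nat) ->
  tri HashRows s (100 * (n.+1 * lm.+1))
    (fun s' => [/\ frame [:: 21; 22; 33; 34]%N [::] s s', draws s' = draws s &
       forall i, (i < n)%N -> nmem s' 33 i = rowhash lm c i]).
Proof.
move=> cs hc.
pose J i (s' : state) := [/\ frame [:: 21; 22; 33; 34]%N [::] s s',
  nmem s' 21 0 = i, draws s' = draws s &
  forall i', (i' < i)%N -> nmem s' 33 i' = rowhash lm c i'].
pose ti := (3 + (fortime lm 2 30 + 5))%N.
apply: (@tri_weaken _ _ _ _ _ _ (fortime n (ncost eN) ti) _ (J n)); last 2 first.
- rewrite /fortime /ti /= mulnCA; apply: leq_mul => //.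
  by rewrite /fortime; lia.
- by move=> s' [].
apply: tri_for.
- move=> k s' _ [fr <- _ _]; split => //; rewrite (neval_frame fr)//=.
  exact: ctx_n cs.
- by split => //=; exact: frame_setnl.
move=> i s' i_n [fr hi hd hh].
have cs' : ctx s' by apply: ctx_frame fr cs _ _.
apply: (@tri_seq _ _ _ _ _ _ _ _ _ (fun s1 => s1 = State (upd (nmem s') 34 0 0)
  (rmem s') (draws s') 0)); first by apply: tri_nstore.
move=> s1 s1E.
have fr1 : frame [:: 21; 22; 33; 34]%N [::] s s1 by rewrite s1E; frame_upd fr.
pose I b (s2 : state) := [/\ frame [:: 22; 34]%N [::] s1 s2, nmem s2 22 0 = b,
   draws s2 = draws s & nmem s2 34 0 = bitsv (fun b => c (i * lm.+1 + b)%N) b].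
have hi1 : nmem s1 21 0 = i by rewrite s1E.
apply: (@tri_seq _ _ _ _ _ _ _ _ _ (I lm)).
  apply: (@tri_for _ _ _ _ 22 eLM _ s1 lm 30 I).
  - move=> k s2 _ [fr2 <- _ _]; split => //; rewrite (neval_frame fr2)//=.
    by rewrite (fr1.1 14%N)// (ctx_lm cs).
  - split => //=; [exact: frame_setnl|by rewrite s1E|by rewrite s1E].
  move=> b s2 bl [fr2 hb hd2 h34]; apply: tri_nstore => //=.
  split; first by rewrite /upd /= hb.
  split => //=.
  + by frame_upd fr2.
  + rewrite {2}/upd /= h34 hb.
    have e14 : nmem s2 14 0 = lm by rewrite fr2.1// fr1.1// (ctx_lm cs).
    have e21 : nmem s2 21 0 = i by rewrite fr2.1.
    rewrite /upd /= e14 e21 addn1 fr2.1// fr1.1// hc//.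
    by rewrite ltn_addr//; exact: (radix_ltn i_n (leqW bl)).
move=> s2 [fr2 hb hd2 h34]; apply: tri_nstore => //=.
have e21 : nmem s2 21 0 = i by rewrite fr2.1.
split; first by rewrite /upd /= e21.
have fr3 : frame [:: 21; 22; 33; 34]%N [::] s s2.
  by apply: frame_trans fr1 _; exact: frame_sub fr2 _ _.
split => //=; first by frame_upd fr3.
move=> i'; rewrite ltnS leq_eqVlt /upd /= e21 => /predU1P[->|i'i].
  by rewrite eqxx h34.
by rewrite ltn_eqF// fr2.1// s1E /= /upd /= hh.
Qed.

Lemma tri_rowcoef s v (c : nat -> bool) : ctx s ->
  (forall k, (k < n * lm.+1 + K * d)%N -> nmem s 32 k = c k :> nat) ->
  (forall i, (i < n)%N -> rmem s 3 i = v i) ->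
  tri RowCoef s (100 * n.+1)
    (fun s' => [/\ frame [:: 21]%N [:: 4]%N s s', draws s' = draws s &
       forall i, (i < n)%N -> rmem s' 4 i = rowwt p v i * rowsign R lm c i]).
Proof.
move=> cs hc hv.
apply: tri_weaken (tri_fill _ _ _ _ _ _) _ _ => //.
  by rewrite /fortime /= (ctx_n cs) mulnC leq_mul2r.
move=> s' [fr dr h]; split => // i i_n; rewrite h.
rewrite /= /upd /= (ctx_n cs) i_n (ctx_p cs) hv// (ctx_lm cs) addn1 hc; last first.
  by rewrite ltn_addr//; exact: (radix_ltn i_n (ltnSn lm)).
rewrite /rowwt /rowsign sub0r; congr (_ * _).
by case: (c _); rewrite /sgc /=; ring.
Qed.

Lemma tri_sketchrows s v (c : nat -> bool) : ctx s ->
  (forall i, (i < n)%N -> nmem s 33 i = rowhash lm c i) ->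
  (forall i, (i < n)%N -> rmem s 4 i = rowwt p v i * rowsign R lm c i) ->
  tri SketchRows s (200 * (2 ^ lm * d + z).+1)
    (fun s' => [/\ frame [:: 21]%N [:: 5]%N s s', draws s' = draws s &
       forall r a, (r < 2 ^ lm)%N -> (a < d)%N ->
         rmem s' 5 (r * d + a) = sketch_of p n ent lm v c r a]).
Proof.
move=> cs hh hw.
apply: (@tri_weaken _ _ _ _ _ _ (fortime (2 ^ lm * d) (ncost (NMul eMM eD)) (3 + 2) +
   fortime z (ncost eZ) 100)); last 2 first.
- by rewrite /fortime /=; lia.
- move=> s'; exact.
apply: (@tri_seq _ _ _ _ _ _ _ _ _ (fun s1 => [/\ frame [:: 21]%N [:: 5]%N s s1,
  draws s1 = draws s & forall k, (k < 2 ^ lm * d)%N -> rmem s1 5 k = 0])).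
  apply: tri_weaken (tri_fill _ _ _ _ _ _) _ _ => //.
    by rewrite /= (ctx_m cs) (ctx_d cs).
  move=> s1 [fr dr h]; split => // k km; rewrite h.
  by rewrite /= (ctx_m cs) (ctx_d cs) km.
move=> s1 [fr1 dr1 h1].
have cs1 : ctx s1 by apply: ctx_frame fr1 cs _ _.
apply: tri_weaken (tri_acc _ _ _ _ _ _ _) _ _ => //.
  by rewrite /= (ctx_z cs1) leq_fortime.
move=> s2 [fr2 dr2 h2]; split.
- by apply: frame_trans fr1 _; exact: cframe_frame fr2.
- by rewrite dr2.
move=> r a rm ad; rewrite h2 h1 ?add0r; last exact: radix_ltn.
rewrite /= /upd /= (ctx_z cs1) (ctx_d cs1) /sketch_of /sketch.
(* The effect of a listed entry depends on its row and column only, so [sum_entries] turns the sum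
   over the list into one over the matrix. *)
pose G i a' := (if (rowhash lm c i * d + a' == r * d + a)%N then
    rowwt p v i * rowsign R lm c i else 0).
transitivity (\sum_(e < z) G (crow e) (ccol e) * vals e).
  apply: eq_bigr => e _; have ez := ltn_ord e.
  rewrite (ctx_row cs1)// (ctx_col cs1)// (ctx_val cs1)//.
  rewrite fr1.1// fr1.2// hh ?hw ?crow_lt// /G.
  by case: ifP => _; rewrite ?mul0r.
rewrite sum_entries; apply: eq_bigr => i _.
rewrite (eq_bigr (fun a' : 'I_d => if (a' : nat) == a then
  (rowhash lm c i == r)%:R * (rowsign R lm c i * wtrows p ent v i a') else 0)).
  by rewrite (sum_pick d a (fun a' => (rowhash lm c i == r)%:R *
    (rowsign R lm c i * wtrows p ent v i a'))) ad.
move=> a' _; rewrite /G /wtrows; case: (eqVneq (rowhash lm c i) r) => [->|hr].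
  by rewrite eqn_add2l mul1r; case: eqP => _; rewrite ?mul0r//; ring.
rewrite ifF ?mul0r; first by case: eqP.
by apply/eqP => /(radix_inj (ltn_ord a') ad)[e _]; rewrite e eqxx in hr.
Qed.

Lemma tri_gramrows s (Y : nat -> nat -> R) : ctx s ->
  (forall r a, (r < 2 ^ lm)%N -> (a < d)%N -> rmem s 5 (r * d + a) = Y r a) ->
  tri GramRows s (fortime (2 ^ lm) 2 (fortime d 2 (fortime d 2 100)) + 100 * (d * d).+1)
    (fun s' => [/\ frame [:: 21; 22; 23]%N [:: 6]%N s s', draws s' = draws s &
       forall a b, (a < d)%N -> (b < d)%N ->
         rmem s' 6 (a * d + b) = gram (2 ^ lm) Y a b]).
Proof.
move=> cs hY.
rewrite addnC; apply: (@tri_seq _ _ _ _ _ _ _ _ _ (fun s1 => [/\ frame [:: 21]%N [:: 6]%N s s1,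
  draws s1 = draws s & forall k, (k < d * d)%N -> rmem s1 6 k = 0])).
  apply: tri_weaken (tri_fill _ _ _ _ _ _) _ _ => //.
    by rewrite /= (ctx_d cs) /fortime mulnC leq_mul2r.
  move=> s1 [fr dr h]; split => // k km; rewrite h.
  by rewrite /= (ctx_d cs) km.
move=> s1 [fr1 dr1 h1].
have cs1 : ctx s1 by apply: ctx_frame fr1 cs _ _.
apply: tri_weaken (tri_acc _ _ _ _ _ _ _) _ _ => //.
  by rewrite /= /upd /= (ctx_m cs1) (ctx_d cs1) !leq_fortime.
move=> s2 [fr2 dr2 h2]; split.
- apply: frame_trans (frame_sub fr1 _ _) (cframe_frame fr2) => //.
- by rewrite dr2.
move=> a b ad bd; rewrite h2 h1 ?add0r; last exact: radix_ltn.
rewrite /= /upd /= (ctx_m cs1) (ctx_d cs1); apply: eq_bigr => r _ /=.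
rewrite (sum_pick2 (fun a b => rmem s1 5 (r * d + a) * rmem s1 5 (r * d + b)))//.
by rewrite fr1.2// !hY.
Qed.

End Phases.

(** * Gram-Schmidt on the sketched form *)

Definition eB (i j : nexp) : rexp := RLoad 7 (idx2 i j).
Definition eQ (i j : nexp) : rexp := RLoad 6 (idx2 i j).

(** The residual is built in the output array 2: after the last round the preliminary solution is
    already in place. *)
Definition GsBody : cmd :=
  Seq (Fill 22 eD 8 (rn 0))
  (Seq (Acc [:: (22, eD); (23, eD)]%N 8 (NV 22) (RMul (eB (NV 23) (NV 22)) (eQ (NV 23) (NV 21))))
  (Seq (Fill 22 eD 2 (rn 0))
  (Seq (RStore 2 (NV 21) (rn 1))
  (Seq (Acc [:: (22, eD); (23, eD)]%N 2 (NV 22)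
         (RSub (rn 0) (RMul (eB (NV 22) (NV 23)) (RLoad 8 (NV 23)))))
  (Seq (RStore 9 (NConst 0) (rn 0))
  (Seq (Acc [:: (22, eD)]%N 9 (NConst 0) (RMul (RLoad 2 (NV 22)) (eQ (NV 22) (NV 21))))
       (If (RLt (rn 0) (RLoad 9 (NConst 0)))
           (Acc [:: (22, eD)]%N 7 (idx2 (NV 22) (NV 21))
             (RDiv (RLoad 2 (NV 22)) (RExp (RDiv (RLn (RLoad 9 (NConst 0))) (rn 2)))))
           Skip))))))).

Definition GsRows : cmd := Seq (Fill 21 (NMul eD eD) 7 (rn 0)) (For 21 eD GsBody).

Section GramSchmidtPhase.
Variable R : realType.
Variables (phi : nat -> nat -> nat) (solve : lp_solver R) (u : nat -> R).
Local Notation state := (state R).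
Local Notation tri := (tri phi solve u).
Variables (d z n lg lm K : nat) (crow ccol : nat -> nat) (vals : nat -> R) (p eps : R).
Local Notation ctx := (@ctx R d z n lg lm K crow ccol vals p eps).

Lemma sum_pick_row k k' l (F : nat -> nat -> R) : (l < k)%N ->
  \sum_(a < k) \sum_(b < k') (if (a : nat) == l then F a b else 0) =
  \sum_(b < k') F l b.
Proof.
move=> lk; rewrite (bigD1 (Ordinal lk))//= [X in _ + X]big1 ?addr0.
  by apply: eq_bigr => b _; rewrite eqxx.
move=> a; rewrite -val_eqE/= => /negbTE al; apply: big1 => b _.
by rewrite al.
Qed.

(** Column [j] is still 0 when step [j] starts, so that accumulating into it amounts to writing
    it. *)
Lemma gs_zero (Q : nat -> nat -> R) j a l : (j <= l)%N -> gs d Q j a l = 0.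
Proof. by elim: j => //= j IH jl; rewrite gtn_eqF// IH// ltnW. Qed.

Definition gsbodytime : nat :=
  (fortime d 2 10 + (fortime d 2 (fortime d 2 100) + (fortime d 2 10 + (20 +
   (fortime d 2 (fortime d 2 100) + (20 + (fortime d 2 100 + (fortime d 2 100 + 20))))))))%N.

Lemma tri_gsbody s (Q : nat -> nat -> R) j : ctx s -> (j < d)%N ->
  nmem s 21 0 = j ->
  (forall a b, (a < d)%N -> (b < d)%N -> rmem s 6 (a * d + b) = Q a b) ->
  (forall a l, (a < d)%N -> (l < d)%N -> rmem s 7 (a * d + l) = gs d Q j a l) ->
  tri GsBody s gsbodytime
    (fun s' => [/\ frame [:: 22; 23]%N [:: 2; 7; 8; 9]%N s s', draws s' = draws s,
       (forall a l, (a < d)%N -> (l < d)%N -> rmem s' 7 (a * d + l) = gs d Q j.+1 a l) &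
       (forall a, (a < d)%N -> rmem s' 2 a = gsf d Q (gs d Q j) j a)]).
Proof.
move=> cs jd hj hQ hB; set B := gs d Q j.
apply: (@tri_seq _ _ _ _ _ _ _ _ _ (fun s1 => [/\ frame [:: 22]%N [:: 8]%N s s1,
  draws s1 = draws s & forall k, (k < d)%N -> rmem s1 8 k = 0])).
  apply: tri_weaken (tri_fill _ _ _ _ _ _) _ _ => //.
    by rewrite /= (ctx_d cs) leq_fortime.
  by move=> s1 [fr dr h]; split => // k km; rewrite h /= (ctx_d cs) km.
move=> s1 [fr1 dr1 h1].
have cs1 : ctx s1 by apply: ctx_frame fr1 cs _ _.
apply: (@tri_seq _ _ _ _ _ _ _ _ _ (fun s2 => [/\ frame [:: 22; 23]%N [:: 8]%N s s2,
  draws s2 = draws s & forall l, (l < d)%N -> rmem s2 8 l = gsy d Q B j l])).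
  apply: tri_weaken (tri_acc _ _ _ _ _ _ _) _ _ => //.
    by rewrite /= /upd /= (ctx_d cs1) !leq_fortime.
  move=> s2 [fr2 dr2 h2]; split.
  - by apply: frame_trans (frame_sub fr1 _ _) (cframe_frame fr2).
  - by rewrite dr2.
  move=> l ld; rewrite h2 h1 ?add0r//= /upd /= (ctx_d cs1).
  rewrite (sum_pick_row d (fun l b => rmem s1 7 (b * d + l) *
    rmem s1 6 (b * d + nmem s1 21 0))) //.
  rewrite /gsy; apply: eq_bigr => b _.
  by rewrite !fr1.2// fr1.1// hj hB// hQ.
move=> s2 [fr2 dr2 h2].
have cs2 : ctx s2 by apply: ctx_frame fr2 cs _ _.
apply: (@tri_seq _ _ _ _ _ _ _ _ _ (fun s3 => [/\ frame [:: 22; 23]%N [:: 2; 8]%N s s3,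
  draws s3 = draws s, rmem s3 8 = rmem s2 8 & forall k, (k < d)%N -> rmem s3 2 k = 0])).
  apply: tri_weaken (tri_fill _ _ _ _ _ _) _ _ => //.
    by rewrite /= (ctx_d cs2) leq_fortime.
  move=> s3 [fr dr h]; split => //.
  - apply: frame_trans (frame_sub fr2 _ _) (frame_sub fr _ _) => //.
  - by rewrite dr.
  - by rewrite fr.2.
  - by move=> k kd; rewrite h /= (ctx_d cs2) kd.
move=> s3 [fr3 dr3 r8 h3].
have cs3 : ctx s3 by apply: ctx_frame fr3 cs _ _.
have j3 : nmem s3 21 0 = j by rewrite fr3.1.
apply: (@tri_seq _ _ _ _ _ _ _ _ _ (fun s4 => [/\ frame [:: 22; 23]%N [:: 2; 8]%N s s4,
  draws s4 = draws s, rmem s4 8 = rmem s2 8 &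
  forall k, (k < d)%N -> rmem s4 2 k = basisv R j k])).
  apply: tri_rstore => //=; split => //=.
  - by frame_upd fr3.
  - by move=> k kd; rewrite /upd /= j3 /basisv; case: eqP => //= _; rewrite h3.
move=> s4 [fr4 dr4 r84 h4].
have cs4 : ctx s4 by apply: ctx_frame fr4 cs _ _.
apply: (@tri_seq _ _ _ _ _ _ _ _ _ (fun s5 => [/\ frame [:: 22; 23]%N [:: 2; 8]%N s s5,
  draws s5 = draws s &
  forall a, (a < d)%N -> rmem s5 2 a = gsf d Q B j a])).
  apply: tri_weaken (tri_acc _ _ _ _ _ _ _) _ _ => //.
    by rewrite /= /upd /= (ctx_d cs4) !leq_fortime.
  move=> s5 [fr5 dr5 h5]; split.
  - by apply: frame_trans fr4 _; exact: frame_sub (cframe_frame fr5) _ _.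
  - by rewrite dr5.
  move=> a ad; rewrite h5 h4//= /upd /= (ctx_d cs4) /gsf; congr (_ + _).
  rewrite (sum_pick_row d (fun a l => 0 - rmem s4 7 (a * d + l) * rmem s4 8 l))//.
  rewrite -sumrN; apply: eq_bigr => l _.
  by rewrite sub0r r84 h2// fr4.2// hB.
move=> s5 [fr5 dr5 h5].
have cs5 : ctx s5 by apply: ctx_frame fr5 cs _ _.
apply: (@tri_seq _ _ _ _ _ _ _ _ _ (fun s6 => [/\ frame [:: 22; 23]%N [:: 2; 8; 9]%N s s6,
  draws s6 = draws s, rmem s6 9 0 = 0 & rmem s6 2 = rmem s5 2])).
  apply: tri_rstore => //=; split => //=.
  - have fr5' := frame_sub fr5 (isT : all (mem [:: 22; 23]%N) [:: 22; 23]%N)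
      (isT : all (mem [:: 2; 8; 9]%N) [:: 2; 8]%N).
    by frame_upd fr5'.
move=> s6 [fr6 dr6 z6 r26].
have cs6 : ctx s6 by apply: ctx_frame fr6 cs _ _.
apply: (@tri_seq _ _ _ _ _ _ _ _ _ (fun s7 => [/\ frame [:: 22; 23]%N [:: 2; 8; 9]%N s s7,
  draws s7 = draws s, rmem s7 9 0 = gsnu d Q B j & rmem s7 2 = rmem s5 2])).
  apply: tri_weaken (tri_acc _ _ _ _ _ _ _) _ _ => //.
    by rewrite /= /upd /= (ctx_d cs6) !leq_fortime.
  move=> s7 [fr7 dr7 h7]; split.
  - by apply: frame_trans fr6 _; exact: frame_sub (cframe_frame fr7) _ _.
  - by rewrite dr7.
  - rewrite h7 z6 add0r /= /upd /= (ctx_d cs6) /gsnu; apply: eq_bigr => a _.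
    by rewrite r26 h5// fr6.2// fr6.1// hj hQ.
  - by rewrite fr7.2.
move=> s7 [fr7 dr7 nu7 r27].
have cs7 : ctx s7 by apply: ctx_frame fr7 cs _ _.
have gsE a l : gs d Q j.+1 a l = if l == j then
    if 0 < gsnu d Q B j then gsf d Q B j a / expR (ln (gsnu d Q B j) / 2) else 0
  else B a l by [].
refine (@tri_weaken _ _ _ _ _ _ (fortime d 2 100 + 6) _ _ _ _ _ (fun _ h => h));
  last by rewrite leq_add2l.
apply: tri_if => /= nu; rewrite nu7 in nu.
  apply: tri_weaken (tri_acc _ _ _ _ _ _ _) _ _ => //.
    by rewrite /= /upd /= (ctx_d cs7) !leq_fortime.
  move=> s8 [fr8 dr8 h8]; split.
  - apply: frame_trans (frame_sub fr7 _ _) (frame_sub (cframe_frame fr8) _ _) => //.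
  - by rewrite dr8.
  - move=> a l ad ld; rewrite h8 fr7.2// hB//= -/B.
    rewrite /upd /= (ctx_d cs7) nu7 r27.
    have -> : nmem s7 21 0 = j by rewrite fr7.1.
    rewrite (eq_bigr (fun k : 'I_d => if (k : nat) == a then
      (if l == j then gsf d Q B j k / expR (ln (gsnu d Q B j) / 2) else 0) else 0)).
      rewrite (sum_pick d a (fun k => if l == j then
        gsf d Q B j k / expR (ln (gsnu d Q B j) / 2) else 0)) ad nu.
      by case: eqP => [->|_]; rewrite ?addr0// /B gs_zero// add0r.
    move=> k _; rewrite h5//.
    case: (eqVneq l j) => [->|lj].
      rewrite eqn_add2r; case: (eqVneq (k : nat) a) => [->|ka]; first by rewrite eqxx.
      rewrite ifF//; apply/negbTE; rewrite eqn_mul2r negb_or ka andbT -lt0n.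
      exact: leq_ltn_trans jd.
    rewrite ifF; first by case: ifP.
    by apply/eqP => /(radix_inj jd ld)[_ e]; rewrite e eqxx in lj.
  - by move=> a ad; rewrite fr8.2// r27 h5.
apply: tri_skip; split => //=.
- exact: frame_sub fr7 _ _.
- move=> a l ad ld; rewrite fr7.2// hB// -/B (negbTE nu).
  by case: eqP => [->|//]; rewrite /B gs_zero.
- by move=> a ad; rewrite r27 h5.
Qed.

Lemma tri_gsrows s (Q : nat -> nat -> R) : ctx s ->
  (forall a b, (a < d)%N -> (b < d)%N -> rmem s 6 (a * d + b) = Q a b) ->
  tri GsRows s (fortime (d * d) 5 10 + fortime d 2 gsbodytime)
    (fun s' => [/\ frame [:: 21; 22; 23]%N [:: 2; 7; 8; 9]%N s s', draws s' = draws s,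
       (forall a l, (a < d)%N -> (l < d)%N -> rmem s' 7 (a * d + l) = gs d Q d a l) &
       (forall j a, j.+1 = d -> (a < d)%N -> rmem s' 2 a = gsf d Q (gs d Q j) j a)]).
Proof.
move=> cs hQ.
apply: (@tri_seq _ _ _ _ _ _ _ _ _ (fun s1 => [/\ frame [:: 21]%N [:: 7]%N s s1,
  draws s1 = draws s & forall k, (k < d * d)%N -> rmem s1 7 k = 0])).
  apply: tri_weaken (tri_fill _ _ _ _ _ _) _ _ => //.
    by rewrite /= (ctx_d cs) leq_fortime.
  by move=> s1 [fr dr h]; split => // k km; rewrite h /= (ctx_d cs) km.
move=> s1 [fr1 dr1 h1].
pose I j (s' : state) := [/\ frame [:: 21; 22; 23]%N [:: 2; 7; 8; 9]%N s s',
   nmem s' 21 0 = j /\ draws s' = draws s,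
   (forall a l, (a < d)%N -> (l < d)%N -> rmem s' 7 (a * d + l) = gs d Q j a l) &
   (forall j' a, j'.+1 = j -> (a < d)%N -> rmem s' 2 a = gsf d Q (gs d Q j') j' a)].
apply: (@tri_weaken _ _ _ _ _ _ (fortime d 2 gsbodytime) _ (I d)) => //; last first.
  by move=> s' [fr [_ dr] hB hf].
have fr1' : frame [:: 21; 22; 23]%N [:: 2; 7; 8; 9]%N s s1 by exact: frame_sub fr1 _ _.
apply: (@tri_for _ _ _ _ 21 eD).
- move=> k s' _ [fr [<- _] _ _]; split => //; rewrite (neval_frame fr)//=.
  exact: ctx_d cs.
- split => //=.
  + exact: frame_trans fr1' (frame_setnl _ _ _ _).
  + by move=> a l ad ld; rewrite h1//; exact: radix_ltn.
move=> j s' jd [fr [hj dr] hB hf].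
have cs' : ctx s' by apply: ctx_frame fr cs _ _.
apply: tri_weaken (tri_gsbody cs' jd hj _ hB) (leqnn _) _.
  by move=> a b ad bd; rewrite fr.2// hQ.
move=> s'' [fr2 dr2 hB2 hf2]; split; first by rewrite fr2.1.
split => //=.
- have fr3 : frame [:: 21; 22; 23]%N [:: 2; 7; 8; 9]%N s s''.
    by apply: frame_trans fr _; exact: frame_sub fr2 _ _.
  exact: frame_trans fr3 (frame_setnl _ _ _ _).
- by rewrite dr2.
by move=> j' a [->]; exact: hf2.
Qed.

End GramSchmidtPhase.

(** * Projections and one complete round *)

Definition signOff : nexp := NMul eN (NAdd eLM (NConst 1)).

Definition ProjBody : cmd :=
  Seq (Fill 22 eD 10 (rn 0))
  (Seq (Acc [:: (22, eD); (23, eD)]%N 10 (NV 22)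
         (RMul (eB (NV 22) (NV 23)) (sgn_of (NAdd signOff (idx2 (NV 21) (NV 23))))))
  (Seq (Fill 22 eN 11 (rn 0))
  (Seq (Acc [:: (22, eZ)]%N 11 (NLoad 31 (NV 22))
         (RMul (RLoad 10 (NLoad 2 (NV 22))) (RLoad 1 (NV 22))))
       (Acc [:: (22, eN)]%N 12 (NV 22) (RMul (RLoad 11 (NV 22)) (RLoad 11 (NV 22))))))).

Definition ProjRows : cmd := Seq (Fill 21 eN 12 (rn 0)) (For 21 eK ProjBody).

Definition eOver : rexp := RDiv (RMul (rn 5) (RLoad 12 (NV 21))) (RNat eK).

Definition UpdateRows : cmd :=
  For 21 eN (If (RLt eOver (RLoad 3 (NV 21))) (RStore 3 (NV 21) eOver) Skip).

Definition LewisStep : cmd :=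
  Seq (DrawBits (NAdd signOff (NMul eK eD)))
  (Seq HashRows (Seq RowCoef (Seq SketchRows (Seq GramRows
  (Seq GsRows (Seq ProjRows UpdateRows)))))).

Section LewisStepPhase.
Variable R : realType.
Variables (phi : nat -> nat -> nat) (solve : lp_solver R) (u : nat -> R).
Local Notation state := (state R).
Local Notation tri := (tri phi solve u).
Variables (d z n lg lm K : nat) (crow ccol : nat -> nat) (vals : nat -> R) (p eps : R).
Local Notation ctx := (@ctx R d z n lg lm K crow ccol vals p eps).
Local Notation ent := (@ent R z crow ccol vals).
Hypothesis crow_lt : forall e, (e < z)%N -> (crow e < n)%N.
Hypothesis ccol_lt : forall e, (e < z)%N -> (ccol e < d)%N.

Definition projbodytime : nat :=
  (fortime d 2 10 + (fortime d 2 (fortime d 2 100) + (fortime n 2 10 +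
   (fortime z 2 100 + fortime n 2 100))))%N.

Lemma tri_projbody s (B : nat -> nat -> R) (c : nat -> bool) k : ctx s ->
  (k < K)%N -> nmem s 21 0 = k ->
  (forall j, (j < n * lm.+1 + K * d)%N -> nmem s 32 j = c j :> nat) ->
  (forall a l, (a < d)%N -> (l < d)%N -> rmem s 7 (a * d + l) = B a l) ->
  tri ProjBody s projbodytime
    (fun s' => [/\ frame [:: 22; 23]%N [:: 10; 11; 12]%N s s', draws s' = draws s &
       forall i, (i < n)%N -> rmem s' 12 i = rmem s 12 i + mulv d ent
         (fun a => \sum_(l < d) B a l * sgc R (c (n * lm.+1 + (k * d + l))%N)) i ^+ 2]).
Proof.
move=> cs kK hk hc hB.
pose w a := \sum_(l < d) B a l * sgc R (c (n * lm.+1 + (k * d + l))%N).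
apply: (@tri_seq _ _ _ _ _ _ _ _ _ (fun s1 => [/\ frame [:: 22]%N [:: 10]%N s s1,
  draws s1 = draws s & forall a, (a < d)%N -> rmem s1 10 a = 0])).
  apply: tri_weaken (tri_fill _ _ _ _ _ _) _ _ => //.
    by rewrite /= (ctx_d cs) leq_fortime.
  by move=> s1 [fr dr h]; split => // a ad; rewrite h /= (ctx_d cs) ad.
move=> s1 [fr1 dr1 h1].
have cs1 : ctx s1 by apply: ctx_frame fr1 cs _ _.
apply: (@tri_seq _ _ _ _ _ _ _ _ _ (fun s2 => [/\ frame [:: 22; 23]%N [:: 10]%N s s2,
  draws s2 = draws s & forall a, (a < d)%N -> rmem s2 10 a = w a])).
  apply: tri_weaken (tri_acc _ _ _ _ _ _ _) _ _ => //.
    by rewrite /= /upd /= (ctx_d cs1) !leq_fortime.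
  move=> s2 [fr2 dr2 h2]; split.
  - by apply: frame_trans (frame_sub fr1 _ _) (cframe_frame fr2).
  - by rewrite dr2.
  move=> a ad; rewrite h2 h1 ?add0r//= /upd /= (ctx_d cs1).
  rewrite (sum_pick_row d (fun a l => rmem s1 7 (a * d + l) *
    ((2 * nmem s1 32 (nmem s1 11 0 * (nmem s1 14 0 + 1) +
       (nmem s1 21 0 * d + l)))%:R - 1)))//.
  rewrite /w; apply: eq_bigr => l _.
  rewrite fr1.2// hB// (ctx_n cs1) (ctx_lm cs1) addn1 !fr1.1// hk hc; last first.
    by rewrite ltn_add2l; exact: radix_ltn.
  by congr (_ * _); case: (c _); rewrite /sgc /=; ring.
move=> s2 [fr2 dr2 h2].
have cs2 : ctx s2 by apply: ctx_frame fr2 cs _ _.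
apply: (@tri_seq _ _ _ _ _ _ _ _ _ (fun s3 => [/\ frame [:: 22; 23]%N [:: 10; 11]%N s s3,
  draws s3 = draws s, rmem s3 10 = rmem s2 10 & forall i, (i < n)%N -> rmem s3 11 i = 0])).
  apply: tri_weaken (tri_fill _ _ _ _ _ _) _ _ => //.
    by rewrite /= (ctx_n cs2) leq_fortime.
  move=> s3 [fr dr h]; split.
  - by apply: frame_trans (frame_sub fr2 _ _) (frame_sub fr _ _).
  - by rewrite dr.
  - by rewrite fr.2.
  - by move=> i i_n; rewrite h /= (ctx_n cs2) i_n.
move=> s3 [fr3 dr3 r10 h3].
have cs3 : ctx s3 by apply: ctx_frame fr3 cs _ _.
apply: (@tri_seq _ _ _ _ _ _ _ _ _ (fun s4 => [/\ frame [:: 22; 23]%N [:: 10; 11]%N s s4,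
  draws s4 = draws s & forall i, (i < n)%N -> rmem s4 11 i = mulv d ent w i])).
  apply: tri_weaken (tri_acc _ _ _ _ _ _ _) _ _ => //.
    by rewrite /= /upd /= (ctx_z cs3) !leq_fortime.
  move=> s4 [fr4 dr4 h4]; split.
  - by apply: frame_trans fr3 _; exact: frame_sub (cframe_frame fr4) _ _.
  - by rewrite dr4.
  move=> i i_n; rewrite h4 h3// add0r /= /upd /= (ctx_z cs3).
  pose G i' a := if i' == i then w a else 0.
  transitivity (\sum_(e < z) G (crow e) (ccol e) * vals e).
    apply: eq_bigr => e _; have ez := ltn_ord e.
    rewrite (ctx_row cs3)// (ctx_col cs3)// (ctx_val cs3)// r10 h2 ?ccol_lt//.
    by rewrite /G; case: ifP => _; rewrite ?mul0r.
  rewrite (sum_entries _ crow_lt ccol_lt) (bigD1 (Ordinal i_n))//=.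
  rewrite [X in _ + X]big1 ?addr0.
    by apply: eq_bigr => a _; rewrite /G eqxx mulrC.
  move=> i'; rewrite -val_eqE/= => /negbTE ii; apply: big1 => a _.
  by rewrite /G ii mul0r.
move=> s4 [fr4 dr4 h4].
have cs4 : ctx s4 by apply: ctx_frame fr4 cs _ _.
apply: tri_weaken (tri_acc _ _ _ _ _ _ _) _ _ => //.
  by rewrite /= /upd /= (ctx_n cs4) !leq_fortime.
move=> s5 [fr5 dr5 h5]; split.
- by apply: frame_trans (frame_sub fr4 _ _) (frame_sub (cframe_frame fr5) _ _).
- by rewrite dr5.
move=> i i_n; rewrite h5 fr4.2//= /upd /= (ctx_n cs4).
rewrite (sum_pick n i (fun i => rmem s4 11 i * rmem s4 11 i)) i_n h4//.
Qed.

Lemma tri_projrows s (B : nat -> nat -> R) (c : nat -> bool) : ctx s ->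
  (forall j, (j < n * lm.+1 + K * d)%N -> nmem s 32 j = c j :> nat) ->
  (forall a l, (a < d)%N -> (l < d)%N -> rmem s 7 (a * d + l) = B a l) ->
  tri ProjRows s (fortime n 2 10 + fortime K 2 projbodytime)
    (fun s' => [/\ frame [:: 21; 22; 23]%N [:: 10; 11; 12]%N s s', draws s' = draws s &
       forall i, (i < n)%N -> rmem s' 12 i = \sum_(k < K) mulv d ent
         (fun a => \sum_(l < d) B a l * sgc R (c (n * lm.+1 + (k * d + l))%N)) i ^+ 2]).
Proof.
move=> cs hc hB.
apply: (@tri_seq _ _ _ _ _ _ _ _ _ (fun s1 => [/\ frame [:: 21]%N [:: 12]%N s s1,
  draws s1 = draws s & forall i, (i < n)%N -> rmem s1 12 i = 0])).
  apply: tri_weaken (tri_fill _ _ _ _ _ _) _ _ => //.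
    by rewrite /= (ctx_n cs) leq_fortime.
  by move=> s1 [fr dr h]; split => // i i_n; rewrite h /= (ctx_n cs) i_n.
move=> s1 [fr1 dr1 h1].
pose I k (s' : state) := [/\ frame [:: 21; 22; 23]%N [:: 10; 11; 12]%N s s',
   nmem s' 21 0 = k, draws s' = draws s &
   forall i, (i < n)%N -> rmem s' 12 i = \sum_(k' < k) mulv d ent
     (fun a => \sum_(l < d) B a l * sgc R (c (n * lm.+1 + (k' * d + l))%N)) i ^+ 2].
apply: (@tri_weaken _ _ _ _ _ _ (fortime K 2 projbodytime) _ (I K)) => //; last first.
  by move=> s' [fr _ dr hB'].
have fr1' : frame [:: 21; 22; 23]%N [:: 10; 11; 12]%N s s1 by exact: frame_sub fr1 _ _.
apply: (@tri_for _ _ _ _ 21 eK).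
- move=> k s' _ [fr <- _ _]; split => //; rewrite (neval_frame fr)//=.
  exact: ctx_K cs.
- split => //=.
  + exact: frame_trans fr1' (frame_setnl _ _ _ _).
  + by move=> i i_n; rewrite h1// big_ord0.
move=> k s' kK [fr hk dr hE].
have cs' : ctx s' by apply: ctx_frame fr cs _ _.
apply: tri_weaken (tri_projbody (c := c) (B := B) cs' kK hk _ _) (leqnn _) _.
- by move=> j jl; rewrite fr.1// hc.
- by move=> a l ad ld; rewrite fr.2// hB.
move=> s'' [fr2 dr2 h2]; split; first by rewrite fr2.1.
split => //=.
- have fr3 : frame [:: 21; 22; 23]%N [:: 10; 11; 12]%N s s''.
    by apply: frame_trans fr _; exact: frame_sub fr2 _ _.
  exact: frame_trans fr3 (frame_setnl _ _ _ _).
- by rewrite dr2.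
by move=> i i_n; rewrite h2// hE// big_ord_recr.
Qed.

Lemma tri_updaterows s (v E : nat -> R) : ctx s ->
  (forall i, (i < n)%N -> rmem s 3 i = v i) ->
  (forall i, (i < n)%N -> rmem s 12 i = E i) ->
  tri UpdateRows s (fortime n 2 50)
    (fun s' => [/\ frame [:: 21]%N [:: 3]%N s s', draws s' = draws s &
       forall i, (i < n)%N -> rmem s' 3 i =
         if 5 * E i / K%:R < v i then 5 * E i / K%:R else v i]).
Proof.
move=> cs hv hE.
pose w i := if 5 * E i / K%:R < v i then 5 * E i / K%:R else v i.
pose I k (s' : state) := [/\ frame [:: 21]%N [:: 3]%N s s',
   nmem s' 21 0 = k, draws s' = draws s &
   forall i, (i < n)%N -> rmem s' 3 i = if (i < k)%N then w i else v i].
apply: (@tri_weaken _ _ _ _ _ _ (fortime n 2 50) _ (I n)) => //; last first.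
  by move=> s' [fr _ dr h]; split => // i i_n; rewrite h// i_n.
apply: (@tri_for _ _ _ _ 21 eN).
- move=> k s' _ [fr <- _ _]; split => //; rewrite (neval_frame fr)//=.
  exact: ctx_n cs.
- by split => //=; exact: frame_setnl.
move=> k s' kn [fr hk dr h].
have cs' : ctx s' by apply: ctx_frame fr cs _ _.
have over : reval s' eOver = 5 * E k / K%:R.
  by rewrite /= hk fr.2// hE// (ctx_K cs').
have vk : rmem s' 3 k = v k by rewrite h// ltnn.
refine (@tri_weaken _ _ _ _ _ _ (20 + (gcost (RLt eOver (RLoad 3 (NV 21)))).+1)
  _ _ _ _ _ (fun _ h => h)); last by [].
apply: tri_if => /= g.
  have {}g : 5 * E k / K%:R < v k by move: g; rewrite -over -vk /= !hk.
  apply: tri_rstore => //=; rewrite hk; split => //; split => //=.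
  - by frame_upd fr.
  - move=> i i_n; rewrite /upd/= ltnS leq_eqVlt.
    case: (eqVneq i k) => [->|ik] /=; last exact: h.
    move: over => /=; rewrite hk => ->; by rewrite /w g.
have {}g : ~~ (5 * E k / K%:R < v k) by move: g; rewrite -over -vk /= !hk.
apply: tri_skip; split => //=; split => //=.
- exact: frame_trans fr (frame_setnl _ _ _ _).
move=> i i_n; rewrite ltnS leq_eqVlt h//.
by case: (eqVneq i k) => [->|ik] //=; rewrite ltnn /w (negbTE g).
Qed.

Definition steptime : nat :=
  (fortime (n * lm.+1 + K * d) 13 20 + (100 * (n.+1 * lm.+1) + (100 * n.+1 +
   (200 * (2 ^ lm * d + z).+1 +
   ((fortime (2 ^ lm) 2 (fortime d 2 (fortime d 2 100)) + 100 * (d * d).+1) +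
   ((fortime (d * d) 5 10 + fortime d 2 (gsbodytime d)) +
   ((fortime n 2 10 + fortime K 2 projbodytime) + fortime n 2 50)))))))%N.

Lemma tri_lewisstep s (v : nat -> R) (c := sshift (draws s) (coins u)) : ctx s ->
  (forall i, (i < n)%N -> rmem s 3 i = v i) ->
  tri LewisStep s steptime
    (fun s' => [/\ frame [:: 21; 22; 23; 32; 33; 34]%N
         [:: 2; 3; 4; 5; 6; 7; 8; 9; 10; 11; 12; 13]%N s s',
       draws s' = (draws s + (n * lm.+1 + K * d))%N,
       (forall i, (i < n)%N -> rmem s' 3 i = lewis_step p n d ent lm K v c i) &
       (forall j a, j.+1 = d -> (a < d)%N ->
         rmem s' 2 a = let Q := gram (2 ^ lm) (sketch_of p n ent lm v c) in
           gsf d Q (gs d Q j) j a)]).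
Proof.
move=> cs hv; set NA := [:: 21; 22; 23; 32; 33; 34]%N.
set RA := [:: 2; 3; 4; 5; 6; 7; 8; 9; 10; 11; 12; 13]%N.
pose len := (n * lm.+1 + K * d)%N.
have lenE : neval s (NAdd signOff (NMul eK eD)) = len.
  by rewrite /= (ctx_n cs) (ctx_lm cs) (ctx_K cs) (ctx_d cs) addn1.
apply: (@tri_seq _ _ _ _ _ _ _ _ _ (fun s1 => [/\ frame [:: 21; 32]%N [:: 13]%N s s1,
  draws s1 = (draws s + len)%N & forall j, (j < len)%N -> nmem s1 32 j = c j :> nat])).
  apply: tri_weaken (tri_drawbits _ _ _ _ _) _ _ => //.
    by rewrite lenE.
  by move=> s1 [fr dr h]; rewrite lenE in dr h.
move=> s1 [fr1 dr1 hc1].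
have F1 : frame NA RA s s1 by exact: frame_sub fr1 _ _.
have cs1 : ctx s1 by apply: ctx_frame F1 cs _ _.
apply: tri_seq (tri_hashrows _ _ _ cs1 hc1) _ => s2 [fr2 dr2 hh2].
have F2 : frame NA RA s s2 by apply: frame_trans F1 _; exact: frame_sub fr2 _ _.
have cs2 : ctx s2 by apply: ctx_frame F2 cs _ _.
have hc2 j : (j < len)%N -> nmem s2 32 j = c j :> nat by rewrite fr2.1//; exact: hc1.
have hv2 i : (i < n)%N -> rmem s2 3 i = v i by rewrite fr2.2// fr1.2//; exact: hv.
apply: tri_seq (tri_rowcoef _ _ _ cs2 hc2 hv2) _ => s3 [fr3 dr3 hw3].
have F3 : frame NA RA s s3 by apply: frame_trans F2 _; exact: frame_sub fr3 _ _.
have cs3 : ctx s3 by apply: ctx_frame F3 cs _ _.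
have hh3 i : (i < n)%N -> nmem s3 33 i = rowhash lm c i by rewrite fr3.1//; exact: hh2.
apply: tri_seq (tri_sketchrows _ _ _ crow_lt ccol_lt cs3 hh3 hw3) _ => s4 [fr4 dr4 hY4].
have F4 : frame NA RA s s4 by apply: frame_trans F3 _; exact: frame_sub fr4 _ _.
have cs4 : ctx s4 by apply: ctx_frame F4 cs _ _.
apply: tri_seq (tri_gramrows _ _ _ cs4 hY4) _ => s5 [fr5 dr5 hQ5].
have F5 : frame NA RA s s5 by apply: frame_trans F4 _; exact: frame_sub fr5 _ _.
have cs5 : ctx s5 by apply: ctx_frame F5 cs _ _.
apply: tri_seq (tri_gsrows _ _ _ cs5 hQ5) _ => s6 [fr6 dr6 hB6 hf6].
have F6 : frame NA RA s s6 by apply: frame_trans F5 _; exact: frame_sub fr6 _ _.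
have cs6 : ctx s6 by apply: ctx_frame F6 cs _ _.
have hc6 j : (j < len)%N -> nmem s6 32 j = c j :> nat.
  by rewrite fr6.1// fr5.1// fr4.1// fr3.1//; exact: hc2.
apply: tri_seq (tri_projrows cs6 hc6 hB6) _ => s7 [fr7 dr7 hE7].
have F7 : frame NA RA s s7 by apply: frame_trans F6 _; exact: frame_sub fr7 _ _.
have cs7 : ctx s7 by apply: ctx_frame F7 cs _ _.
have hv7 i : (i < n)%N -> rmem s7 3 i = v i.
  by rewrite fr7.2// fr6.2// fr5.2// fr4.2// fr3.2//; exact: hv2.
apply: tri_weaken (tri_updaterows cs7 hv7 hE7) (leqnn _) _ => s8 [fr8 dr8 hv8].
split.
- by apply: frame_trans F7 _; exact: frame_sub fr8 _ _.
- by rewrite dr8 dr7 dr6 dr5 dr4 dr3 dr2 dr1.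
- by move=> i i_n; rewrite hv8.
- by move=> j a jd ad; rewrite fr8.2// fr7.2// (hf6 j).
Qed.

End LewisStepPhase.

(** * Renumbering the nonzero rows, and logarithms *)

Definition CompactRows : cmd :=
  For 21 eZ
    (Seq (If (NLt (NLoad 30 (NLoad 1 (NV 21))) (NConst 1))
             (Seq (NStore 11 (NConst 0) (NAdd (NV 11) (NConst 1)))
                  (NStore 30 (NLoad 1 (NV 21)) (NV 11)))
             Skip)
         (NStore 31 (NV 21) (NSub (NLoad 30 (NLoad 1 (NV 21))) (NConst 1)))).

Definition LogLoop (l pw : nat) (bound : nexp) : cmd :=
  Seq (NStore l (NConst 0) (NConst 0))
  (Seq (NStore pw (NConst 0) (NConst 1))
       (While (NLt (NV pw) bound)
          (Seq (NStore pw (NConst 0) (NAdd (NV pw) (NV pw)))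
               (NStore l (NConst 0) (NAdd (NV l) (NConst 1)))))).

(** Distinct values in the order of first occurrence, which is the order of the renumbering; [undup]
    would keep last occurrences. *)
Fixpoint firsts (r : nat -> nat) (k : nat) : seq nat :=
  if k is k'.+1 then
    if r k' \in firsts r k' then firsts r k' else rcons (firsts r k') (r k')
  else [::].

Lemma firsts_uniq r k : uniq (firsts r k).
Proof. by elim: k => //= k IH; case: ifPn => //; rewrite rcons_uniq IH andbT. Qed.

Lemma firsts_size r k : (size (firsts r k) <= k)%N.
Proof. by elim: k => //= k IH; case: ifP => _; rewrite ?size_rcons//; exact: leqW. Qed.

Lemma mem_firsts r k e : (e < k)%N -> r e \in firsts r k.
Proof.
elim: k => //= k IH; rewrite ltnS leq_eqVlt => /predU1P[->|/IH h].
  by case: ifP => // _; rewrite mem_rcons mem_head.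
by case: ifP => // _; rewrite mem_rcons inE h orbT.
Qed.

Lemma firsts_mem r k x : x \in firsts r k -> exists2 e, (e < k)%N & r e = x.
Proof.
elim: k => //= k IH; case: ifP => _; last rewrite mem_rcons inE.
  by move=> /IH[e ek <-]; exists e => //; exact: leqW.
move=> /orP[/eqP->|/IH[e ek <-]]; first by exists k.
by exists e => //; exact: leqW.
Qed.

Section Preprocessing.
Variable R : realType.
Variables (phi : nat -> nat -> nat) (solve : lp_solver R) (u : nat -> R).
Local Notation state := (state R).
Local Notation tri := (tri phi solve u).

(** Only rows that occur in the listing are visited, so the number of rows of the input does not
    enter the time bound. *)
Lemma tri_compact s z : nmem s 0 2 = z -> nmem s 11 0 = 0%N ->
  (forall x, nmem s 30 x = 0%N) ->
  tri CompactRows s (fortime z 2 60)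
    (fun s' => [/\ frame [:: 11; 21; 30; 31]%N [::] s s', draws s' = draws s,
       nmem s' 11 0 = size (firsts (nmem s 1) z) &
       forall e, (e < z)%N -> nmem s' 31 e = index (nmem s 1 e) (firsts (nmem s 1) z)]).
Proof.
move=> hz h11 h30; set r := nmem s 1.
pose I k (s' : state) := [/\ frame [:: 11; 21; 30; 31]%N [::] s s',
   nmem s' 21 0 = k /\ draws s' = draws s, nmem s' 11 0 = size (firsts r k),
   (forall x, nmem s' 30 x =
     if x \in firsts r k then (index x (firsts r k)).+1 else 0%N) &
   forall e, (e < k)%N -> nmem s' 31 e = index (r e) (firsts r k)].
apply: (@tri_weaken _ _ _ _ _ _ (fortime z 2 60) _ (I z)) => //; last first.
  by move=> s' [fr [_ dr] h1 _ h2].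
apply: (@tri_for _ _ _ _ 21 eZ).
- by move=> k s' _ [fr [<- _] _ _ _]; split => //; rewrite (neval_frame fr).
- by split => //=; exact: frame_setnl.
move=> k s' kz [fr [hk dr] h1 h2 h3].
have r1 : nmem s' 1 = r by rewrite fr.1.
pose s0 x := State x (rmem s') (draws s') 0.
pose nm1 := if r k \in firsts r k then nmem s' else
  upd (upd (nmem s') 11 0 (size (firsts r k)).+1) 30 (r k) (size (firsts r k)).+1.
refine (@tri_weaken _ _ _ _ _ _ (40 + (gcost (NLt (NLoad 30 (NLoad 1 (NV 21)))
  (NConst 1))).+1 + 12) _ _ _ _ _ (fun _ h => h)); last by [].
apply: (@tri_seq _ _ _ _ _ _ _ _ _ (fun s1 => s1 = s0 nm1)).
  apply: tri_if => /=; rewrite hk r1 h2 /nm1; case: ifP => hin // _; last first.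
    by apply: tri_skip; rewrite /core /s0.
  refine (@tri_weaken _ _ _ _ _ _ (20 + 20) _ _ _ _ _ (fun _ h => h)); last by [].
  apply: (@tri_seq _ _ _ _ _ _ _ _ _ (fun s1 =>
    s1 = s0 (upd (nmem s') 11 0 (size (firsts r k)).+1))).
    by apply: tri_nstore => //=; rewrite h1 addn1.
  move=> s1 ->; apply: tri_nstore => //=.
  by rewrite /upd /= r1 hk.
move=> s1 ->; apply: tri_nstore => //=.
have fr1 : frame [:: 11; 21; 30; 31]%N [::] s (s0 nm1).
  by rewrite /s0 /nm1; case: ifP => _; [exact: fr|frame_upd fr].
have e21 : nm1 21 0 = k by rewrite /nm1; case: ifP => _; rewrite /upd /= hk.
have e1 : nm1 1 = r by exact: (fr1.1 1%N isT).
have e11 : nm1 11 0 = size (firsts r k.+1).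
  by rewrite /nm1 /=; case: ifP => _; rewrite ?size_rcons.
have e30 x : nm1 30 x = if x \in firsts r k.+1 then (index x (firsts r k.+1)).+1 else 0%N.
  rewrite /nm1 /=; case: ifPn => hin; first exact: h2.
  rewrite /upd /= mem_rcons inE -cats1 index_cat h2.
  case: eqP => [->|_] /=; last by case: ifP.
  by rewrite (negbTE hin) /= eqxx addn0.
have e31 : nm1 31 = nmem s' 31 by rewrite /nm1; case: ifP.
rewrite e21; split; first by rewrite /upd /= e21.
split => //.
- by frame_upd fr1.
move=> e; rewrite ltnS leq_eqVlt /= /upd /= => /predU1P[->|ek].
  by rewrite eqxx e1 e30 mem_firsts// subn1.
rewrite ltn_eqF// e31 h3//=; case: ifP => // _.
by rewrite -cats1 index_cat mem_firsts.
Qed.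

Lemma tri_log s l pw bound N (lg := up_log 2 N) : l != pw ->
  avoids (nreads bound) [:: l; pw] -> neval s bound = N ->
  tri (LogLoop l pw bound) s (10 + lg.+1 * (ncost bound + 40))
    (fun s' => [/\ frame [:: l; pw] [::] s s', draws s' = draws s,
       nmem s' l 0 = lg & nmem s' pw 0 = (2 ^ lg)%N]).
Proof.
move=> lpw av hN.
rewrite /LogLoop; set W := While _ _.
pose I k (s' : state) := [/\ frame [:: l; pw] [::] s s', draws s' = draws s,
   nmem s' l 0 = k & nmem s' pw 0 = (2 ^ k)%N].
have loop r : forall k s', (k + r = lg)%N -> I k s' ->
    tri W s' (r.+1 * (ncost bound + 40) - 20) (I lg).
  elim: r => [|r IH] k s' kr [fr dr hl hp].
    rewrite addn0 in kr; rewrite {k}kr in hl hp.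
    exists (tick (gcost (NLt (NV pw) bound)).+1 (core s')); split => //.
    - apply: exec_While_false; rewrite /= hp neval_core (neval_frame fr)// hN.
      by rewrite -leqNgt; exact: up_logP.
    - by rewrite /=; lia.
  have kl : (k < lg)%N by lia.
  have g : (2 ^ k < N)%N by rewrite ltnNge; apply/negP => /(up_log_min (ltnSn 1)); rewrite -/lg; lia.
  have := tri_seq (u := u) (s := s') (phi := phi) (solve := solve)
    (c1 := NStore pw (NConst 0) (NAdd (NV pw) (NV pw)))
    (c2 := NStore l (NConst 0) (NAdd (NV l) (NConst 1))) (t1 := 10) (t2 := 10)
    (Q1 := fun s1 => s1 = State (upd (nmem s') pw 0 (2 ^ k.+1)%N) (rmem s') (draws s') 0)
    (Q := I k.+1).
  case=> [||s1 [x1 t1 I1]].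
  - by apply: tri_nstore => //=; rewrite hp addnn -mul2n -expnS.
  - move=> s1 ->; apply: tri_nstore => //=; split => //=.
    + have fr' : frame [:: l; pw] [::] s (State (nmem s') (rmem s') (draws s') 0) by [].
      apply: frame_trans fr' _; apply: frame_nupd; first exact: mem_head.
      by apply: frame_nupd => //; rewrite !inE eqxx orbT.
    + by rewrite /upd !eqxx /= (negbTE lpw) /= hl addn1.
    + by rewrite /upd eq_sym (negbTE lpw) /= !eqxx.
  have [||s2 [x2 t2 I2]] := IH k.+1 (core s1); [by lia|by []|].
  set gc := (gcost (NLt (NV pw) bound)).+1.
  exists (tick (gc + time s1) s2); split => //.
  - apply: (@exec_While_true _ _ _ _ _ _ _ (tick gc s1)).
    + by rewrite /= hp neval_core (neval_frame fr)// hN.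
    + by apply: (@exec_tick _ _ _ _ _ _ _ gc); exact: x1.
    + have -> : tick gc s1 = tick (gc + time s1) (core (core s1)).
        by rewrite /tick /core /=; congr State; lia.
      exact: exec_tick.
  - by move: t1 t2; rewrite /gc /=; lia.
refine (@tri_weaken _ _ _ _ _ _ (5 + (5 + (lg.+1 * (ncost bound + 40) - 20))) _ (I lg) _ _ _ _) => //;
  last by lia.
apply: (@tri_seq _ _ _ _ _ _ _ _ _ (fun s1 => s1 = State (upd (nmem s) l 0 0) (rmem s) (draws s) 0)).
  by apply: tri_nstore.
move=> s1 ->; apply: (@tri_seq _ _ _ _ _ _ _ _ _ (I 0)).
  apply: tri_nstore => //=; split => //=.
  - have fr' : frame [:: l; pw] [::] s (State (nmem s) (rmem s) (draws s) 0) by [].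
    apply: frame_trans fr' _; apply: frame_nupd; first by rewrite !inE eqxx orbT.
    by apply: frame_nupd => //; rewrite !inE eqxx.
  - by rewrite /upd (negbTE lpw) /= !eqxx.
  - by rewrite /upd !eqxx.
by move=> s2; exact: loop.
Qed.

End Preprocessing.

(* Array 15 holds the sampling rate Np; a row of Lewis weight w is kept with
   probability 2^-J, where J is the largest exponent (up to the cap eLG) with
   Np * w <= 2^-J. *)
Definition eNp : rexp := RLoad 15 (NConst 0).
Definition ePr : rexp := RLoad 14 (NConst 0).
Definition eW : rexp := RExp (RMul (RDiv eP (rn 2)) (RLn (RLoad 3 (NV 21)))).

Definition SampleRows : cmd :=
  For 21 eN
    (Seq (RStore 14 (NConst 0) (rn 1))
    (Seq (NStore 35 (NConst 0) (NConst 1))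
    (Seq (For 22 eLG
           (If (RLt (RDiv ePr (rn 2)) (RMul eNp eW)) Skip
               (Seq (RStore 14 (NConst 0) (RDiv ePr (rn 2)))
                    (NStore 35 (NConst 0) (NMul (NV 35)
                       (NLoad 32 (NAdd (NMul (NV 21) eLG) (NV 22))))))))
         (If (NLt (NConst 0) (NV 35))
             (Seq (NStore 36 (NV 21) (NV 37))
             (Seq (RStore 17 (NV 21) (RExp (RDiv (RSub (rn 0) (RLn ePr)) eP)))
                  (NStore 37 (NConst 0) (NAdd (NV 37) (NConst 1)))))
             Skip)))).

(** Truncated subtraction as a test: 1 in the last column and 0 before it. The body of [Acc] has no
    conditional. *)
Definition eIsLast : nexp :=
  NSub (NConst 1) (NSub (NSub eD (NConst 1)) (NLoad 2 (NV 21))).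

(** Entries of dropped rows are harmless: such a row has position 0 and weight 0, so they add 0 to
    row 0. The matrix keeps [d] columns, the last one zero, as the call is to be charged
    [phi t d]. *)
Definition BuildProblem : cmd :=
  Seq (Acc [:: (21, eZ)]%N 18 (idx2 (NLoad 36 (NLoad 31 (NV 21))) (NLoad 2 (NV 21)))
         (RMul (RMul (RLoad 17 (NLoad 31 (NV 21))) (RLoad 1 (NV 21)))
               (RSub (rn 1) (RNat eIsLast))))
      (Acc [:: (21, eZ)]%N 19 (NLoad 36 (NLoad 31 (NV 21)))
         (RMul (RSub (rn 0) (RMul (RLoad 17 (NLoad 31 (NV 21))) (RLoad 1 (NV 21))))
               (RNat eIsLast))).

Lemma ltnS_eqVlt j i : (j < i.+1)%N = (j == i) || (j < i)%N.
Proof. by rewrite ltnS leq_eqVlt. Qed.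

Section SamplingExponent.
Variable R : realType.

Definition sampexp (L : nat) (x : R) : nat :=
  find (fun l => 2^-1 ^+ l.+1 < x) (iota 0 L).

Lemma sampexp_le L x : (sampexp L x <= L)%N.
Proof. by rewrite -[leqRHS](size_iota 0 L) find_size. Qed.

Lemma sampexp_before L x l : (l < sampexp L x)%N -> x <= 2^-1 ^+ l.+1.
Proof.
move=> h; have := before_find 0 h; rewrite nth_iota ?add0n => [/negbT|].
  by rewrite -leNgt.
exact: leq_trans h (sampexp_le L x).
Qed.

Lemma sampexp_at L x : (sampexp L x < L)%N -> 2^-1 ^+ (sampexp L x).+1 < x.
Proof.
move=> h; have hs : has (fun l => 2^-1 ^+ l.+1 < x) (iota 0 L).
  by rewrite has_find size_iota.
have := nth_find 0 hs; rewrite nth_iota ?add0n//.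
Qed.

Definition keepbits (L : nat) (c : nat -> bool) (i k : nat) : bool :=
  all (fun b => c (i * L + b)%N) (iota 0 k).

Lemma keepbitsS L c i k : keepbits L c i k.+1 = keepbits L c i k && c (i * L + k)%N.
Proof. by rewrite /keepbits -addn1 iotaD all_cat /= andbT. Qed.

Lemma kept_keepbits L J c i : kept L J c i = keepbits L c i (J i).
Proof.
apply/forallP/allP => [h b|h l].
  by rewrite mem_iota add0n => /= bJ; exact: (h (Ordinal bJ)).
by apply: h; rewrite mem_iota add0n /=.
Qed.

End SamplingExponent.

Section SamplingPhase.
Variable R : realType.
Variables (phi : nat -> nat -> nat) (solve : lp_solver R) (u : nat -> R).
Local Notation state := (state R).
Local Notation tri := (tri phi solve u).
Variables (d z n lg lm K : nat) (crow ccol : nat -> nat) (vals : nat -> R) (p eps : R).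
Local Notation ctx := (@ctx R d z n lg lm K crow ccol vals p eps).
Local Notation ent := (@ent R z crow ccol vals).
Hypothesis crow_lt : forall e, (e < z)%N -> (crow e < n)%N.
Hypothesis ccol_lt : forall e, (e < z)%N -> (ccol e < d)%N.
Variables (v : nat -> R) (Np : R) (c : nat -> bool).

Definition sampJ (i : nat) : nat := sampexp lg (Np * lewis p v i).
Definition sampkept (i : nat) : bool := kept lg sampJ c i.
Definition samppos (i : nat) : nat := (\sum_(j < i) sampkept j)%N.
(** The [p]-th root of the inverse probability [2^J], since rows are scaled before the power [p] is
    taken. *)
Definition sampwt (i : nat) : R := expR ((0 - ln (2^-1 ^+ sampJ i)) / p).

Definition samptime : nat := fortime n 2 (10 + (10 + (fortime lg 2 100 + 100))).

Lemma tri_samplerows s : ctx s ->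
  (forall k, (k < n * lg)%N -> nmem s 32 k = c k :> nat) ->
  (forall i, (i < n)%N -> rmem s 3 i = v i) ->
  rmem s 15 0 = Np -> nmem s 37 0 = 0%N ->
  (forall i, nmem s 36 i = 0%N) -> (forall i, rmem s 17 i = 0) ->
  tri SampleRows s samptime
    (fun s' => [/\ frame [:: 21; 22; 35; 36; 37]%N [:: 14; 17]%N s s', draws s' = draws s,
       nmem s' 37 0 = samppos n,
       (forall i, (i < n)%N -> nmem s' 36 i = if sampkept i then samppos i else 0%N) &
       forall i, (i < n)%N -> rmem s' 17 i = if sampkept i then sampwt i else 0]).
Proof.
move=> cs hc hv hNp h37 h36 h17.
set NA := [:: 21; 22; 35; 36; 37]%N; set RA := [:: 14; 17]%N.
pose I k (s' : state) := [/\ frame NA RA s s', nmem s' 21 0 = k /\ draws s' = draws s,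
   nmem s' 37 0 = samppos k,
   (forall i, nmem s' 36 i = if (i < k)%N && sampkept i then samppos i else 0%N) &
   forall i, rmem s' 17 i = if (i < k)%N && sampkept i then sampwt i else 0].
apply: (@tri_weaken _ _ _ _ _ _ samptime _ (I n)) => //; last first.
  move=> s' [fr [_ dr] h1 h2 h3]; split => // i i_n; first by rewrite h2 i_n.
  by rewrite h3 i_n.
apply: (@tri_for _ _ _ _ 21 eN).
- move=> k s' _ [fr [<- _] _ _ _]; split => //; rewrite (neval_frame fr)//=.
  exact: ctx_n cs.
- split => //=; first exact: frame_setnl.
  by rewrite /samppos big_ord0.
move=> i s' i_n [fr [hi dr] hpos h36' h17'].
have cs' : ctx s' by apply: ctx_frame fr cs _ _.
pose J := sampJ i; pose w := lewis p v i.
apply: (@tri_seq _ _ _ _ _ _ _ _ _ (fun s1 => [/\ frame [::] [:: 14]%N s' s1,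
   draws s1 = draws s & rmem s1 14 0 = 1])).
  have fr0 : frame [::] [:: 14]%N s' (core s') by [].
  by apply: tri_rstore => //=; split => //=; frame_upd fr0.
move=> s1 [fr1 dr1 h1].
apply: (@tri_seq _ _ _ _ _ _ _ _ _ (fun s2 => [/\ frame [:: 35]%N [:: 14]%N s' s2,
   draws s2 = draws s, rmem s2 14 0 = 1 & nmem s2 35 0 = 1%N])).
  have fr1' : frame [:: 35]%N [:: 14]%N s' s1 by exact: frame_sub fr1 _ _.
  by apply: tri_nstore => //=; split => //=; frame_upd fr1'.
move=> s2 [fr2 dr2 h2 k2].
(* Once the guard holds at pass [J], it holds at all later passes and they change nothing; so a loop
   of fixed length finds the exponent, and [minn] describes every stage. *)
pose I2 l (s3 : state) := [/\ frame [:: 22; 35]%N [:: 14]%N s' s3,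
   nmem s3 22 0 = l /\ draws s3 = draws s, rmem s3 14 0 = 2^-1 ^+ (minn l J) &
   nmem s3 35 0 = keepbits lg c i (minn l J) :> nat].
apply: (@tri_seq _ _ _ _ _ _ _ _ _ (I2 lg)).
  apply: (@tri_for _ _ _ _ 22 eLG).
  - move=> l s3 _ [fr3 [<- _] _ _]; split => //; rewrite (neval_frame fr3)//=.
    exact: ctx_lg cs'.
  - split => //=.
    + apply: frame_trans (frame_sub fr2 _ _) (frame_setnl _ _ _ _) => //.
    + by rewrite min0n expr0.
    + by rewrite min0n.
  move=> l s3 ll [fr3 [hl dr3] hpr hkp].
  have cs3 : ctx s3 by apply: ctx_frame fr3 cs' _ _.
  have condE : (2^-1 ^+ (minn l J).+1 < Np * w) = (J <= l)%N.
    case: (leqP J l) => Jl.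
      by have := @sampexp_at R lg (Np * w); apply; exact: leq_ltn_trans Jl ll.
    by apply/negbTE; rewrite -leNgt; exact: (@sampexp_before R lg _ _ Jl).
  have prE : rmem s3 14 0 / 2%:R = 2^-1 ^+ (minn l J).+1 by rewrite hpr exprSr.
  have npE : rmem s3 15 0 * expR (rmem s3 0 0 / 2%:R * ln (rmem s3 3 (nmem s3 21 0))) =
      Np * w.
    rewrite (ctx_p cs3) fr3.2// fr.2// hNp fr3.1// hi fr3.2// fr.2//.
    by rewrite hv.
  refine (@tri_weaken _ _ _ _ _ _ (40 + (gcost (RLt (RDiv ePr (rn 2)) (RMul eNp eW))).+1)
    _ _ _ _ _ (fun _ h => h)); last by [].
  apply: tri_if => /= g.
    rewrite prE npE condE in g.
    have m1 : minn l.+1 J = J by apply/minn_idPr; exact: leqW.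
    have m2 : minn l J = J by exact/minn_idPr.
    apply: tri_skip; split => //=; split => //=.
    - exact: frame_trans fr3 (frame_setnl _ _ _ _).
    - by rewrite hpr m1 m2.
    - by rewrite /upd /= hkp m1 m2.
  rewrite prE npE condE -ltnNge in g.
  have mS : minn l.+1 J = l.+1 by apply/minn_idPl.
  have ml : minn l J = l by apply/minn_idPl; exact: ltnW.
  refine (@tri_weaken _ _ _ _ _ _ (20 + 20) _ _ _ _ _ (fun _ h => h)); last by [].
  apply: (@tri_seq _ _ _ _ _ _ _ _ _ (fun s4 =>
     s4 = State (nmem s3) (upd (rmem s3) 14 0 (2^-1 ^+ l.+1)) (draws s3) 0)).
    by apply: tri_rstore => //=; rewrite prE ml.
  move=> s4 ->; apply: tri_nstore => //=; split => //=; split => //=.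
  - by frame_upd fr3.
  - by rewrite /upd /= mS.
  - have e21 : nmem s3 21 0 = i by rewrite fr3.1.
    have e32 : nmem s3 32 (i * lg + l) = c (i * lg + l)%N.
      by rewrite fr3.1// fr.1// hc//; exact: radix_ltn.
    by rewrite /upd /= hkp ml mS keepbitsS e21 hl (ctx_lg cs3) e32 mulnb.
move=> s3 [fr3 [_ dr3] hpr hkp].
have mJ : minn lg J = J by apply/minn_idPr; exact: sampexp_le.
rewrite mJ in hpr hkp.
have keptE : sampkept i = keepbits lg c i J by exact: kept_keepbits.
rewrite -keptE in hkp.
have fr4 : frame NA RA s s3.
  by apply: frame_trans fr _; exact: frame_sub fr3 _ _.
have cs4 : ctx s3 by apply: ctx_frame fr4 cs _ _.
have e21 : nmem s3 21 0 = i by rewrite fr3.1.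
have e37 : nmem s3 37 0 = samppos i by rewrite fr3.1.
have e36 : nmem s3 36 = nmem s' 36 by rewrite fr3.1.
have e17 : rmem s3 17 = rmem s' 17 by rewrite fr3.2.
have posS : samppos i.+1 = (samppos i + sampkept i)%N by rewrite /samppos big_ord_recr.
refine (@tri_weaken _ _ _ _ _ _ (60 + (gcost (NLt (NConst 0) (NV 35))).+1)
    _ _ _ _ _ (fun _ h => h)); last by [].
apply: tri_if => /= g; rewrite hkp lt0b in g; last first.
  rewrite (negbTE g) addn0 in posS.
  apply: tri_skip; split => //=; split => //=.
  - exact: frame_trans fr4 (frame_setnl _ _ _ _).
  - by rewrite /upd /= e37 posS.
  - move=> j; rewrite /upd /= e36 h36' ltnS_eqVlt.
    by case: (eqVneq j i) => [->|_] //=; rewrite ltnn (negbTE g).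
  - move=> j; rewrite /= e17 h17' ltnS_eqVlt.
    by case: (eqVneq j i) => [->|_] //=; rewrite ltnn (negbTE g).
rewrite g addn1 in posS.
refine (@tri_weaken _ _ _ _ _ _ (20 + (20 + 20)) _ _ _ _ _ (fun _ h => h)); last by [].
apply: (@tri_seq _ _ _ _ _ _ _ _ _ (fun s5 => [/\ frame NA RA s s5,
   nmem s5 21 0 = i /\ draws s5 = draws s, nmem s5 37 0 = samppos i,
   (forall j, nmem s5 36 j = if (j < i.+1)%N && sampkept j then samppos j else 0%N) &
   rmem s5 17 = rmem s' 17 /\ rmem s5 14 0 = 2^-1 ^+ J])).
  apply: tri_nstore => //=; split => //=.
  - by frame_upd fr4.
  - move=> j; rewrite /upd /= e21 e37 e36 ltnS_eqVlt.
    by case: (eqVneq j i) => [->|_] //=; rewrite g.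
move=> s5 [fr5 [i5 dr5] p5 q5 [r5 pr5]].
have cs5 : ctx s5 by apply: ctx_frame fr5 cs _ _.
apply: (@tri_seq _ _ _ _ _ _ _ _ _ (fun s6 => [/\ frame NA RA s s6,
   nmem s6 21 0 = i /\ draws s6 = draws s, nmem s6 37 0 = samppos i,
   nmem s6 36 = nmem s5 36 &
   forall j, rmem s6 17 j = if (j < i.+1)%N && sampkept j then sampwt j else 0])).
  apply: tri_rstore => //=; split => //=.
  - by frame_upd fr5.
  - move=> j; rewrite /upd /= i5 pr5 (ctx_p cs5) r5 h17' ltnS_eqVlt.
    by case: (eqVneq j i) => [->|_] //=; rewrite g.
move=> s6 [fr6 [i6 dr6] p6 q6 r6].
apply: tri_nstore => //=; split => //=; split => //=.
- by frame_upd fr6.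
- by rewrite /upd /= p6 addn1 posS.
- by move=> j; rewrite /upd /= q6 q5.
Qed.

Lemma samppos_lt m i : (i < m)%N -> sampkept i -> (samppos i < samppos m)%N.
Proof.
move=> i_m k; rewrite /samppos -!(big_mkord xpredT (fun j => nat_of_bool (sampkept j))).
rewrite [X in (_ < X)%N](big_cat_nat (n := i.+1))//= big_nat_recr//= k.
by rewrite -addnA -addn1 leq_add2l.
Qed.

Let W i : R := if sampkept i then sampwt i else 0.
Let pos i : nat := if sampkept i then samppos i else 0%N.

(** Kept rows are numbered consecutively, so each sampled row collects exactly one kept row; dropped
    rows share position 0 but carry weight 0. *)
Lemma sum_samppos m (f : R -> R) (h : nat -> R) : (m <= n)%N ->
  \sum_(t < samppos m) f (\sum_(i < m) (if pos i == t then W i * h i else 0)) =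
  \sum_(i < m) (if sampkept i then f (W i * h i) else 0).
Proof.
elim: m => [|m IH] mn.
  by rewrite /samppos !big_ord0.
rewrite [RHS]big_ord_recr/= -IH; last exact: ltnW.
have -> : samppos m.+1 = (samppos m + sampkept m)%N by rewrite /samppos big_ord_recr.
case km : (sampkept m).
  rewrite addn1 big_ord_recr/=; congr (_ + _).
    apply: eq_bigr => t _; congr f; rewrite big_ord_recr/=.
    by rewrite /pos km gtn_eqF ?addr0.
  congr f; rewrite big_ord_recr/= big1 ?add0r.
    by rewrite /pos km eqxx.
  move=> i _; rewrite /W; case ki : (sampkept i); last by rewrite mul0r if_same.
  by rewrite /pos ki ltn_eqF// samppos_lt.
rewrite addn0 addr0; apply: eq_bigr => t _; congr f.
by rewrite big_ord_recr/= /W km mul0r if_same addr0.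
Qed.

Lemma tri_buildproblem s : ctx s ->
  (forall i, (i < n)%N -> nmem s 36 i = pos i) ->
  (forall i, (i < n)%N -> rmem s 17 i = W i) ->
  (forall j, rmem s 18 j = 0) -> (forall j, rmem s 19 j = 0) ->
  tri BuildProblem s (fortime z 2 200 + fortime z 2 200)
    (fun s' => [/\ frame [:: 21]%N [:: 18; 19]%N s s', draws s' = draws s,
       (forall t a, (a < d)%N -> rmem s' 18 (t * d + a) =
          \sum_(i < n) (if pos i == t then W i *
             (if a.+1 == d then 0 else ent i a) else 0)) &
       (forall t, rmem s' 19 t = - \sum_(i < n) (if pos i == t then
          W i * ent i d.-1 else 0))]).
Proof.
move=> cs hp hw h18 h19.
have lastE a : (a < d)%N -> ((1 - (d - 1 - a))%N)%:R = (a.+1 == d)%:R :> R.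
  by move=> ad; congr (_%:R); case: eqP => [|] h; lia.
apply: (@tri_seq _ _ _ _ _ _ _ _ _ (fun s1 => [/\ frame [:: 21]%N [:: 18]%N s s1,
  draws s1 = draws s &
  forall t a, (a < d)%N -> rmem s1 18 (t * d + a) =
    \sum_(i < n) (if pos i == t then W i *
       (if a.+1 == d then 0 else ent i a) else 0)])).
  apply: tri_weaken (tri_acc _ _ _ _ _ _ _) _ _ => //.
    by rewrite /= /upd /= (ctx_z cs) leq_fortime.
  move=> s1 [fr1 dr1 h1]; split => //; first exact: cframe_frame.
  move=> t a ad; rewrite h1 h18 add0r /= /upd /= (ctx_z cs) (ctx_d cs).
  pose G i a' := if (pos i * d + a' == t * d + a)%N then
     W i * (1 - (a'.+1 == d)%:R) else 0.
  transitivity (\sum_(e < z) G (crow e) (ccol e) * vals e).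
    apply: eq_bigr => e _; have ez := ltn_ord e.
    rewrite (ctx_row cs)// (ctx_col cs)// (ctx_val cs)// hp ?hw ?crow_lt//.
    rewrite lastE ?ccol_lt// /G; case: ifP => _; rewrite ?mul0r//; ring.
  rewrite (sum_entries _ crow_lt ccol_lt); apply: eq_bigr => i _.
  rewrite (eq_bigr (fun a' : 'I_d => if (a' : nat) == a then
     (if pos i == t then W i * (if a'.+1 == d then 0 else ent i a') else 0) else 0)).
    by rewrite (sum_pick d a (fun a' => if pos i == t then
       W i * (if a'.+1 == d then 0 else ent i a') else 0)) ad.
  move=> a' _; rewrite /G; case: (eqVneq (pos i) t) => [->|pt].
    rewrite eqn_add2l; case: eqP => _; last by rewrite mul0r.
    by case: eqP => _ /=; rewrite ?subrr ?mulr0 ?mul0r ?subr0 ?mulr1.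
  rewrite if_same ifF ?mul0r//.
  by apply/eqP => /(radix_inj (ltn_ord a') ad)[e _]; rewrite e eqxx in pt.
move=> s1 [fr1 dr1 h1].
have cs1 : ctx s1 by apply: ctx_frame fr1 cs _ _.
apply: tri_weaken (tri_acc _ _ _ _ _ _ _) _ _ => //.
  by rewrite /= /upd /= (ctx_z cs1) leq_fortime.
move=> s2 [fr2 dr2 h2]; split.
- by apply: frame_trans (frame_sub fr1 _ _) (frame_sub (cframe_frame fr2) _ _).
- by rewrite dr2.
- by move=> t a ad; rewrite fr2.2// h1.
move=> t; rewrite h2 fr1.2// h19 add0r /= /upd /= (ctx_z cs1) (ctx_d cs1).
pose G i a' := if pos i == t then - W i * (a'.+1 == d)%:R else 0.
transitivity (\sum_(e < z) G (crow e) (ccol e) * vals e).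
  apply: eq_bigr => e _; have ez := ltn_ord e.
  rewrite (ctx_row cs1)// (ctx_col cs1)// (ctx_val cs1)// fr1.1// fr1.2//.
  rewrite hp ?hw ?crow_lt// lastE ?ccol_lt// /G.
  by case: ifP => _; rewrite ?mul0r//; ring.
rewrite (sum_entries _ crow_lt ccol_lt) -sumrN; apply: eq_bigr => i _.
rewrite /G; case: ifP => _; last by rewrite oppr0 big1// => a _; rewrite mul0r.
case: (posnP d) => [d0|d0].
  have e0 : ent i d.-1 = 0.
    rewrite /ent big1// => e _; have := ccol_lt (ltn_ord e).
    by rewrite d0.
  rewrite e0 mulr0 oppr0 big1// => a _; have ad := ltn_ord a; exfalso.
  by move: (nat_of_ord a) ad => k; rewrite d0.
have dd : (d.-1 < d)%N by rewrite prednK.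
rewrite (eq_bigr (fun a' : 'I_d => if (a' : nat) == d.-1 then
   - (W i * ent i a') else 0)).
  by rewrite (sum_pick d d.-1 (fun a' => - (W i * ent i a'))) dd.
move=> a' _.
have -> : (a'.+1 == d) = ((a' : nat) == d.-1).
  by move: (nat_of_ord a') => k; apply/eqP/eqP; lia.
by case: eqP => _ /=; [rewrite mulr1 mulNr|rewrite mulr0 mul0r].
Qed.

End SamplingPhase.

(** * Assembling the program *)

Definition eSketchBound : nexp :=
  NMul (NMul (NMul (NConst 60) (NConst 60)) (NMul eD eD)) (NAdd eLG (NConst 1)).

Definition Prefix : cmd :=
  Seq CompactRows
  (Seq (LogLoop 12 13 (NAdd (NAdd eZ eD) (NConst 2)))
  (Seq (LogLoop 14 15 eSketchBound)
  (Seq (NStore 16 (NConst 0) (NMul (NConst 24) (NAdd (NMul (NConst 2) eLG) (NConst 8))))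
  (Seq (Fill 21 eN 3 (rn 1))
       (For 20 (NAdd eLG (NConst 1)) LewisStep))))).

Definition eRoot : rexp := RMul (rn 48) (rn 100).
Definition eCap : rexp :=
  RAdd (RMul (RMul (RMul (rn 30) (rn 100)) (RNat eD)) eNp) (rn 20).

Definition SolveSample : cmd :=
  Seq (If (RLt eEPS (rn 1)) (RStore 20 (NConst 0) eEPS) (RStore 20 (NConst 0) (rn 1)))
  (Seq (RStore 15 (NConst 0) (RDiv (RMul (RMul eRoot eRoot) (RNat eD))
         (RMul (RLoad 20 (NConst 0)) (RLoad 20 (NConst 0)))))
  (Seq (DrawBits (NMul eN eLG))
  (Seq SampleRows
       (If (RLt (RNat (NV 37)) eCap)
           (Seq BuildProblem (Regress (NV 37) eD 18 19 2)) Skip)))).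

Definition Main : cmd :=
  Seq Prefix
      (If (RLt (RMul eEPS eEPS) (RMul (RMul (rn 48) (rn 48)) (RNat eD))) SolveSample Skip).

Section MainProgram.
Variable R : realType.
Variables (phi : nat -> nat -> nat) (solve : lp_solver R) (u : nat -> R).
Local Notation state := (state R).
Local Notation tri := (tri phi solve u).
Variables (d z : nat) (r ccol : nat -> nat) (vals : nat -> R) (p eps : R).
Hypothesis ccol_lt : forall e, (e < z)%N -> (ccol e < d)%N.

Definition nrows : nat := size (firsts r z).
Definition crow (e : nat) : nat := index (r e) (firsts r z).
(** [2^loglen] is at least the number of nonzero rows. So [loglen] rounds reduce the contribution of
    the initial sum to at most 1, and capping the exponents at [loglen] adds at most one kept row on
    average. *)
Definition loglen : nat := up_log 2 (z + d + 2).
(* 2^sketchlog buckets and numproj projections make each of the loglen + 1 rounds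
   fail with probability at most 1/(100 (loglen + 1)), by step_failure. *)
Definition sketchlog : nat := up_log 2 (60 * 60 * (d * d) * (loglen + 1)).
Definition numproj : nat := 24 * (2 * loglen + 8).

Local Notation n := nrows.
Local Notation lg := loglen.
Local Notation lm := sketchlog.
Local Notation K := numproj.
Local Notation ctx := (@ctx R d z n lg lm K crow ccol vals p eps).
Local Notation A := (@ent R z crow ccol vals).

Definition steplen : nat := n * lm.+1 + K * d.
Definition weights (t : nat) (c : nat -> bool) : nat -> R :=
  lewis_run p n d A lm K t (fun=> 1) c.
(** The last round sketches the form of [weights lg] and only then updates to [weights lg.+1]; this
    explains the index. *)
Definition prelimsol (c : nat -> bool) (a : nat) : R :=
  let Q := gram (2 ^ lm) (sketch_of p n A lm (weights lg c) (sshift (lg * steplen) c)) in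
  gsf d Q (gs d Q d.-1) d.-1 a.

Record init_state (s : state) : Prop := InitState {
  init_d : nmem s 0 1 = d;
  init_z : nmem s 0 2 = z;
  init_row : nmem s 1 = r;
  init_col : forall e, (e < z)%N -> nmem s 2 e = ccol e;
  init_val : forall e, (e < z)%N -> rmem s 1 e = vals e;
  init_p : rmem s 0 0 = p;
  init_eps : rmem s 0 1 = eps;
  init_draws : draws s = 0%N;
  init_n0 : forall a i, a \in [:: 11; 30; 36; 37]%N -> nmem s a i = 0%N;
  init_r0 : forall a i, a \in [:: 17; 18; 19]%N -> rmem s a i = 0 }.

Lemma crow_lt e : (e < z)%N -> (crow e < n)%N.
Proof. by move=> ez; rewrite index_mem mem_firsts. Qed.

Definition prefixtime : nat :=
  (fortime z 2 60 + ((10 + lg.+1 * 60) + ((10 + lm.+1 * 80) + (30 +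
   (fortime n 2 10 + fortime lg.+1 4 (steptime d z n lm K))))))%N.

Definition NApre : seq nat := [:: 11; 12; 13; 14; 15; 16; 20; 21; 22; 23; 30; 31; 32; 33; 34]%N.
Definition RApre : seq nat := [:: 2; 3; 4; 5; 6; 7; 8; 9; 10; 11; 12; 13]%N.

Lemma tri_prefix s : init_state s ->
  tri Prefix s prefixtime
    (fun s' => [/\ ctx s', frame NApre RApre s s', draws s' = (lg.+1 * steplen)%N,
       (forall i, (i < n)%N -> rmem s' 3 i = weights lg.+1 (coins u) i) &
       ((0 < d)%N -> forall a, (a < d)%N -> rmem s' 2 a = prelimsol (coins u) a)]).
Proof.
move=> si.
apply: tri_seq (tri_compact _ _ _ (init_z si) _ _) _.
- exact: (init_n0 si).
- by move=> x; exact: (init_n0 si).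
move=> s1 [fr1 dr1 h1 h1']; rewrite (init_row si) in h1 h1'.
have F1 : frame NApre RApre s s1 by exact: frame_sub fr1 _ _.
have sd (s' : state) : frame NApre RApre s s' -> nmem s' 0 1 = d /\ nmem s' 0 2 = z.
  by move=> F; rewrite F.1// (init_d si) (init_z si).
apply: tri_seq.
  apply: tri_weaken (@tri_log _ phi solve u s1 12 13 _ (z + d + 2) _ _ _) _ (fun _ h => h) => //.
    by have [e1 e2] := sd _ F1; rewrite /= e1 e2.
  by apply: leq_add => //; exact: leq_mul.
move=> s2 [fr2 dr2 lg2 _].
have F2 : frame NApre RApre s s2 by apply: frame_trans F1 _; exact: frame_sub fr2 _ _.
apply: tri_seq.
  apply: tri_weaken (@tri_log _ phi solve u s2 14 15 eSketchBound
    (60 * 60 * (d * d) * (lg + 1)) _ _ _) _ (fun _ h => h) => //.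
    by have [e1 e2] := sd _ F2; rewrite /= e1 lg2.
  by apply: leq_add => //; exact: leq_mul.
move=> s3 [fr3 dr3 lm3 mm3].
have F3 : frame NApre RApre s s3 by apply: frame_trans F2 _; exact: frame_sub fr3 _ _.
have lg3 : nmem s3 12 0 = lg by rewrite fr3.1.
apply: (@tri_seq _ _ _ _ _ _ _ _ _ (fun s4 => ctx s4 /\
    [/\ frame NApre RApre s s4 & draws s4 = 0%N])).
  apply: tri_nstore => //=; split; last first.
    by split; [frame_upd F3|rewrite /= dr3 dr2 dr1 (init_draws si)].
  have [e1 e2] := sd _ F3.
  have h31 e : (e < z)%N -> nmem s3 31 e = crow e.
    by move=> ez; rewrite fr3.1// fr2.1// h1'.
  split; rewrite /= ?/upd /= ?e1 ?e2 ?lg3//.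
  - by rewrite fr3.1// fr2.1// h1.
  - by move=> e ez; rewrite F3.1// (init_col si).
  - by move=> e ez; rewrite F3.2// (init_val si).
  - by rewrite F3.2// (init_p si).
  - by rewrite F3.2// (init_eps si).
move=> s4 [cs4 [F4 dr4]].
apply: (@tri_seq _ _ _ _ _ _ _ _ _ (fun s5 => [/\ frame NApre RApre s s5,
   draws s5 = 0%N, ctx s5 & forall i, (i < n)%N -> rmem s5 3 i = 1])).
  apply: tri_weaken (tri_fill _ _ _ _ _ _) _ _ => //.
    by rewrite /= (ctx_n cs4) leq_fortime.
  move=> s5 [fr dr h]; split.
  - by apply: frame_trans F4 _; exact: frame_sub fr _ _.
  - by rewrite dr.
  - by apply: ctx_frame fr cs4 _ _.
  - by move=> i i_n; rewrite h /= (ctx_n cs4) i_n.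
move=> s5 [F5 dr5 cs5 hv5].
pose I t (s' : state) := [/\ frame NApre RApre s s' /\ nmem s' 20 0 = t,
   ctx s', draws s' = (t * steplen)%N,
   (forall i, (i < n)%N -> rmem s' 3 i = weights t (coins u) i) &
   ((0 < d)%N -> t = lg.+1 -> forall a, (a < d)%N -> rmem s' 2 a = prelimsol (coins u) a)].
apply: (@tri_weaken _ _ _ _ _ _ (fortime lg.+1 4 (steptime d z n lm K)) _ (I lg.+1)) => //;
  last by move=> s' [[fr _] cs dr hv hf]; split => // d0; exact: hf.
apply: (@tri_for _ _ _ _ 20 (NAdd eLG (NConst 1))).
- move=> k s' _ [[fr <-] cs _ _ _]; split => //=.
  by rewrite (ctx_lg cs) addn1.
- split => //=; first by split => //; exact: frame_trans F5 (frame_setnl _ _ _ _).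
  by apply: ctx_frame (frame_setnl [::] s5 0 (mem_head 20%N [::])) cs5 _ _.
move=> t s' tT [[fr ht] cs dr hv hf].
apply: tri_weaken (@tri_lewisstep R phi solve u d z n lg lm K crow ccol vals p eps
  crow_lt ccol_lt s' _ cs hv) (leqnn _) _.
move=> s'' [fr2' dr2' hv2 hf2].
have F'' : frame NApre RApre s s''.
  by apply: frame_trans fr _; exact: frame_sub fr2' _ _.
have cE : sshift (draws s') (coins u) = sshift (t * steplen) (coins u) by rewrite dr.
rewrite cE in hv2 hf2.
split; first by rewrite fr2'.1.
split => //=.
- split; last by [].
  exact: frame_trans F'' (frame_setnl _ _ _ _).
- apply: ctx_frame (frame_setnl [::] s'' t.+1 (mem_head 20%N [::])) _ _ _ => //.
  exact: ctx_frame fr2' cs _ _.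
- by rewrite dr2' dr mulSnr.
- move=> d0 [tE] a ad; rewrite (hf2 d.-1 a)//; last by rewrite prednK.
  by rewrite /prelimsol tE.
Qed.

Definition epsmin : R := if eps < 1 then eps else 1.
(** [48 * 100 = 12 * 400], so that a Lewis sum of [144 d] divided by this rate is
    [(epsmin / 400)^2], the square of the parameter [theta] in the sampling bounds. *)
Definition samprate : R := (48 * 100) * (48 * 100) * d%:R / (epsmin * epsmin).
(* The sample is small enough with probability 9/10, by Markov. *)
Definition sampcap : R := 30 * 100 * d%:R * samprate + 20.
Definition sampcoins (c : nat -> bool) := sshift (lg.+1 * steplen) c.
Definition sampsize (c : nat -> bool) : nat :=
  samppos lg p (weights lg.+1 c) samprate (sampcoins c) n.

Definition sampW (c : nat -> bool) (i : nat) : R :=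
  if sampkept lg p (weights lg.+1 c) samprate (sampcoins c) i
  then sampwt lg p (weights lg.+1 c) samprate i else 0.
Definition samploc (c : nat -> bool) (i : nat) : nat :=
  if sampkept lg p (weights lg.+1 c) samprate (sampcoins c) i
  then samppos lg p (weights lg.+1 c) samprate (sampcoins c) i else 0.

Definition sampmx (c : nat -> bool) : 'M[R]_(sampsize c, d) :=
  \matrix_(t, a) \sum_(i < n) (if samploc c i == t then sampW c i *
     (if (a : nat).+1 == d then 0 else A i a) else 0).
Definition sampcv (c : nat -> bool) : 'cV[R]_(sampsize c) :=
  \col_t (- \sum_(i < n) (if samploc c i == t then sampW c i * A i d.-1 else 0)).

Definition small_eps : bool := eps * eps < 48 * 48 * d%:R.

Definition sample_ok (c : nat -> bool) : bool :=
  small_eps && ((sampsize c)%:R < sampcap).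

Definition regresscost (c : nat -> bool) : nat :=
  if sample_ok c then phi (sampsize c) d else 0%N.

Definition sampletime (c : nat -> bool) : nat :=
  (100 + (100 + (fortime (n * lg) 5 20 + (samptime n lg +
    ((fortime z 2 200 + fortime z 2 200) + (30 + regresscost c) + 50)))))%N.

Definition maintime (c : nat -> bool) : nat := (prefixtime + (sampletime c + 50))%N.

Lemma tri_regress em ek aN ac ax s m k (N : 'M[R]_(m, k)) (b : 'cV[R]_m) :
  neval s em = m -> neval s ek = k ->
  read_mx s aN m k = N -> read_cv s ac m = b ->
  tri (Regress em ek aN ac ax) s (ncost em + ncost ek + phi m k).+1
    (fun s' => forall a : 'I_k, rmem s' ax a = solve N b a 0).
Proof.
move=> mE kE NE bE; subst m k N b.
eexists; split; first exact: exec_Regress.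
  by rewrite /= !neval_core.
rewrite /core /= /write_cv => a; rewrite eqxx.
(* The call sees dimensions evaluated in [core s], equal to those of [s] only by a lemma;
   generalizing them allows substitution in the dependent types. *)
have gen m' k' (e1 : m' = neval s em) (e2 : k' = neval s ek) : (a < k')%N ->
    (if insub (a : nat) is Some j then
       solve (read_mx (core s) aN m' k') (read_cv (core s) ac m') j 0 else rmem s ax a) =
    solve (read_mx s aN (neval s em) (neval s ek)) (read_cv s ac (neval s em)) a 0.
  move=> ak; subst m' k'; rewrite insubT /=; congr (solve _ _ _ _).
  exact: val_inj.
by apply: gen; rewrite neval_core.
Qed.

Lemma tri_main s : init_state s -> (0 < d)%N -> tri Main s (maintime (coins u))
    (fun s' => forall a : 'I_d, rmem s' 2 a =
       if sample_ok (coins u) then solve (sampmx (coins u)) (sampcv (coins u)) a 0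
       else prelimsol (coins u) a).
Proof.
move=> si d0; set c := coins u.
apply: tri_seq (tri_prefix si) _ => s1 [cs1 F1 dr1 hv1 hf1].
refine (@tri_weaken _ _ _ _ _ _ (sampletime c + (gcost (RLt (RMul eEPS eEPS)
  (RMul (RMul (rn 48) (rn 48)) (RNat eD)))).+1) _ _ _ _ _ (fun _ h => h));
  last by rewrite leq_add2l.
apply: tri_if => /=; rewrite (ctx_eps cs1) (ctx_d cs1) -/small_eps => g; last first.
  apply: tri_skip => a /=; rewrite /sample_ok (negbTE g) /=; exact: hf1.
set R1 := [:: 20]%N.
apply: (@tri_seq _ _ _ _ _ _ _ _ _ (fun s2 => [/\ frame [::] [:: 20]%N s1 s2,
    draws s2 = draws s1 & rmem s2 20 0 = epsmin])).
  have fr1 : frame [::] [:: 20]%N s1 (core s1) by [].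
  refine (@tri_weaken _ _ _ _ _ _ (50 + (gcost (RLt eEPS (rn 1))).+1)
    _ _ _ _ _ (fun _ h => h)); last by [].
  by apply: tri_if => /=; rewrite (ctx_eps cs1) => h; apply: tri_rstore => //=;
    split => //=; [frame_upd fr1|rewrite /upd /= ?(ctx_eps cs1) /epsmin ?h ?(negbTE h)|
      frame_upd fr1|rewrite /upd /= ?(ctx_eps cs1) /epsmin ?h ?(negbTE h)].
move=> s2 [fr2 dr2 h2].
have cs2 : ctx s2 by apply: ctx_frame fr2 cs1 _ _.
apply: (@tri_seq _ _ _ _ _ _ _ _ _ (fun s3 => [/\ frame [::] [:: 15; 20]%N s1 s3,
    draws s3 = draws s1 & rmem s3 15 0 = samprate])).
  have fr2' : frame [::] [:: 15; 20]%N s1 s2 by exact: frame_sub fr2 _ _.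
  apply: tri_rstore => //=; split => //=; first by frame_upd fr2'.
  by rewrite /upd /= h2 (ctx_d cs2).
move=> s3 [fr3 dr3 h3].
have cs3 : ctx s3 by apply: ctx_frame fr3 cs1 _ _.
apply: (@tri_seq _ _ _ _ _ _ _ _ _ (fun s4 => [/\ frame [:: 21; 32]%N [:: 13; 15; 20]%N s1 s4,
    rmem s4 15 0 = samprate &
    forall k, (k < n * lg)%N -> nmem s4 32 k = sampcoins c k :> nat])).
  apply: tri_weaken (tri_drawbits _ _ _ _ _) _ _ => //.
    by rewrite /= (ctx_n cs3) (ctx_lg cs3).
  move=> s4 [fr dr h]; split.
  - by apply: frame_trans (frame_sub fr3 _ _) (frame_sub fr _ _).
  - by rewrite fr.2.
  - move=> k kl; rewrite h ?dr3 ?dr1//=.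
    by rewrite (ctx_n cs3) (ctx_lg cs3).
move=> s4 [fr4 h4 hb4].
have cs4 : ctx s4 by apply: ctx_frame fr4 cs1 _ _.
have hv4 i : (i < n)%N -> rmem s4 3 i = weights lg.+1 c i.
  by move=> i_n; rewrite fr4.2// hv1.
have z4 a i : a \in [:: 11; 30; 36; 37]%N -> a \in [:: 36; 37]%N -> nmem s4 a i = 0%N.
  move=> a1 a2; rewrite fr4.1; last by move: a2; rewrite !inE => /orP[] /eqP->.
  rewrite F1.1; last by move: a2; rewrite !inE => /orP[] /eqP->.
  exact: (init_n0 si).
have y4 a i : a \in [:: 17; 18; 19]%N -> rmem s4 a i = 0.
  move=> a1; rewrite fr4.2; last by move: a1; rewrite !inE => /or3P[] /eqP->.
  rewrite F1.2; last by move: a1; rewrite !inE => /or3P[] /eqP->.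
  exact: (init_r0 si).
apply: tri_seq.
  apply: (@tri_samplerows R phi solve u d z n lg lm K crow ccol vals p eps
    (weights lg.+1 c) samprate (sampcoins c) s4 cs4 hb4 hv4 h4).
  - exact: z4.
  - by move=> i; exact: z4.
  - by move=> i; exact: y4.
move=> s5 [fr5 dr5 h5 hpos5 hw5]; rewrite -/(sampsize c) in h5.
have fr15 : frame [:: 21; 22; 32; 35; 36; 37]%N [:: 13; 14; 15; 17; 20]%N s1 s5.
  by apply: frame_trans (frame_sub fr4 _ _) (frame_sub fr5 _ _).
have cs5 : ctx s5 by apply: ctx_frame fr15 cs1 _ _.
have capE : reval (core s5) eCap = sampcap.
  by rewrite /= (ctx_d cs5) fr5.2// h4.
refine (@tri_weaken _ _ _ _ _ _ (((fortime z 2 200 + fortime z 2 200) +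
   (30 + regresscost c)) + (gcost (RLt (RNat (NV 37)) eCap)).+1)
    _ _ _ _ _ (fun _ h => h)); last by rewrite leq_add2l.
have okE : geval (core s5) (RLt (RNat (NV 37)) eCap) = sample_ok c.
  by rewrite /sample_ok g -capE /= h5.
apply: tri_if => ok; rewrite okE in ok; last first.
  apply: tri_skip => a /=; rewrite (negbTE ok) fr15.2//; exact: hf1.
have y5 a i : a \in [:: 18; 19]%N -> rmem s5 a i = 0.
  move=> a1; rewrite fr5.2; last by move: a1; rewrite !inE => /orP[] /eqP->.
  by apply: y4; move: a1; rewrite !inE => /orP[] /eqP->.
apply: tri_seq.
  apply: (@tri_buildproblem R phi solve u d z n lg lm K crow ccol vals p eps
    crow_lt ccol_lt (weights lg.+1 c) samprate (sampcoins c) s5 cs5 hpos5 hw5).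
  - by move=> j; exact: y5.
  - by move=> j; exact: y5.
move=> s6 [fr6 dr6 hN6 hc6].
have cs6 : ctx s6 by apply: ctx_frame fr6 cs5 _ _.
rewrite /regresscost ok.
apply: tri_weaken (@tri_regress (NV 37) eD 18 19 2 s6 _ _ (sampmx c) (sampcv c) _ _ _ _)
  _ _ => //.
- by rewrite /= fr6.1.
- by rewrite /= (ctx_d cs6).
- by apply/matrixP => t a; rewrite !mxE hN6.
- by apply/matrixP => t a; rewrite !mxE hc6.
- by rewrite /=; lia.
Qed.

End MainProgram.

(** * Correctness *)

Section SampledProblem.
Variable R : realType.
Variables (d z : nat) (r ccol : nat -> nat) (vals : nat -> R) (p eps : R).
Hypotheses (p1 : 1 <= p) (p2 : p < 2) (eps0 : 0 < eps) (d0 : (0 < d)%N).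

Local Notation n := (nrows z r).
Local Notation lg := (loglen d z).
Local Notation lm := (sketchlog d z).
Local Notation K := (numproj d z).
Local Notation A := (@ent R z (crow z r) ccol vals).
Local Notation wts := (@weights R d z r ccol vals p).
Local Notation len := (steplen d z r).
Local Notation emin := (epsmin eps).
Local Notation Np := (samprate d eps).
Local Notation cost := (@lp_cost R p n d A).
Local Notation sJ c := (sampJ lg p (wts lg.+1 c) Np).
Local Notation scost c := (@sampled_cost R p n d A lg (sJ c) (sampcoins d z r c)).
Local Notation size c := (sampsize d z r ccol vals p eps c).
Local Notation Smx c := (@sampmx R d z r ccol vals p eps c).
Local Notation Scv c := (@sampcv R d z r ccol vals p eps c).

(** The last column of the sampled matrix is zero, so the last coordinate of its solution is
    arbitrary and is overwritten by 1. *)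
Definition homog (Y : nat -> R) (a : nat) : R := if a.+1 == d then 1 else Y a.

Lemma mulv_homog Y i : mulv d A (homog Y) i =
  \sum_(a < d) (if (a : nat).+1 == d then 0 else A i a) * Y a + A i d.-1.
Proof.
have dd : (d.-1 < d)%N by rewrite prednK.
have := sum_pick d d.-1 (fun a => A i a); rewrite dd => <-.
rewrite -big_split/=; apply: eq_bigr => a _; rewrite /homog.
have -> : ((a : nat).+1 == d) = ((a : nat) == d.-1) by apply/eqP/eqP; lia.
by case: ifP => _; rewrite ?mul0r ?mulr1 ?add0r ?addr0.
Qed.

Lemma powR_root (x : R) : 0 <= x -> (x `^ p^-1) `^ p = x.
Proof.
move=> x0; rewrite -powRrM mulVf ?powRr1// gt_eqF//.
by move: (p1) => h; lra.
Qed.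

Lemma sampwt_powR v i : (sampwt lg p v Np i) `^ p = 2 ^+ sampJ lg p v Np i.
Proof.
have pn0 : p != 0 by rewrite gt_eqF//; move: (p1) => h; lra.
rewrite /sampwt powR_expR ?expR_gt0// expRK mulrC divfK// sub0r -lnV ?posrE ?exprn_gt0//.
by rewrite lnK ?posrE ?invr_gt0 ?exprn_gt0// -exprVn invrK.
Qed.

Lemma sampled_lp_norm c (Y : nat -> R) (y : 'cV[R]_d) : (forall a : 'I_d, y a 0 = Y a) ->
  lp_norm p (Smx c *m y - Scv c) = scost c (homog Y) `^ p^-1.
Proof.
move=> yY; congr (_ `^ _); rewrite /sampled_cost.
pose h i := mulv d A (homog Y) i.
have := @sum_samppos R n lg p (wts lg.+1 c) Np (sampcoins d z r c) n
  (fun x => `|x| `^ p) h (leqnn _).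
move=> E; transitivity (\sum_(i < n) if sampkept lg p (wts lg.+1 c) Np (sampcoins d z r c) i then
   `|sampW d z r ccol vals p eps c i * h i| `^ p else 0).
  rewrite -[RHS]E.
  apply: eq_bigr => t _; congr (`|_| `^ _); rewrite !mxE opprK.
  under eq_bigr => a _ do rewrite !mxE yY mulr_suml.
  rewrite exchange_big/= -big_split/=; apply: eq_bigr => i _.
  rewrite /h mulv_homog -/(samploc d z r ccol vals p eps c i) -/(sampW d z r ccol vals p eps c i).
  case: ifP => _; last by rewrite addr0 big1// => a _; rewrite mul0r.
  rewrite mulrDr; congr (_ + _); rewrite mulr_sumr; apply: eq_bigr => a _.
  by rewrite mulrA.
apply: eq_bigr => i _; rewrite /sampW keepwt_kept -/(sampkept _ _ _ _ _ i).
case: (sampkept _ _ _ _ _ _); last by rewrite mulr0 mul0r.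
rewrite mulr1 normrM powRM// ger0_norm ?expR_ge0//.
by rewrite sampwt_powR.
Qed.

Lemma emin_gt0 : 0 < emin. Proof. by rewrite /epsmin; case: ifP => _; [exact: eps0|exact: ltr01]. Qed.
Lemma emin_le1 : emin <= 1. Proof. by rewrite /epsmin; case: ltP => [/ltW|]. Qed.
Lemma emin_le : emin <= eps. Proof. by rewrite /epsmin; case: ltP. Qed.
Let dR : 1 <= d%:R :> R. Proof. by rewrite ler1n. Qed.

Lemma samprate_gt0 : 0 < Np.
Proof.
have := emin_gt0 => h.
by rewrite /samprate divr_gt0 ?mulr_gt0//; move: dR => h'; lra.
Qed.

(** The first two fields concern [weights lg], on which the preliminary solution is based;
    [good_step] carries the invariant over to [weights lg.+1], from which the sample is drawn. *)
Record good_coins (c : nat -> bool) : Prop := GoodCoins {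
  good_inv : lewis_inv p n d A (wts lg c);
  good_sum : lewis_sum p n (wts lg c) <= 144 * d%:R;
  good_step : step_good p n d A lm K (wts lg c) (sshift (lg * len) c);
  good_dev : forall x, qform p n d A (wts lg.+1 c) x <= 1 ->
    `|scost c x - cost x| <= emin / 4;
  good_size : (size c)%:R < sampcap d eps }.

Hypothesis A0 : forall i, (i < n)%N -> exists2 a, (a < d)%N & A i a != 0.
Let K0 : (0 < K)%N. Proof. by rewrite /numproj muln_gt0 addn_gt0 orbT. Qed.

Lemma solver_opt (solve : lp_solver R) m k (N : 'M[R]_(m, k)) b (y : 'cV[R]_k) :
  lp_solver_correct p solve -> lp_norm p (N *m solve m k N b - b) <= lp_norm p (N *m y - b).
Proof.
move=> ->; apply: ge_inf; last by exists y.
by exists 0 => _ [x _ <-]; exact: powR_ge0.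
Qed.

Lemma sampled_cost_ge0 c x : 0 <= scost c x.
Proof.
apply: sumr_ge0 => i _; rewrite keepwt_kept.
by rewrite !mulr_ge0 ?exprn_ge0 ?powR_ge0.
Qed.

Lemma output_quality (solve : lp_solver R) c (X Y : nat -> R) :
  lp_solver_correct p solve -> good_coins c ->
  (forall a : 'I_d, X a = if sample_ok d z r ccol vals p eps c
     then solve _ _ (Smx c) (Scv c) a 0 else prelimsol d z r ccol vals p c a) ->
  cost (homog X) <= (1 + eps) `^ p * cost (homog Y).
Proof.
move=> sol [inv sm st dev sz] hX.
have cX := lp_cost_ge0 p n d A (homog X); have cY := lp_cost_ge0 p n d A (homog Y).
have inv1 : lewis_inv p n d A (wts lg.+1 c) by exact: (lewis_inv_step p2 A0 K0 inv st).
(* Both branches give the factor [1 + eps] already for the [p]-th powers. *)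
suff H : cost (homog X) <= (1 + eps) * cost (homog Y).
  apply: le_trans H _; apply: ler_wpM2r => //.
  rewrite -[leLHS]powRr1; last by move: (eps0) => h; lra.
  by apply: ler_powR => //; move: (eps0) => h; lra.
case: (boolP (sample_ok d z r ccol vals p eps c)) => ok.
  have D := sampled_cost_dev p1 p2 inv1 dev.
  have opt : scost c (homog X) <= scost c (homog Y).
    have := @solver_opt solve _ _ (Smx c) (Scv c) (\col_a Y a) sol.
    rewrite (@sampled_lp_norm c X) => [|a]; last by rewrite hX ok.
    rewrite (@sampled_lp_norm c Y) => [|a]; last by rewrite mxE.
    have := sampled_cost_ge0 c (homog X); have := sampled_cost_ge0 c (homog Y).
    move: (scost c _) (scost c _) => b a b0 a0 ab.
    rewrite -(powR_root a0) -(powR_root b0).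
    by apply: ge0_ler_powR => //; rewrite ?nnegrE ?powR_ge0//; move: (p1) => h'; lra.
  have := D (homog X); have := D (homog Y); rewrite !ler_norml.
  have e0 := emin_gt0; have e1 := emin_le1; have ee := emin_le.
  move: (cost (homog X)) (cost (homog Y)) (scost c (homog X)) (scost c (homog Y)) cX cY opt.
  move=> a b a' b' a0 b0 ab.
  move=> /andP[_ h1] /andP[h2 _].
  have : (1 - emin / 4) * a <= (1 + emin / 4) * b by lra.
  (* With [emin <= 1] and [emin <= eps]: [(1 - emin/4) (1 + emin) >= 1 + emin/4]. *)
  have : (1 + emin / 4) * b <= (1 - emin / 4) * ((1 + eps) * b).
    by rewrite mulrA ler_wpM2r//; nra.
  move=> h3 h4; have := le_trans h4 h3.
  by rewrite ler_pM2l//; lra.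
have big : 48 * 48 * d%:R <= eps * eps.
  by move: ok; rewrite /sample_ok sz andbT /small_eps -leNgt.
have dd : d.-1.+1 = d by rewrite prednK.
pose Q := gram (2 ^ lm) (sketch_of p n A lm (wts lg c) (sshift (lg * len) c)).
pose f := gsf d Q (gs d Q d.-1) d.-1.
have fX a : (a < d)%N -> homog X a = f a.
  move=> ad; rewrite /homog; case: eqP => [e|_].
    have -> : a = d.-1 by lia.
    by rewrite /f gsf_diag//; apply: gsP; rewrite leq_pred.
  by have := hX (Ordinal ad); rewrite /= (negbTE ok).
have qf : qform p n d A (wts lg c) f <= 3 * qform p n d A (wts lg c) (homog Y).
  have [skg _] := st.
  have := skg f; have := skg (homog Y).
  rewrite -!/(qform p n d A (wts lg c) _) -!/(sketch_of _ _ _ _ _ _) !ler_norml.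
  have := @gs_last_min R d (2 ^ lm) (sketch_of p n A lm (wts lg c) (sshift (lg * len) c))
    d.-1 (homog Y) dd; rewrite /homog dd eqxx => /(_ erefl).
  rewrite -/Q -/f -/(homog Y); move: (ip _ _ _ f f) => a.
  by move=> h1 /andP[_ h2] /andP[h3 _]; lra.
have mE : cost (homog X) = cost f.
  apply: eq_bigr => i _; congr (`|_| `^ _); apply: eq_bigr => a _.
  by rewrite fX.
have dge0 : 0 <= d%:R :> R by exact: ler0n.
have s1 : 1 <= Num.sqrt d%:R :> R by rewrite -[leLHS]sqrtr1 ler_sqrt.
(* [S = 12 sqrt d], because [S^2 = 144 d] bounds the Lewis sum; the resulting factor
   [4 S = 48 sqrt d] is at most [eps] by [big]. *)
rewrite mE; apply: le_trans (@lp_cost_le R p n d A (wts lg c) p1 p2 inv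
  (12 * Num.sqrt d%:R) f (homog Y) _ _ qf) _.
- by lra.
- by rewrite exprMn sqr_sqrtr//; apply: le_trans sm _; rewrite expr2; lra.
apply: ler_wpM2r => //; rewrite mulrA.
have : (48 * Num.sqrt d%:R) ^+ 2 <= eps ^+ 2 :> R.
  by rewrite exprMn sqr_sqrtr//; apply: le_trans big; rewrite expr2 lexx.
rewrite ler_sqr ?nnegrE ?mulr_ge0 ?sqrtr_ge0 ?(ltW eps0)//.
by move: (Num.sqrt _) s1 => s s1 h; lra.
Qed.

End SampledProblem.

(** * Probability of good coins *)

Section GoodCoinsProbability.
Variable R : realType.
Local Notation coinE := (@coinE R).
Variables (d z : nat) (r ccol : nat -> nat) (vals : nat -> R) (p eps : R).

Local Notation n := (nrows z r).
Local Notation lg := (loglen d z).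
Local Notation lm := (sketchlog d z).
Local Notation K := (numproj d z).
Local Notation A := (@ent R z (crow z r) ccol vals).
Local Notation wts := (@weights R d z r ccol vals p).
Local Notation len := (steplen d z r).
Local Notation emin := (epsmin eps).
Local Notation Np := (samprate d eps).
Local Notation cost := (@lp_cost R p n d A).
Local Notation good := (@good_coins R d z r ccol vals p eps).

(** All rounds but the last, the last round, and the sampling: the split along which
    [good_coins_prob] conditions. *)
Definition numcoins : nat := lg * len + (len + n * lg).

(** This makes the event measurable, although [good_dev] quantifies over a continuum of points. *)
Lemma good_coins_local : coin_local numcoins good.
Proof.
move=> c c' cc'.
have e0 : wts lg c = wts lg c'.
  by apply: lewis_run_local => k kl; apply: cc'; exact: ltn_addr.
have [e1 e2] : lewis_step p n d A lm K (wts lg c) (sshift (lg * len) c) =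
    lewis_step p n d A lm K (wts lg c) (sshift (lg * len) c') /\
    step_good p n d A lm K (wts lg c) (sshift (lg * len) c) =
    step_good p n d A lm K (wts lg c) (sshift (lg * len) c').
  by apply: step_local => k kl; apply: cc'; rewrite /numcoins ltn_add2l ltn_addr.
have e3 : wts lg.+1 c = wts lg.+1 c'.
  by have := e1; rewrite {2}e0.
pose v := wts lg.+1 c.
have kE i : (i < n)%N -> kept lg (sampJ lg p v Np) (sampcoins d z r c) i =
    kept lg (sampJ lg p v Np) (sampcoins d z r c') i.
  move=> i_n; apply: eq_forallb => l; rewrite /sampcoins /sshift cc'// /numcoins mulSn.
  have bl : (l < lg)%N by exact: leq_trans (ltn_ord l) (sampexp_le _ _).
  by have := radix_ltn i_n bl; lia.
have zE : sampsize d z r ccol vals p eps c = sampsize d z r ccol vals p eps c'.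
  rewrite /sampsize /samppos -e3; apply: eq_bigr => i _.
  by rewrite /sampkept kE.
case=> [i1 i2 i3 i4 i5]; split.
- by rewrite -e0.
- by rewrite -e0.
- by rewrite -e0 -e2.
- move=> x; rewrite -e3 => /i4.
  rewrite /sampled_cost (eq_bigr (fun i : 'I_n =>
    keepwt R lg (sampJ lg p v Np) (sampcoins d z r c') 0 i * `|mulv d A x i| `^ p))//.
  by move=> i _; rewrite !keepwt_kept kE.
- by rewrite -zE.
Qed.

Hypotheses (p1 : 1 <= p) (p2 : p < 2) (eps0 : 0 < eps) (d0 : (0 < d)%N).
Hypothesis A0 : forall i, (i < n)%N -> exists2 a, (a < d)%N & A i a != 0.
Let K0 : (0 < K)%N. Proof. by rewrite /numproj muln_gt0 addn_gt0 orbT. Qed.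
Let dR : 1 <= d%:R :> R. Proof. by rewrite ler1n. Qed.

(** Bernoulli's inequality: [(25/24)^24 >= 1 + 24/24 = 2]. *)
Lemma pow_24_25 j : (24 / 25 : R) ^+ (24 * j) <= 2^-1 ^+ j.
Proof.
rewrite exprM; apply: lerXn2r; rewrite ?nnegrE ?exprn_ge0//.
have B : 1 + 24 / 24 <= (25 / 24 : R) ^+ 24.
  have gen k : 1 + k%:R / 24 <= (25 / 24 : R) ^+ k.
    elim: k => [|k IH]; first by rewrite mul0r addr0 expr0.
    rewrite exprS -addn1 natrD.
    have k0 : 0 <= k%:R :> R by exact: ler0n.
    by move: (_ ^+ k) IH => y; nra.
  exact: gen 24.
have -> : 24 / 25 = (25 / 24 : R)^-1 by field.
by rewrite exprVn lef_pV2 ?posrE//; move: (_ ^+ 24) B => y; lra.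
Qed.

Lemma nrows_le : (n <= 2 ^ lg)%N.
Proof.
have nz : (n <= z)%N by exact: firsts_size.
have zl : (z + d + 2 <= 2 ^ lg)%N by exact: up_logP.
lia.
Qed.

(** [225 = 3600 / 16] comes from the number of buckets. For the projections, [n <= 2^lg] and
    [2^-(2 lg + 8)] leave [2^-lg / 256], and [2^lg >= lg + 1]. Finally [1/225 + 1/256 <= 1/100]. *)
Lemma step_failure : 16 * d%:R ^+ 2 / (2 ^ lm)%:R + n%:R * (24 / 25) ^+ K <=
  (100 * (lg%:R + 1))^-1 :> R.
Proof.
have lg0 : 0 <= lg%:R :> R by exact: ler0n.
have h1 : 16 * d%:R ^+ 2 / (2 ^ lm)%:R <= (225 * (lg%:R + 1))^-1 :> R.
  have lP : (60 * 60 * (d * d) * (lg + 1) <= 2 ^ lm)%N by exact: up_logP.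
  have : (60 * 60 * (d * d) * (lg + 1))%:R <= (2 ^ lm)%:R :> R by rewrite ler_nat.
  rewrite !natrM natrD => h.
  rewrite ler_pdivrMr; last by rewrite ltr0n expn_gt0.
  rewrite [leRHS]mulrC ler_pdivlMr; last by lra.
  by move: h; rewrite expr2; lra.
have h2 : n%:R * (24 / 25) ^+ K <= (256 * (lg%:R + 1))^-1 :> R.
  apply: (@le_trans _ _ (2 ^+ lg * 2^-1 ^+ (2 * lg + 8))).
    rewrite ler_pM// ?pow_24_25// ?exprn_ge0//.
    by rewrite -natrX ler_nat nrows_le.
  have -> : (2 * lg + 8 = lg + (lg + 8))%N by lia.
  rewrite exprD mulrA -exprMn divff// expr1n mul1r exprD invfM mulrC.
  apply: ler_pM => //; rewrite ?exprn_ge0//.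
    by rewrite exprVn lef_pV2 ?posrE ?exprn_gt0// -natrX ler_nat.
  have lg1 : 0 < lg%:R + 1 :> R by lra.
  rewrite exprVn lef_pV2 ?posrE ?exprn_gt0//.
  by rewrite -natrX natr1 ler_nat ltn_expl.
apply: le_trans (lerD h1 h2) _.
rewrite !invfM -mulrDl; apply: ler_wpM2r; last by lra.
by rewrite invr_ge0; lra.
Qed.

Lemma sample_failure v (J := sampJ lg p v Np) : lewis_inv p n d A v ->
  lewis_sum p n v <= 144 * d%:R ->
  coinE (n * lg) (fun c => ind R (~ ((forall x, qform p n d A v x <= 1 ->
      `|sampled_cost p n d A lg J c x - cost x| <= emin / 4) /\
    (\sum_(i < n) kept lg J c i)%:R < sampcap d eps))) <= 5^-1.
Proof.
move=> inv sm.
have e0 := emin_gt0 eps0; have Np0 := samprate_gt0 eps0 d0; have D1 := dR.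
have JL i : (i < n)%N -> (J i <= lg)%N by move=> _; exact: sampexp_le.
have Jle i : (i < n)%N -> (0 < J i)%N -> Np * lewis p v i <= 2^-1 ^+ J i.
  move=> _ J0; rewrite -(prednK J0); apply: (@sampexp_before R lg).
  by rewrite prednK.
have Jgt i : (i < n)%N -> (J i < lg)%N -> 2^-1 ^+ J i < 2 * (Np * lewis p v i).
  move=> _ Jl; have : 2^-1 ^+ (J i).+1 < Np * lewis p v i by exact: sampexp_at Jl.
  by rewrite exprS; move: (2^-1 ^+ J i) (Np * lewis p v i) => a b h; lra.
(* With [theta = emin / 400] and deviation [emin / 4], the bound [10 * theta / eta] of
   [sampling_prob] is 1/10. *)
have th0 : 0 < emin / 400 by apply: divr_gt0; [exact: e0|rewrite ltr0n].
have Sle : lewis_sum p n v / Np <= (emin / 400) ^+ 2.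
  rewrite ler_pdivrMr//; apply: le_trans sm _; rewrite le_eqVlt; apply/orP; left.
  by apply/eqP; rewrite /samprate; field; rewrite gt_eqF.
have eta0 : 0 < emin / 4 by rewrite divr_gt0.
have B1 := sampling_prob p1 p2 inv Np0 th0 JL Jle Sle eta0.
have B2 := kept_mean p1 p2 Np0 th0 JL Sle Jgt.
have DN : 0 <= d%:R * Np by rewrite mulr_ge0// ltW.
have cap0 : 0 < sampcap d eps.
  by rewrite /sampcap; move: Np d%:R DN => a b h; lra.
have capV : 0 <= (sampcap d eps)^-1 by rewrite invr_ge0 ltW.
have n1 : n%:R * 2^-1 ^+ lg <= 1 :> R.
  rewrite exprVn ler_pdivrMr ?exprn_gt0// mul1r -natrX ler_nat.
  exact: nrows_le.
set dev := fun c x => `|sampled_cost p n d A lg J c x - cost x|.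
apply: (@le_trans _ _ (coinE (n * lg) (fun c =>
    ind R (exists2 x, qform p n d A v x <= 1 & emin / 4 < dev c x) +
    (sampcap d eps)^-1 * (\sum_(i < n) kept lg J c i)%:R))).
  apply: le_coinE => c; apply: ind_le => [|h].
    by apply: addr_ge0; [exact: ind_ge0|exact: mulr_ge0].
  case: (EM (exists2 x, qform p n d A v x <= 1 & emin / 4 < dev c x)) => [ex|ne].
    by rewrite indT// lerDl mulr_ge0.
  rewrite indF// add0r mulrC ler_pdivlMr// mul1r leNgt; apply/negP => h'.
  apply: h; split => // x qx; rewrite leNgt; apply/negP => h2.
  by apply: ne; exists x.
rewrite coinED coinEZ.
have b1 : coinE (n * lg) (fun c => ind R (exists2 x, qform p n d A v x <= 1 &
    emin / 4 < dev c x)) <= 10^-1.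
  apply: le_trans B1 _; rewrite le_eqVlt; apply/orP; left; apply/eqP.
  by field; rewrite gt_eqF.
have b2 : (sampcap d eps)^-1 * coinE (n * lg)
    (fun c => (\sum_(i < n) kept lg J c i)%:R) <= 10^-1.
  rewrite mulrC ler_pdivrMr//; apply: le_trans B2 _.
  have : 2 * Np * lewis_sum p n v <= 2 * Np * (144 * d%:R).
    by rewrite ler_wpM2l// mulr_ge0// ltW.
  by rewrite /sampcap; move: n1 DN; lra.
by have := lerD b1 b2; lra.
Qed.

(** Condition on the first rounds, then on the last round: the failures add up to
    [1/100 + 15/144 + 1/100 + 1/5]. *)
Lemma good_coins_prob : coinE numcoins (fun c => ind R (~ good c)) <= 2^-1.
Proof.
have SF := step_failure; have lg0 : 0 <= lg%:R :> R by exact: ler0n.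
have l1 : 0 < 100 * (lg%:R + 1) :> R by lra.
set delta := _ + _ in SF.
have D1 := dR.
have d144 : 0 < 144 * d%:R :> R by lra.
have P1 := lewis_run_prob p1 p2 A0 lm K0 lg d144 (lewis_inv1 p n d A).
rewrite -/delta in P1.
set E1 := fun v => lewis_inv p n d A v /\ lewis_sum p n v <= 144 * d%:R.
(* 1/100 bounds the failing rounds. Otherwise the sum has mean at most [1 + 14 d <= 15 d], as the
   initial sum is the number of rows, at most [4^lg]. *)
have b1 : coinE (lg * len) (fun c => ind R (~ E1 (wts lg c))) <= 100^-1 + 15 / 144.
  apply: le_trans P1 _; apply: lerD.
    apply: le_trans (ler_wpM2l lg0 SF) _.
    by rewrite ler_pdivrMr//; lra.
  rewrite ler_pdivrMr//.
  have : lewis_sum p n (fun=> 1) / 4 ^+ lg <= 1.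
    rewrite ler_pdivrMr ?exprn_gt0// mul1r /lewis_sum.
    under eq_bigr do rewrite /lewis ln1 mulr0 expR0.
    rewrite sumr_const card_ord -natrX ler_nat.
    by apply: leq_trans nrows_le _; case: (posnP lg) => [->|l0]; rewrite ?expn0// leq_exp2r.
  by lra.
have dl : delta <= 100^-1.
  by apply: le_trans SF _; rewrite lef_pV2 ?posrE//; lra.
rewrite /numcoins coinE_cat.
apply: (@le_trans _ _ (coinE (lg * len) (fun c => ind R (~ E1 (wts lg c)) +
   (100^-1 + 5^-1)))); last first.
  by rewrite coinED coinE_cst; lra.
apply: le_coinE => c; case: (EM (E1 (wts lg c))) => [[i1 i2]|ne]; last first.
  apply: (@le_trans _ _ (coinE (len + n * lg) (fun=> 1))).
    by apply: le_coinE => c'; exact: ind_le1.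
  by rewrite coinE_cst [X in _ <= X + _]indT//; lra.
have -> : ind R (~ E1 (wts lg c)) = 0 by apply: indF => h; apply: h.
rewrite add0r.
apply: (@le_trans _ _ (coinE len (fun c' =>
    ind R (~ step_good p n d A lm K (wts lg c) c') + 5^-1))); last first.
  rewrite coinED coinE_cst lerD2r; apply: le_trans dl.
  exact: step_good_prob.
rewrite coinE_cat; apply: le_coinE => c2.
case: (EM (step_good p n d A lm K (wts lg c) c2)) => [st|ne]; last first.
  apply: (@le_trans _ _ (coinE (n * lg) (fun=> 1))).
    by apply: le_coinE => c'; exact: ind_le1.
  by rewrite coinE_cst [X in _ <= X + _]indT//; lra.
have -> : ind R (~ step_good p n d A lm K (wts lg c) c2) = 0.
  by apply: indF => h; exact: h.
rewrite add0r.
pose v := lewis_step p n d A lm K (wts lg c) c2.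
have inv : lewis_inv p n d A v by exact: (lewis_inv_step p2 A0 K0 i1 st).
have sm : lewis_sum p n v <= 144 * d%:R.
  apply: le_trans i2; apply: ler_sum => i _; rewrite ler_expR ler_wpM2l//.
    by move: (p1) => h; lra.
  have vi : 0 < v i by have [h _] := inv; exact: h.
  have vle : v i <= wts lg c i by exact: lewis_step_le.
  by rewrite ler_ln// posrE (lt_le_trans vi).
apply: le_trans (sample_failure inv sm); apply: le_coinE => c3.
apply: ind_le => [|h]; first exact: ind_ge0.
rewrite indT// => -[h1 h2]; apply: h.
set cc := scat (lg * len) c (scat len c2 c3).
have w0 : wts lg cc = wts lg c by exact: lewis_run_scat.
have [e1 e2] : lewis_step p n d A lm K (wts lg c) (sshift (lg * len) cc) = v /\
    step_good p n d A lm K (wts lg c) (sshift (lg * len) cc) =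
    step_good p n d A lm K (wts lg c) c2.
  by rewrite sshift_scat; apply: step_local => k kl; rewrite /scat kl.
have w1 : wts lg.+1 cc = v by rewrite -e1 -{1}w0.
have sc : sampcoins d z r cc = c3.
  transitivity (sshift len (sshift (lg * len) cc)); last by rewrite !sshift_scat.
  apply/funext => k; rewrite /sampcoins /sshift; congr cc.
  by rewrite [(lg.+1 * len)%N]mulSn -addnA addnCA.
split; rewrite ?w0//.
- by rewrite e2.
- by move=> x; rewrite w1 sc; exact: h1.
- by rewrite /sampsize w1 sc.
Qed.

End GoodCoinsProbability.

(** * Running time *)

Section Domination.
Variable I : Type.
Implicit Types f g : I -> nat.

(** An O-bound uniform over an arbitrary index type: one constant has to serve all inputs. *)
Definition dominated f g : Prop := exists C, forall i, (f i <= C * g i)%N.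

Lemma dominated_le f g : (forall i, (f i <= g i)%N) -> dominated f g.
Proof. by move=> h; exists 1%N => i; rewrite mul1n. Qed.

Lemma dominated_trans f g h : dominated f g -> dominated g h -> dominated f h.
Proof.
move=> [C hC] [D hD]; exists (C * D)%N => i.
by apply: leq_trans (hC i) _; rewrite -mulnA leq_mul2l hD orbT.
Qed.

Lemma dominated_cst k g : (forall i, (0 < g i)%N) -> dominated (fun=> k) g.
Proof. by move=> g0; exists k => i; rewrite leq_pmulr. Qed.

Lemma dominatedD f f' g : dominated f g -> dominated f' g ->
  dominated (fun i => f i + f' i)%N g.
Proof. by move=> [C hC] [D hD]; exists (C + D)%N => i; rewrite mulnDl leq_add. Qed.

Lemma dominatedM f f' g g' : dominated f g -> dominated f' g' ->
  dominated (fun i => f i * f' i)%N (fun i => g i * g' i)%N.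
Proof. by move=> [C hC] [D hD]; exists (C * D)%N => i; rewrite mulnACA leq_mul. Qed.

Lemma dominatedS f g : (forall i, (0 < g i)%N) -> dominated f g ->
  dominated (fun i => (f i).+1) g.
Proof.
by move=> g0 [C hC]; exists C.+1 => i; rewrite mulSn -[(f i).+1]add1n leq_add.
Qed.

Lemma dominated_fortime (cN : nat) f t g h : (forall i, (0 < g i)%N) ->
  (forall i, (0 < h i)%N) -> dominated f g -> dominated t h ->
  dominated (fun i => fortime (f i) cN (t i)) (fun i => g i * h i)%N.
Proof.
move=> g0 h0 fg th; apply: dominatedM; first exact: dominatedS.
by do 2![apply: dominatedD; last exact: dominated_cst].
Qed.

End Domination.

Section RunningTime.
Variable I : Type.
Variables (d z : I -> nat) (r : I -> nat -> nat).
Hypothesis d0 : forall i, (0 < d i)%N.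

Let n i := nrows (z i) (r i).
Let lg i := loglen (d i) (z i).
Let lm i := sketchlog (d i) (z i).
Let K i := numproj (d i) (z i).
Let L i := (lg i).+1.
Let P k i := (d i ^ k)%N.
Let P0 k i : (0 < P k i)%N. Proof. by rewrite expn_gt0 d0. Qed.
Let L0 i : (0 < L i)%N. Proof. by []. Qed.

Let P_le k j f : (j <= k)%N -> dominated f (P j) -> dominated f (P k).
Proof.
move=> jk h; apply: dominated_trans h _.
by apply: dominated_le => i; rewrite leq_pexp2l.
Qed.

Let d_dom : dominated d (P 1).
Proof. by apply: dominated_le => i; rewrite /P expn1. Qed.

Let P_fortime j k cN f t : dominated f (P j) -> dominated t (P k) ->
  dominated (fun i => fortime (f i) cN (t i)) (P (j + k)).
Proof.
move=> fj tk; apply: dominated_trans (dominated_fortime cN (P0 j) (P0 k) fj tk) _.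
by apply: dominated_le => i; rewrite /P expnD.
Qed.

Let cst k j : dominated (fun=> k) (P j). Proof. exact: dominated_cst. Qed.

Let loop1 k cN : dominated (fun i => fortime (d i) cN k) (P 1).
Proof. exact: (P_fortime _ d_dom (cst _ 0)). Qed.

Let loop2 k cN cN' : dominated (fun i => fortime (d i) cN (fortime (d i) cN' k)) (P 2).
Proof. exact: (P_fortime _ d_dom (loop1 _ _)). Qed.

Let dd_dom : dominated (fun i => d i * d i)%N (P 2).
Proof. exact: dominated_le. Qed.

Let gsbody_dom : dominated (fun i => gsbodytime (d i)) (P 2).
Proof.
rewrite /gsbodytime; do ![apply: dominatedD | exact: cst | exact: loop2].
all: exact: P_le (loop1 _ _).
Qed.

Let Z i := (z i).+1.
Let Z0 i : (0 < Z i)%N. Proof. by []. Qed.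
Let z_dom : dominated z Z. Proof. by apply: dominated_le => i; exact: leqnSn. Qed.
Let n_dom : dominated n Z.
Proof. by apply: dominated_le => i; exact: leqW (firsts_size _ _). Qed.

Let projbody_dom : dominated (fun i => projbodytime (d i) (z i) (n i)) (fun i => P 2 i + Z i)%N.
Proof.
have Q0 i : (0 < P 2 i + Z i)%N by rewrite addn_gt0 P0.
have hP f : dominated f (P 2) -> dominated f (fun i => P 2 i + Z i)%N.
  by move/dominated_trans; apply; apply: dominated_le => i; exact: leq_addr.
have hZ f : dominated f Z -> dominated f (fun i => P 2 i + Z i)%N.
  by move/dominated_trans; apply; apply: dominated_le => i; exact: leq_addl.
have loopZ f cN k : dominated f Z -> dominated (fun i => fortime (f i) cN k) Z.
  move=> fZ; apply: dominated_trans (dominated_fortime cN Z0 (fun=> ltn0Sn 0) fZ _) _.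
    exact: (@dominated_cst _ k).
  by apply: dominated_le => i; rewrite muln1.
rewrite /projbodytime; do ![apply: dominatedD].
all: first [exact/hZ/loopZ | exact/hP/loop2 | exact/hP/P_le/loop1].
Qed.

Let K_dom : dominated K L.
Proof.
by exists 192%N => i; rewrite /K /L /numproj -/(lg i); move: (lg i) => k; lia.
Qed.

Let lg_dom : dominated lg L. Proof. by apply: dominated_le => i; exact: leqnSn. Qed.

Let sketch_arg i := (60 * 60 * (d i * d i) * (lg i + 1))%N.

Let sketch_arg_gt1 i : (1 < sketch_arg i)%N.
Proof.
rewrite /sketch_arg; apply: (@leq_trans (60 * 60 * 1 * 1)%N) => //.
by apply: leq_mul; [apply: leq_mul; rewrite // muln_gt0 d0|rewrite addn1].
Qed.

Let lm_dom : dominated (fun i => (lm i).+1) L.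
Proof.
exists 13%N => i; rewrite /L.
(* [3600 <= 2^12], while [d] and [lg + 1] are both at most [2^lg]. *)
suff : (lm i <= 12 + 3 * lg i)%N by lia.
rewrite /lm /sketchlog; apply: up_log_min => //.
have dl : (z i + d i + 2 <= 2 ^ lg i)%N by exact: up_logP.
have dl2 : (d i <= 2 ^ lg i)%N by apply: leq_trans dl; rewrite -addnA addnCA leq_addr.
have ll : (lg i + 1 <= 2 ^ lg i)%N by rewrite addn1 ltn_expl.
have -> : (2 ^ (12 + 3 * lg i) = 2 ^ 12 * (2 ^ lg i * 2 ^ lg i) * 2 ^ lg i)%N.
  by rewrite -!expnD; congr (_ ^ _)%N; move: (lg i) => k; lia.
by apply: leq_mul => //; apply: leq_mul => //; exact: leq_mul.
Qed.

Let H_dom : dominated (fun i => 2 ^ lm i)%N (fun i => P 2 i * L i)%N.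
Proof.
exists (2 * (60 * 60))%N => i.
have /andP[+ _] := up_log_bounds (ltnSn 1) (sketch_arg_gt1 i).
rewrite -[up_log 2 _]/(lm i) => h.
have -> : (2 * (60 * 60) * (P 2 i * L i) = 2 * sketch_arg i)%N.
  by rewrite /P /L /sketch_arg -mulnn addn1 !mulnA.
case: (lm i) h => [_|k h]; first by rewrite expn0 muln_gt0 (ltn_trans _ (sketch_arg_gt1 i)).
by rewrite expnS leq_mul2l /= ltnW.
Qed.

(** The cost of one round. [d^4] comes from the Gram matrix of the sketch: about [d^2 L] rows, with
    [d^2] products each. *)
Let W i := (L i * (Z i + P 4 i))%N.
Let W0 i : (0 < W i)%N. Proof. by []. Qed.

Let ZL_W f : dominated f (fun i => Z i * L i)%N -> dominated f W.
Proof.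
move/dominated_trans; apply; apply: dominated_le => i.
by rewrite mulnC leq_mul2l leq_addr orbT.
Qed.

Let Z_W f : dominated f Z -> dominated f W.
Proof.
move=> h; apply/ZL_W/(dominated_trans h); apply: dominated_le => i.
exact: leq_pmulr.
Qed.

Let PL_W k f : (k <= 4)%N -> dominated f (fun i => P k i * L i)%N -> dominated f W.
Proof.
move=> k4 /dominated_trans; apply; apply: dominated_le => i.
rewrite mulnC leq_mul2l; apply/orP; right; apply: leq_trans (leq_addl _ _).
by rewrite leq_pexp2l.
Qed.

Let P_W k f : (k <= 4)%N -> dominated f (P k) -> dominated f W.
Proof.
move=> k4 h; apply/(PL_W k4)/(dominated_trans h); apply: dominated_le => i.
exact: leq_pmulr.
Qed.

Let L_W f : dominated f L -> dominated f W.
Proof.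
move=> h; apply/(@PL_W 0) => //; apply: (dominated_trans h); apply: dominated_le => i.
by rewrite mul1n.
Qed.

Let W_mulc k f : dominated f W -> dominated (fun i => k * f i)%N W.
Proof.
move=> [C hC]; exists (k * C)%N => i; by rewrite -mulnA leq_mul2l hC orbT.
Qed.

Let W_for cN k f : dominated f W -> dominated (fun i => fortime (f i) cN k) W.
Proof.
move=> fW; have := @dominated_fortime _ cN f (fun=> k) W (fun=> 1%N) W0 (fun=> ltnSn 0) fW.
move=> /(_ (@dominated_cst _ k _ (fun=> ltnSn 0)))/dominated_trans; apply.
by apply: dominated_le => i; rewrite muln1.
Qed.

Let nS_dom : dominated (fun i => (n i).+1) Z. Proof. exact: dominatedS. Qed.

Let step_dom : dominated (fun i => steptime (d i) (z i) (n i) (lm i) (K i)) W.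
Proof.
rewrite /steptime; apply: dominatedD.
  apply: W_for; apply: dominatedD.
    by apply: ZL_W; exact: dominatedM.
  by apply: (@PL_W 1) => //; under eq_fun do rewrite mulnC; exact: dominatedM.
apply: dominatedD; first by apply/W_mulc/ZL_W; exact: dominatedM.
apply: dominatedD; first exact/W_mulc/Z_W.
apply: dominatedD.
  apply/W_mulc/(dominatedS W0)/dominatedD; last exact: Z_W.
  apply: (@PL_W 3) => //; apply: dominated_trans (dominatedM H_dom d_dom) _.
  by apply: dominated_le => i; rewrite /P expn1 mulnAC -expnSr.
apply: dominatedD.
  apply: dominatedD.
    apply: (@PL_W 4) => //.
    apply: dominated_trans (dominated_fortime 2 _ _ H_dom (loop2 100 2 2)) _.
    - by move=> i; rewrite muln_gt0 P0.
    - exact: P0.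
    by apply: dominated_le => i; rewrite mulnAC /P -expnD.
  by apply/W_mulc/(dominatedS W0)/(@P_W 2).
apply: dominatedD.
  apply: dominatedD; first exact/W_for/(@P_W 2).
  by apply: (@P_W 3) => //; exact: (P_fortime _ d_dom gsbody_dom).
apply: dominatedD; last exact/W_for/Z_W.
apply: dominatedD; first exact/W_for/Z_W.
apply: dominated_trans (dominated_fortime 2 L0 _ K_dom projbody_dom) _.
  by move=> i; rewrite addn_gt0 P0.
apply: dominated_le => i; rewrite /W leq_mul2l; apply/orP; right.
by rewrite addnC leq_add2l leq_pexp2l.
Qed.

Let LW i := (L i * W i)%N.
Let W_LW f : dominated f W -> dominated f LW.
Proof.
move/dominated_trans; apply; apply: dominated_le => i; exact: leq_pmull.
Qed.

Let prefix_dom : dominated (fun i => prefixtime (d i) (z i) (r i)) LW.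
Proof.
have LW0 i : (0 < LW i)%N by [].
rewrite /prefixtime; apply: dominatedD; first exact/W_LW/W_for/Z_W.
apply: dominatedD.
  apply: dominatedD; first exact: dominated_cst.
  by apply/W_LW; under eq_fun do rewrite mulnC; apply/W_mulc/L_W/dominated_le.
apply: dominatedD.
  apply: dominatedD; first exact: dominated_cst.
  by apply/W_LW; under eq_fun do rewrite mulnC; apply/W_mulc/L_W.
apply: dominatedD; first exact: dominated_cst.
apply: dominatedD; first exact/W_LW/W_for/Z_W.
by apply: dominated_fortime step_dom => //; exact: dominated_le.
Qed.

Let samp_dom : dominated (fun i => samptime (n i) (lg i)) W.
Proof.
apply: ZL_W; rewrite /samptime; apply: dominated_fortime => //.
do 2![apply: dominatedD; first exact: dominated_cst].
apply: dominatedD; last exact: dominated_cst.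
have := @dominated_fortime _ 2 lg (fun=> 100%N) L (fun=> 1%N) L0 (fun=> ltnSn 0) lg_dom.
move=> /(_ (@dominated_cst _ _ _ (fun=> ltnSn 0)))/dominated_trans; apply.
by apply: dominated_le => i; rewrite muln1.
Qed.

(** The solver's cost is kept apart with coefficient 1, as [phi] is arbitrary. *)
Lemma maintime_dominated : exists C, forall (R : realType) (phi : nat -> nat -> nat)
    (ccol : nat -> nat) (vals : nat -> R) (p eps : R) (c : nat -> bool) i,
  (maintime phi (d i) (z i) (r i) ccol vals p eps c <=
   C * ((loglen (d i) (z i)).+1 ^ 2 * ((z i).+1 + d i ^ 4)) +
   regresscost phi (d i) (z i) (r i) ccol vals p eps c)%N.
Proof.
have LW0 i : (0 < LW i)%N by [].
have : dominated (fun i => prefixtime (d i) (z i) (r i) +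
    (100 + (100 + (fortime (n i * lg i) 5 20 + (samptime (n i) (lg i) +
    ((fortime (z i) 2 200 + fortime (z i) 2 200) + 30 + 50)))) + 50))%N LW.
  apply: dominatedD => //; apply: dominatedD; last exact: dominated_cst.
  do 2![apply: dominatedD; first exact: dominated_cst].
  apply: dominatedD; first by apply/W_LW/W_for/ZL_W; exact: dominatedM.
  apply: dominatedD; first exact: W_LW.
  do 2![apply: dominatedD; last exact: dominated_cst].
  by apply: dominatedD; exact/W_LW/W_for/Z_W.
move=> [C hC]; exists C => R phi ccol vals p eps c i.
rewrite -mulnn -[(_ * _ * (_ + _))%N]mulnA -/(L i) -/(Z i) -/(P 4 i) -/(W i) -/(LW i).
apply: leq_trans (leq_add (hC i) (leqnn _)); rewrite /maintime /sampletime.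
move: (prefixtime _ _ _) (fortime (_ * _) _ _) (samptime _ _) (fortime (z i) _ _).
by move: (regresscost _ _ _ _ _ _ _ _ _) => *; lia.
Qed.

End RunningTime.

(** * From domination to polylogarithmic bounds *)

Section PolylogBounds.
Variable R : realType.
Variables (p : R) (d z : nat).
Hypothesis d0 : (0 < d)%N.

Let dR : 1 <= d%:R :> R. Proof. by rewrite ler1n. Qed.

Let le_dpow k (a : R) : k%:R <= a -> d%:R ^+ k <= d%:R `^ a.
Proof. by move=> ka; rewrite -powR_mulrn ?ler0n//; exact: ler_powR. Qed.

Let ln2_gt0 : 0 < ln 2 :> R. Proof. by rewrite ln_gt0// ltr1n. Qed.

Lemma le_polylog (C C' f : R) : 0 <= f -> 0 <= C -> C / ln 2 ^+ 2 <= C' ->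
  C * f <= polylog_bound C' 2 f.
Proof.
move=> f0 C0 CC'.
have l2 : 1 <= ln (2 + f) ^+ 2 / ln 2 ^+ 2.
  rewrite ler_pdivlMr ?exprn_gt0// mul1r ler_sqr ?nnegrE ?(ltW ln2_gt0)//.
    by rewrite ler_ln ?posrE; lra.
  by rewrite ln_ge0//; lra.
apply: (@le_trans _ _ (C / ln 2 ^+ 2 * f * ln (2 + f) ^+ 2)); last first.
  by rewrite /polylog_bound !ler_wpM2r ?sqr_ge0.
have -> : C / ln 2 ^+ 2 * f * ln (2 + f) ^+ 2 = C * f * (ln (2 + f) ^+ 2 / ln 2 ^+ 2) by ring.
by rewrite ler_peMr// mulr_ge0.
Qed.

(** Rounding up to a power of 2 at most doubles, so [2^(loglen + 1) <= 8 (2 + f)]; and 8 costs three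
    logarithms of 2, each at most [ln (2 + f)]. *)
Lemma loglen_le (f : R) : z%:R + d%:R <= f ->
  (loglen d z).+1%:R <= 4 / ln 2 * ln (2 + f).
Proof.
move=> zf; set l := loglen d z; rewrite mulrAC ler_pdivlMr//.
have z0 : 0 <= z%:R :> R by exact: ler0n.
have D1 := dR.
have h : (2 ^ l.+1)%:R <= 8 * (2 + f) :> R.
  apply: (@le_trans _ _ (4 * (z + d + 2))%:R).
    rewrite ler_nat.
    have n1 : (1 < z + d + 2)%N by rewrite addn2.
    have /andP[+ _] := up_log_bounds (ltnSn 1) n1; rewrite -[up_log 2 _]/l.
    case: (l) => [|k]; first by rewrite expn0; lia.
    by rewrite /= !expnS; lia.
  by rewrite natrM !natrD; lra.
have f2 : 0 < 2 + f by lra.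
have : ln ((2 ^ l.+1)%:R : R) <= ln (8 * (2 + f)).
  by rewrite ler_ln ?posrE ?mulr_gt0// ltr0n expn_gt0.
rewrite natrX lnXn// lnM ?posrE//.
have -> : (8 : R) = 2 ^+ 3 by rewrite -natrX.
rewrite lnXn// -[X in X <= _]mulr_natl -[X in X + _]mulr_natl => h'.
have : ln 2 <= ln (2 + f) :> R by rewrite ler_ln ?posrE//; lra.
by move: h'; lra.
Qed.

(** [7 - p/2 > 6], so the power of [d] leaves ample room for [d^4]. The two logarithms come from
    [loglen], and [32 = 4^2 * 2]. *)
Lemma maintime_le (C : nat) (T ph : nat) : p < 2 ->
  let f := z%:R + d%:R `^ (7 - p / 2) + ph%:R in
  (T <= C * ((loglen d z).+1 ^ 2 * (z.+1 + d ^ 4)) + ph)%N ->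
  T%:R <= polylog_bound ((32 * C%:R + 1) / ln 2 ^+ 2 : R) 2 f.
Proof.
move=> p2 f hT.
have C0 : 0 <= C%:R :> R by exact: ler0n.
have z0 : 0 <= z%:R :> R by exact: ler0n.
have ph0 : 0 <= ph%:R :> R by exact: ler0n.
have D1 := dR.
have d1 : d%:R <= d%:R `^ (7 - p / 2).
  by have := @le_dpow 1 (7 - p / 2); rewrite expr1; apply; lra.
have d4 : d%:R ^+ 4 <= d%:R `^ (7 - p / 2) by apply: le_dpow; lra.
have f0 : 0 <= f by rewrite /f; lra.
have lf : 0 <= ln (2 + f) by rewrite ln_ge0//; lra.
have zf : z%:R + d%:R <= f by rewrite /f; lra.
have ll := loglen_le zf.
have vf : (z.+1 + d ^ 4)%:R <= 2 * f.
  by rewrite natrD -[z.+1]addn1 natrD natrX /f; lra.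
have : T%:R <= C%:R * ((4 / ln 2 * ln (2 + f)) ^+ 2 * (2 * f)) + ph%:R.
  apply: (@le_trans _ _ (C * ((loglen d z).+1 ^ 2 * (z.+1 + d ^ 4)) + ph)%:R).
    by rewrite ler_nat.
  rewrite natrD natrM [((_ ^ 2 * _)%N)%:R]natrM natrX lerD2r ler_wpM2l// ler_pM//.
  by rewrite ler_sqr ?nnegrE// mulr_ge0// divr_ge0// ltW.
move/le_trans; apply.
have phf : ph%:R <= 1 * f by rewrite /f; lra.
have h1 := @le_polylog 1 (1 / ln 2 ^+ 2) f f0 ler01 (lexx _).
have -> : polylog_bound ((32 * C%:R + 1) / ln 2 ^+ 2 : R) 2 f =
    C%:R * ((4 / ln 2 * ln (2 + f)) ^+ 2 * (2 * f)) + polylog_bound (1 / ln 2 ^+ 2) 2 f.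
  by rewrite /polylog_bound; field; rewrite gt_eqF.
by rewrite lerD2l; exact: le_trans phf h1.
Qed.

Definition cap_factor : R := (30 * 100) * ((48 * 100) * (48 * 100)) * (48 * 48) + 20 * (48 * 48).

(** The cap is of order [d^2 / epsmin^2]. For small [eps] the quantity [48^2 d / eps^2] is at least
    1 and at least [1 / epsmin^2]; its factor [d] leads to [d^3 <= d^(2+p)], by [p >= 1]. *)
Lemma sampcap_le (eps : R) : 1 <= p -> 0 < eps -> eps * eps < 48 * 48 * d%:R ->
  sampcap d eps <= cap_factor * (d%:R `^ (2 + p) / eps ^+ 2).
Proof.
move=> p1 eps0 small; have D1 := dR.
have ee : 0 < eps * eps by exact: mulr_gt0.
have d3 : d%:R * d%:R * d%:R <= d%:R `^ (2 + p).
  have -> : d%:R * d%:R * d%:R = d%:R ^+ 3 :> R by ring.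
  by apply: le_dpow; lra.
have em : (epsmin eps * epsmin eps)^-1 <= 48 * 48 * d%:R / (eps * eps).
  rewrite ler_pdivlMr// mulrC /epsmin; case: ifP => _.
    by rewrite divff ?gt_eqF//; lra.
  by rewrite mulr1 divr1 ltW.
have one : 1 <= 48 * 48 * d%:R / (eps * eps) by rewrite ler_pdivlMr// mul1r ltW.
rewrite /sampcap /samprate.
set E := (epsmin eps * epsmin eps)^-1 in em *.
apply: (@le_trans _ _ (cap_factor * ((d%:R * d%:R * d%:R) / (eps * eps)))); last first.
  rewrite expr2 ler_wpM2l ?ler_wpM2r ?invr_ge0 ?(ltW ee)//.
  by rewrite /cap_factor; lra.
set X := 48 * 48 * d%:R / (eps * eps) in em one.
have -> : cap_factor * ((d%:R * d%:R * d%:R) / (eps * eps)) =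
    30 * 100 * (48 * 100 * (48 * 100)) * (d%:R * d%:R) * X + 20 * (d%:R * d%:R) * X.
  by rewrite /cap_factor /X; field; rewrite gt_eqF.
have dd : 1 <= d%:R * d%:R :> R by nra.
apply: lerD.
  have -> : 30 * 100 * d%:R * (48 * 100 * (48 * 100) * d%:R * E) =
    30 * 100 * (48 * 100 * (48 * 100)) * (d%:R * d%:R) * E by ring.
  by apply: ler_wpM2l em; do ![apply: mulr_ge0]; rewrite ler0n.
by rewrite -mulrA -[leLHS]mulr1; apply: ler_wpM2l; [rewrite ler0n|exact: mulr_ege1].
Qed.

End PolylogBounds.

(** * The input problem *)

Section SparseInput.
Variable R : realType.
Variables (n m : nat) (N : 'M[R]_(n, m)) (entries : seq ('I_n * 'I_m)).
Hypothesis listing : sparse_listing N entries.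

Let z := size entries.
Definition listrow : nat -> nat := nth 0%N [seq nat_of_ord e.1 | e <- entries].
Definition listcol : nat -> nat := nth 0%N [seq nat_of_ord e.2 | e <- entries].
Definition listval : nat -> R := nth 0 [seq N e.1 e.2 | e <- entries].

Local Notation A := (@ent R z (crow z listrow) listcol listval).
Local Notation rows := (firsts listrow z).

Let nonempty e : (e < z)%N -> exists x0, x0 \in entries.
Proof. by rewrite /z; case: (entries) => // x s _; exists x; exact: mem_head. Qed.

Lemma nnz_listing : nnz N = z.
Proof.
have [u h] := listing; rewrite /nnz /z -(card_uniqP u); apply: eq_card => e.
by rewrite inE h.
Qed.

Lemma listcol_lt e : (e < z)%N -> (listcol e < m)%N.
Proof.
move=> ez; have [x0 _] := nonempty ez.
by rewrite /listcol (nth_map x0).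
Qed.

Definition listent (k a : nat) : R :=
  \sum_(e < z) (if (listrow e == k) && (listcol e == a) then listval e else 0).

Lemma listentE (k : 'I_n) (a : 'I_m) : listent k a = N k a.
Proof.
have [u h] := listing.
transitivity (\sum_(e <- entries) (if e == (k, a) then N k a else 0)).
  rewrite (big_nth (k, a)) big_mkord; apply: eq_bigr => e _.
  rewrite /listrow /listcol /listval !(nth_map (k, a))//.
  by case: (nth _ _ _) => k' a'; rewrite xpair_eqE /=; case: ifP => // /andP[/eqP/val_inj-> /eqP/val_inj->].
rewrite big_uniq//= -big_mkcondr/=.
rewrite (eq_bigl (fun e => (e \in entries) && (e == (k, a)))); last by [].
case: (boolP (N k a == 0)) => [/eqP->|Nka]; first by rewrite big1.
rewrite (big_pred1 (k, a))// => e /=; rewrite andb_idl// => /eqP->.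
by rewrite h.
Qed.

Lemma ent_listing i a : (i < nrows z listrow)%N -> A i a = listent (nth 0%N rows i) a.
Proof.
move=> ir; apply: eq_bigr => e _; congr (if _ && _ then _ else _).
rewrite /crow; apply/eqP/eqP => [<-|->]; first by rewrite nth_index// mem_firsts.
by rewrite index_uniq// firsts_uniq.
Qed.

Lemma ent_row_neq0 i : (i < nrows z listrow)%N -> exists2 a, (a < m)%N & A i a != 0.
Proof.
move=> ir; have [e ez re] := firsts_mem (mem_nth 0%N ir).
exists (listcol e); first exact: listcol_lt.
rewrite ent_listing// -re.
have [x0 _] := nonempty ez.
rewrite /listrow /listcol !(nth_map x0)// listentE.
by have [_ <-] := listing; exact: mem_nth.
Qed.

(** Rows outside the listing are zero and contribute [0^p = 0], as [p > 0]. *)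
Lemma lp_cost_listing p x : 0 < p -> lp_cost p (nrows z listrow) m A x =
  \sum_(k < n) `|\sum_(a < m) N k a * x a| `^ p.
Proof.
move=> p0; pose g k := `|\sum_(a < m) listent k a * x a| `^ p.
have gN (k : 'I_n) : g k = `|\sum_(a < m) N k a * x a| `^ p.
  by congr (`|_| `^ _); apply: eq_bigr => a _; rewrite listentE.
rewrite -(eq_bigr _ (fun k _ => gN k)).
transitivity (\sum_(k <- rows) g k).
  rewrite (big_nth 0%N) big_mkord; apply: eq_bigr => i _.
  by congr (`|_| `^ _); apply: eq_bigr => a _; rewrite ent_listing.
have -> : \sum_(k <- rows) g k = \sum_(k <- iota 0 n | k \in rows) g k.
  rewrite -[RHS]big_filter; apply: perm_big; apply: uniq_perm.
  - exact: firsts_uniq.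
  - by rewrite filter_uniq// iota_uniq.
  move=> k; rewrite mem_filter mem_iota /= add0n; case: (boolP (k \in rows)) => //= kr.
  have [e ez <-] := firsts_mem kr.
  have [x0 _] := nonempty ez.
  by rewrite /listrow (nth_map x0)// ltn_ord.
have -> : iota 0 n = index_iota 0 n by rewrite /index_iota subn0.
rewrite big_mkcond big_mkord /=; apply: eq_bigr => k _.
case: ifP => // /negbT kr; rewrite /g big1 ?normr0 ?powR0 ?gt_eqF// => a _.
rewrite /listent big1 ?mul0r// => e _; case: ifP => // /andP[/eqP ek _].
by rewrite -ek mem_firsts in kr.
Qed.

End SparseInput.

Section RegressionInput.
Variable R : realType.
Variables (n d : nat) (M : 'M[R]_(n, d.-1)) (b : 'cV[R]_n) (p eps : R).
Hypothesis d0 : (0 < d)%N.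
Variable entries : seq ('I_n * 'I_(d.-1 + 1)).
Hypothesis listing : sparse_listing (augmented M b) entries.

Local Notation N := (augmented M b).
Local Notation z := (size entries).
Local Notation A := (@ent R z (crow z (listrow entries)) (listcol entries) (listval N entries)).
Local Notation nr := (nrows z (listrow entries)).

Lemma dimE : (d.-1 + 1 = d)%N. Proof. by rewrite addn1 prednK. Qed.

Lemma init_state_input :
  init_state d z (listrow entries) (listcol entries) (listval N entries) p eps
    (input_state N p eps entries).
Proof. by split => // a i; rewrite !inE; do ![case: eqP => [-> //|_]]. Qed.

Hypothesis p1 : 1 <= p.

Lemma regression_cost (x : 'cV[R]_d.-1) (X : nat -> R) : (forall a : 'I_d.-1, x a 0 = X a) ->
  lp_norm p (M *m x - b) = lp_cost p nr d A (homog d X) `^ p^-1.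
Proof.
move=> xX; have p0 : 0 < p by exact: lt_le_trans p1.
have -> : lp_cost p nr d A (homog d X) = lp_cost p nr (d.-1 + 1) A (homog d X).
  by congr (lp_cost p nr _ A _); rewrite dimE.
rewrite (@lp_cost_listing R n (d.-1 + 1) N entries listing p (homog d X) p0).
congr (_ `^ _).
apply: eq_bigr => i _.
congr (`|_| `^ _); rewrite !mxE big_split_ord /=; congr (_ + _).
  apply: eq_bigr => a _; rewrite row_mxEl xX /homog /=.
  by have := ltn_ord a; case: eqP => // ->; lia.
by rewrite big_ord1 row_mxEr mxE /homog /= addn0 prednK// eqxx mulr1.
Qed.

(** The hypothesis compares with every competitor, so the bound passes to the infimum; [(1 + eps)^p]
    becomes [1 + eps] on taking [p]-th roots. *)
Lemma regression_near_opt (X : nat -> R) : 0 < eps ->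
  (forall Y, lp_cost p nr d A (homog d X) <= (1 + eps) `^ p * lp_cost p nr d A (homog d Y)) ->
  lp_norm p (M *m (\col_(a < d.-1) X a) - b) <= (1 + eps) * lp_min p M b.
Proof.
move=> eps0 opt; have e1 : 0 < 1 + eps by lra.
have p0 : p != 0 by rewrite gt_eqF//; move: (p1) => h; lra.
rewrite -ler_pdivrMl//; apply: lb_le_inf; first by eexists; exists 0.
move=> _ [y _ <-]; rewrite ler_pdivrMl//.
pose Y a := if insub a is Some j then y j 0 else 0.
rewrite (@regression_cost _ X) => [|a]; last by rewrite mxE.
rewrite (@regression_cost y Y) => [|a]; last by rewrite /Y valK.
have := opt Y; have := lp_cost_ge0 p nr d A (homog d X).
have := lp_cost_ge0 p nr d A (homog d Y).
move: (lp_cost _ _ _ _ (homog d X)) (lp_cost _ _ _ _ _) => u v v0 u0 uv.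
have -> : (1 + eps) * v `^ p^-1 = ((1 + eps) `^ p * v) `^ p^-1.
  by rewrite powRM ?powR_ge0// -powRrM divff// powRr1// ltW.
apply: ge0_ler_powR => //; rewrite ?nnegrE ?mulr_ge0 ?powR_ge0//.
by rewrite invr_ge0; move: (p1) => h; lra.
Qed.

End RegressionInput.

Theorem theorem5p6 (R : realType) :
  exists (prog : cmd) (q C : R) (e : nat),
    0 < q /\
    forall (n d : nat) (M : 'M[R]_(n, d.-1)) (b : 'cV[R]_n) (p eps : R),
      (0 < d)%N -> 1 <= p < 2 -> 0 < eps ->
    forall entries : seq ('I_n * 'I_(d.-1 + 1)),
      sparse_listing (augmented M b) entries ->
    forall (phi : nat -> nat -> nat) (solve : lp_solver R),
      lp_solver_correct p solve ->
    forall (disp : measure_display) (T : measurableType disp)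
           (P : probability T R) (U : nat -> {RV P >-> R}),
      iid_uniform01 U ->
    exists final : T -> state R,
      (forall w : T,
         exec phi solve (fun k => U k w) prog
              (input_state (augmented M b) p eps entries) (final w)) /\
      (forall w : T, exists t : nat,
         t%:R <= polylog_bound C e (d%:R `^ (2 + p) / eps ^+ 2) /\
         (time (final w))%:R <=
           polylog_bound C e ((nnz (augmented M b))%:R
                              + d%:R `^ (7 - p / 2) + (phi t d)%:R)) /\
      exists A : set T,
        measurable A /\ (q%:E <= P A)%E /\
        forall w : T, A w ->
          lp_norm p (M *m output d.-1 (final w) - b)
            <= (1 + eps) * lp_min p M b.

Proof.
(* Everything that the time bound depends on besides the solver; quantifying over it here fixes [C0]
   before any input is given. *)
pose I := {x : nat * nat * (nat -> nat) | (0 < x.1.1)%N}.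
have [C0 timeC] := @maintime_dominated I (fun i => (sval i).1.1) (fun i => (sval i).1.2)
  (fun i => (sval i).2) (fun i => svalP i).
pose C1 : R := (32 * C0%:R + 1) / ln 2 ^+ 2; pose C2 : R := cap_factor R / ln 2 ^+ 2.
have C1ge0 : 0 <= C1 by rewrite divr_ge0 ?sqr_ge0 ?addr_ge0 ?mulr_ge0.
have cf0 : 0 <= cap_factor R.
  by rewrite /cap_factor; apply: addr_ge0; do ![apply: mulr_ge0]; rewrite ler0n.
have C2ge0 : 0 <= C2 by rewrite divr_ge0 ?sqr_ge0.
have mono (C C' f : R) : C <= C' -> 0 <= f -> polylog_bound C 2 f <= polylog_bound C' 2 f.
  by move=> CC f0; rewrite /polylog_bound !ler_wpM2r ?sqr_ge0.
(* [C1] serves the time and [C2] the sample size; their sum serves both. *)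
exists Main, 2^-1, (C1 + C2), 2%N; split; first by rewrite invr_gt0.
move=> n d M b p eps d0 /andP[p1 p2] eps0 entries listing phi solve sol disp T P U iidU.
set N := augmented M b; set z := size entries.
pose r := listrow entries; pose ccol := listcol entries; pose vals := listval N entries.
have ccol_lt e : (e < z)%N -> (ccol e < d)%N.
  by move=> ez; exact: leq_trans (listcol_lt ez) (eq_leq (dimE d0)).
have A0 i : (i < nrows z r)%N -> exists2 a, (a < d)%N & ent z (crow z r) ccol vals i a != 0.
  move=> ir; have [a am Aa] := ent_row_neq0 listing ir; exists a => //.
  exact: leq_trans am (eq_leq (dimE d0)).
have := fun w => tri_main phi solve (fun k => U k w) ccol_lt
  (init_state_input M b p eps entries) d0.
move=> /choice[final finalP].
exists final; split; first by move=> w; have [] := finalP w.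
split.
  move=> w; have [_ tm _] := finalP w.
  set c := coins (fun k => U k w) in tm.
  (* If the solver is not called, 0 is a legitimate size, and [phi 0 d] only weakens the bound. *)
  pose t := if sample_ok d z r ccol vals p eps c then sampsize d z r ccol vals p eps c else 0%N.
  have g0 : 0 <= d%:R `^ (2 + p) / eps ^+ 2 by rewrite divr_ge0 ?powR_ge0 ?sqr_ge0.
  exists t; split.
    apply: (@le_trans _ _ (cap_factor R * (d%:R `^ (2 + p) / eps ^+ 2))).
      rewrite /t; case: ifP => [/andP[small sz]|_]; last exact: mulr_ge0.
      by apply: le_trans (ltW sz) _; exact: sampcap_le.
    by apply: le_polylog => //; rewrite lerDr.
  rewrite (nnz_listing listing) -/z.
  have f0 : 0 <= z%:R + d%:R `^ (7 - p / 2) + (phi t d)%:R by rewrite !addr_ge0// powR_ge0.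
  apply: le_trans (mono C1 _ _ _ f0); last by rewrite lerDl.
  apply: maintime_le => //; apply: leq_trans tm _.
  have := timeC R phi ccol vals p eps c 
    (@exist _ (fun x : nat * nat * (nat -> nat) => (0 < x.1.1)%N) (d, z, r) d0).
  move=> /leq_trans; apply; rewrite leq_add2l /regresscost /t /=.
  by case: ifP.
have [mA PA] := prob_coin iidU (@good_coins_local R d z r ccol vals p eps).
exists [set w | good_coins d z r ccol vals p eps (coin U w)]; split => //.
split.
  rewrite PA lee_fin.
  have := good_coins_prob p1 p2 eps0 d0 A0.
  set E := coinE _ _ => h.
  have : coinE (numcoins d z r) (fun c => ind R (good_coins d z r ccol vals p eps c)) + E = 1.
    rewrite -coinED -[RHS](coinE_cst (numcoins d z r)); apply: eq_coinE => c.
    by rewrite ind_not; ring.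
  by move: h; lra.
move=> w gw; have [_ _ out] := finalP w; rewrite /output /read_cv.
apply: (@regression_near_opt R n d M b p eps d0 entries listing p1 (rmem (final w) 2) eps0).
move=> Y; exact: (output_quality p1 p2 eps0 d0 A0 Y sol gw out).
Qed.
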